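(* Let $Y=Y_{(n,q)}$ be a cyclic quotient singularity with corresponding chain $(a_2,\dots,a_{e-1})$. (1) For $2\le h\le e-1$ and positive integers $p,d$ with $pd\le\mathrm{length}(Q_\sigma(w^h))$, the general fiber of the deformation $\pi_{h,p}^d$ has exactly a $(a_2,\dots,a_{h-1},a_h-dp,a_{h+1},\dots,a_{e-1})$ singularity in the origin, and $A_{d-1}$ singularities in $p$ other points (where $A_0$ is defined to be smooth). (2) For $2<h<e-1$ and $1\le d\le\#\left(Q_\sigma(w^h)\cap L^h\right)$, the general fiber of the deformation $\overline{\pi}_h^d$ has a $(a_h-d,a_{h+1},\dots,a_{e-1})$ singularity in the origin and a $(a_2,\dots,a_{h-1},d)$ singularity in some other point. In both cases, these are the only singularities in the general fiber.
   Context: Setting. $n,q$ are relatively prime integers with $n\ge 3$ and $0<q<n-1$; $Y=Y_{(n,q)}=\mathbb{C}^2/(\mathbb{Z}/n\mathbb{Z})$ with a generator acting by $\mathrm{diag}(\xi,\xi^q)$, $\xi$ a primitive $n$-th root of unity. Let $N=\mathbb{Z}^2+\mathbb{Z}\cdot\frac1n(1,q)$, $M$ the dual lattice (elements written $[a,b]$), $\sigma\subset N_{\mathbb{R}}$ the cone generated by $(1,0)$ and $(0,1)$; then $Y=\mathrm{Spec}\,\mathbb{C}[M\cap\sigma^\vee]$. Let $n/(n-q)=[a_2,\dots,a_{e-1}]=a_2-1/(a_3-1/(\cdots))$ be the unique continued fraction expansion with all $a_i\ge2$; $e$ is the embedding dimension of $Y$. The minimal generators (Hilbert basis) of $M\cap\sigma^\vee$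 are $w^1=[n,0],w^2,\dots,w^e=[0,n]$, with $w^{i-1}+w^{i+1}=a_iw^i$ for $2\le i\le e-1$. Segments. For $2\le h\le e-1$, $H^h=\{v\in N_{\mathbb{R}}:\langle v,w^h\rangle=1\}$; choosing a point of $N\cap H^h$ as origin makes $H^h$ a one-dimensional vector space with lattice $L^h=N\cap H^h\cong\mathbb{Z}$. It is oriented so that the endpoint of $Q:=Q_\sigma(w^h):=H^h\cap\sigma$ at which $w^e$ vanishes is the left one and the endpoint at which $w^1$ vanishes is the right one. Write $Q=(\beta,\gamma)$, where $(\beta,\gamma)$ denotes the closed segment from $\beta$ to $\gamma$; lengths are measured with respect to $L^h\cong\mathbb{Z}$. Decompositions. For positive integers $p,d$ with $pd\le\mathrm{length}(Q)$, $D_{h,p}^d$ is the Minkowski decomposition $Q=Q_0+Q_1$ with $Q_0=(\beta,\gamma-pd)$, $Q_1=p\cdot(0,d)=(0,pd)$. For $2<h<e-1$, $p=1$ and $1\le d\le\#(Q\cap L^h)$, $\overline{D}_h^d$ is the decomposition $Q=Q_0+Q_1$ with $Q_0=(\beta,c)$, $Q_1=(0,\gamma-c)$, where $c=\lceil\beta+\#(Q\cap L^h)-d\rceil$. Deformations. Given such a decomposition $Q_0=(\beta_0,\gamma_0)$, $Q_1=(\beta_1,\gamma_1)$ (with its $p$), let $N'=L^h\times\mathbb{Z}^2$, $e_0,e_1$ the standard basis of $\mathbb{Z}^2$, $M'$ the dual of $N'$, $\sigma'\subset N'_{\mathbb{R}}$ the cone generated by $(\beta_0,e_0),(\gamma_0,e_0),(\beta_1/p,e_1),(\gamma_1/p,e_1)$,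 and $X=\mathrm{Spec}\,\mathbb{C}[M'\cap\sigma'^\vee]$. The linear map $\varphi:N\to N'$ with $\varphi(a)=(a,1,p)$ for $a\in L^h$ induces a closed embedding $Y\to X$, and $\lambda\mapsto x^{[0,0,1]}-x^{[0,p,0]}$ defines $\pi:X\to\mathbb{A}^1_{\mathbb{C}}=\mathrm{Spec}\,\mathbb{C}[\lambda]$, which is a deformation of $Y$ (Altmann). It is denoted $\pi_{h,p}^d$ if the decomposition is $D_{h,p}^d$, and $\overline{\pi}_h^d$ if it is $\overline{D}_h^d$. Origin. For each $i$ let $v^i$ be the element of the Hilbert basis of $M'\cap\sigma'^\vee$ mapping to $w^i$ under the map $M'\cap\sigma'^\vee\to M\cap\sigma^\vee$ dual to $\varphi$, where $v^h=[0,1,0]$, and put $x_i=x^{v^i}$. The functions $x_1,\dots,x_e$ embed each fiber of $\pi$ in $\mathbb{A}^e$; the origin of a fiber is the point $x_1=\dots=x_e=0$. Chains as singularities. A chain of integers $(b_1,\dots,b_r)$ with all $b_i\ge2$ denotes the cyclic quotient singularity $Y_{(m,c)}$ with $m/(m-c)=[b_1,\dots,b_r]$, $m,c$ coprime, $0<c<m$. For a chain with all $b_i\ge1$, if $b_j=1$ it may be blown down to $(\dots,b_{j-1}-1,b_{j+1}-1,\dots)$ (the entry $b_j$ is deleted and its neighbours are lowered by one; if $b_j$ is the first or last entry, it is deleted and its only neighbour is lowered by one). Blowing down is repeated until no entry equals $1$ or the chain is $(1,1)$ or $(1)$; only chains whose entries stay $\ge1$ throughout are considered. The chain then denotes the cyclic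 quotient singularity of the resulting chain, and denotes a smooth point if the result is $(1,1)$ or $(1)$. $A_{d-1}$ denotes the surface singularity $xy=z^d$.
   Formalization: If the chain at the origin blows down to (1,1) (when pd = length(Q)), the origin is not on the general fiber (e.g. n=4, q=1, h=3, p=d=1, where x_1x_5=λ² at x_3=0); in that case the claim is read as: the fiber has no singularity in the origin. *)

(* Defs.v *)
From HB Require Import structures.
From mathcomp Require Import all_boot all_order all_algebra.
From mathcomp Require Import finmap.
From mathcomp Require Import boolp classical_sets cardinality reals.
From mathcomp Require Import complex.
From mathcomp Require Import (canonicals) mpoly.
From mathcomp Require Import monalg.

Set Implicit Arguments.
Unset Strict Implicit.
Unset Printing Implicit Defensive.

Import Order.TTheory GRing.Theory Num.Theory.

Local Open Scope classical_set_scope.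
Local Open Scope ring_scope.

(* Semigroup algebras K[S], with basis << u >>, u \in S, and
   << u >> * << v >> = << u + v >>. The product of {malg K[S]} is not
   available here, because multinomials requires the monoid of exponents
   to have no units other than its neutral element.                     *)

Definition sgalg (K : comNzRingType) (S : nmodType) := {malg K[S]}.

Section SemigroupAlgebra.
Context (K : comNzRingType) (S : nmodType).

HB.instance Definition _ := GRing.Lmodule.on (sgalg K S).

Implicit Types (f g : sgalg K S).
Local Open Scope fset_scope.

Definition sgone : sgalg K S := << 1 *g (0 : S)%R >>.

Definition sgmul f g : sgalg K S :=
  \sum_(u <- msupp f) \sum_(v <- msupp g) << f@_u * g@_v *g (u + v)%R >>.

Lemma sgmul_w (d1 d2 : {fset S}) f g :
  msupp f `<=` d1 -> msupp g `<=` d2 ->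
  sgmul f g = \sum_(u <- d1) \sum_(v <- d2) << f@_u * g@_v *g (u + v)%R >>.
Proof.
move=> le1 le2; rewrite /sgmul (big_fset_incl _ le1) /=.
  apply/eq_bigr=> u _; apply/big_fset_incl => // v _ /mcoeff_outdom ->.
  by rewrite mulr0 monalgU0.
move=> u _ /mcoeff_outdom fu.
by rewrite big1 => // v _; rewrite fu mul0r monalgU0.
Qed.

Lemma sgmulC : commutative sgmul.
Proof.
move=> f g; rewrite /sgmul exchange_big /=.
apply/eq_bigr=> u _; apply/eq_bigr=> v _.
by rewrite mulrC addrC.
Qed.

Lemma sgmulDl : left_distributive sgmul +%R.
Proof.
move=> f1 f2 g.
pose d := fsetU (msupp f1) (msupp f2).
rewrite (@sgmul_w d (msupp g) (f1 + f2)%R) ?msuppD_le ?fsubset_refl //.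
rewrite (@sgmul_w d (msupp g) f1) ?fsubsetUl ?fsubset_refl //.
rewrite (@sgmul_w d (msupp g) f2) ?fsubsetUr ?fsubset_refl //.
rewrite -big_split /=; apply/eq_bigr=> u _.
rewrite -big_split /=; apply/eq_bigr=> v _.
by rewrite mcoeffD mulrDl monalgUD.
Qed.

Lemma sgmul0 g : sgmul 0 g = 0.
Proof. by rewrite /sgmul msupp0 big_seq_fset0. Qed.

Lemma sgmulDr : right_distributive sgmul +%R.
Proof. by move=> f g1 g2; rewrite !(sgmulC f) sgmulDl. Qed.

Lemma sgmulr0 f : sgmul f 0 = 0.
Proof. by rewrite sgmulC sgmul0. Qed.

Lemma sgmulUU c1 c2 (u v : S) :
  sgmul << c1 *g u >> << c2 *g v >> = << c1 * c2 *g (u + v)%R >>.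
Proof.
by rewrite (sgmul_w (d1 := [fset u]) (d2 := [fset v])) ?msuppU_le //
           !big_seq_fset1 !mcoeffUU.
Qed.

Lemma sgmul_suml (I : Type) (r : seq I) (F : I -> sgalg K S) g :
  sgmul (\sum_(i <- r) F i) g = \sum_(i <- r) sgmul (F i) g.
Proof. exact: (big_morph (sgmul^~ g) (fun x y => sgmulDl x y g) (sgmul0 g)). Qed.

Lemma sgmul_sumr (I : Type) (r : seq I) f (F : I -> sgalg K S) :
  sgmul f (\sum_(i <- r) F i) = \sum_(i <- r) sgmul f (F i).
Proof. exact: (big_morph (sgmul f) (sgmulDr f) (sgmulr0 f)). Qed.

Lemma sgmulA : associative sgmul.
Proof.
move: sgmul_suml sgmul_sumr sgmulUU.
move: sgmul => m suml sumr mUU f g h.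
rewrite (monalgE f) !suml; apply/eq_bigr=> u _.
rewrite (monalgE g) !(suml, sumr); apply/eq_bigr=> v _.
rewrite (monalgE h) !sumr; apply/eq_bigr=> w _.
by rewrite !mUU mulrA addrA.
Qed.

Lemma sgmul1 : left_id sgone sgmul.
Proof.
move=> f; rewrite {1}(monalgE f) sgmul_sumr [RHS]monalgE.
by apply/eq_bigr=> u _; rewrite /sgone sgmulUU mul1r add0r.
Qed.

Lemma sgone_neq0 : sgone != 0.
Proof. by rewrite monalgU_eq0 oner_eq0. Qed.

HB.instance Definition _ := GRing.Zmodule_isComNzRing.Build (sgalg K S)
  sgmulA sgmulC sgmul1 sgmulDl sgone_neq0.

Lemma sgscaleAl (c : K) f g : c *: (f * g) = (c *: f) * g.
Proof.
have scU d (u : S) : c *: (<< d *g u >> : sgalg K S) = << c * d *g u >>.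
  by apply/malgP=> v; rewrite mcoeffZ !mcoeffU mulrnAr.
change (c *: sgmul f g = sgmul (c *: f) g).
move: sgmul_suml sgmul_sumr sgmulUU; move: sgmul => m suml sumr mUU.
rewrite (monalgE f) scaler_sumr !suml scaler_sumr; apply/eq_bigr=> u _.
rewrite (monalgE g) !sumr scaler_sumr; apply/eq_bigr=> v _.
by rewrite scU !mUU scU mulrA.
Qed.

HB.instance Definition _ := GRing.Lmodule_isLalgebra.Build K (sgalg K S)
  sgscaleAl.
HB.instance Definition _ := GRing.Lalgebra_isComAlgebra.Build K (sgalg K S).

End SemigroupAlgebra.

Definition submonoid (G : zmodType) (P : addrClosed G) : Type :=
  {u : G | u \in P}.

Section Submonoid.
Context (G : zmodType) (P : addrClosed G).
HB.instance Definition _ := SubChoice.on (submonoid P).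
Fact submonoid_closed : addr_closed (fun u : G => u \in P).
Proof. by split=> [|u v]; [exact: rpred0 | exact: rpredD]. Qed.
HB.instance Definition _ :=
  GRing.SubChoice_isSubNmodule.Build G _ (submonoid P) submonoid_closed.
End Submonoid.

(* The Hilbert basis of a monoid without nontrivial units: its minimal
   generators are the nonzero elements that do not decompose.           *)
Definition hilbert_basis (G : zmodType) (P : {pred G}) : set G :=
  [set u | [/\ u \in P, u != 0 &
    forall v w, v \in P -> w \in P -> u = v + w -> v = 0 \/ w = 0]].

(* The monomial x^u; it is only used for u \in P, and is 0 otherwise.   *)
Definition monomial (K : comNzRingType) (G : zmodType) (P : addrClosed G)
    (u : G) : sgalg K (submonoid P) :=
  if (insub u : option (submonoid P)) is Some s then << 1 *g s >> else 0.

(* Closed subschemes of affine schemes. A pair (A, E) of a K-algebra and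
   a set of equations stands for Spec (A / (E)), whose coordinate ring is
   never formed: K-points are the K-algebra morphisms A -> K killing E,
   and a congruence modulo an ideal of A / (E) is one modulo its
   preimage in A.                                                       *)

Section LocalGeometry.
Context (K : fieldType).

Definition ideal_span (A : comAlgType K) (E : set A) : set A :=
  [set f | exists m (c g : 'I_m -> A),
     (forall i, E (g i)) /\ f = \sum_(i < m) c i * g i].

Definition scheme_point (A : comAlgType K) (E : set A) (x : A -> K) : Prop :=
  [/\ scalar x, monoid_morphism x & forall f, E f -> x f = 0].

(* the preimage in A of the k-th power of the maximal ideal of x        *)
Definition maxideal_pow (A : comAlgType K) (E : set A) (x : A -> K) (k : nat)
    : set A :=
  ideal_span ([set f | exists g : 'I_k -> A,
     (forall i, x (g i) = 0) /\ f = \prod_(i < k) g i] `|` E).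

(* Regularity of a point of a surface: the cotangent space m / m^2 has
   dimension 2 (the residue field being K). All schemes below are of pure
   dimension 2.                                                         *)
Definition smooth_at (A : comAlgType K) (E : set A) (x : A -> K) : Prop :=
  exists f1 f2 : A, [/\ x f1 = 0, x f2 = 0 &
    forall g, x g = 0 -> exists! c : K * K,
      maxideal_pow E x 2 (g - (c.1 *: f1 + c.2 *: f2))].

(* The completed local ring at x is represented by coherent sequences of
   elements of A, where f k matters modulo m^k, up to adic_eq.          *)
Definition adic_seq (A : comAlgType K) (E : set A) (x : A -> K)
    (f : nat -> A) : Prop :=
  forall k, maxideal_pow E x k (f k.+1 - f k).

Definition adic_eq (A : comAlgType K) (E : set A) (x : A -> K)
    (f g : nat -> A) : Prop :=
  forall k, maxideal_pow E x k (f k - g k).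

Definition completion_morphism
    (A : comAlgType K) (E : set A) (x : A -> K)
    (B : comAlgType K) (F : set B) (y : B -> K)
    (phi : (nat -> A) -> (nat -> B)) : Prop :=
  [/\ forall f, adic_seq E x f -> adic_seq F y (phi f)
        /\ forall g, adic_seq E x g -> adic_eq E x f g ->
             adic_eq F y (phi f) (phi g),
      forall c : K, adic_eq F y (phi (fun=> c%:A)) (fun=> c%:A),
      forall f g, adic_seq E x f -> adic_seq E x g ->
        adic_eq F y (phi (fun k => f k + g k)) (fun k => phi f k + phi g k) &
      forall f g, adic_seq E x f -> adic_seq E x g ->
        adic_eq F y (phi (fun k => f k * g k)) (fun k => phi f k * phi g k)].

(* Two points have the same singularity if their completed local rings
   are isomorphic K-algebras.                                           *)
Definition same_singularity
    (A : comAlgType K) (E : set A) (x : A -> K)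
    (B : comAlgType K) (F : set B) (y : B -> K) : Prop :=
  exists (phi : (nat -> A) -> (nat -> B)) (psi : (nat -> B) -> (nat -> A)),
  [/\ completion_morphism E x F y phi,
      completion_morphism F y E x psi,
      forall f, adic_seq E x f -> adic_eq E x (psi (phi f)) f &
      forall g, adic_seq F y g -> adic_eq F y (phi (psi g)) g].

(* A_(d-1) is X Y = Z^d at the origin, A_0 being smooth by convention   *)
Definition A_singularity (d : nat) (A : comAlgType K) (E : set A)
    (x : A -> K) : Prop :=
  if d == 1%N then smooth_at E x else
  let X (i : 'I_3) : mpoly.mpoly 3 K := mpoly.mpolyX K (mpoly.mnm1 i) in
  same_singularity E x
    [set X (inord 0) * X (inord 1) - X (inord 2) ^+ d]
    (mpoly.meval (fun=> 0)).

End LocalGeometry.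

(* the continued fraction a_1 - 1/(a_2 - 1/(...))                       *)
Fixpoint hj_fraction (a : seq int) : rat :=
  match a with
  | [::] => 0
  | [:: x] => x%:Q
  | x :: a' => x%:Q - (hj_fraction a')^-1
  end.

Definition expands (n q : nat) (a : seq int) : Prop :=
  all (fun x : int => 2 <= x) a /\ hj_fraction a = n%:R / (n%:R - q%:R).

Inductive blow_down : seq int -> seq int -> Prop :=
| BlowInner s x y t :
    blow_down (s ++ [:: x, 1, y & t]) (s ++ [:: x - 1, y - 1 & t])
| BlowFirst y t : blow_down [:: 1, y & t] (y - 1 :: t)
| BlowLast s x : blow_down (s ++ [:: x; 1]) (s ++ [:: x - 1]).

Inductive blows_down_to : seq int -> seq int -> Prop :=
| BlowDone b : all (fun x : int => 1 <= x) b -> blows_down_to b b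
| BlowStep b b' t : all (fun x : int => 1 <= x) b -> blow_down b b' ->
    blows_down_to b' t -> blows_down_to b t.

(* M \cap sigma^vee: [a, b] is in the dual of N = Z^2 + Z (1/n)(1, q) iff
   it is integral and n divides a + q b.                                *)
Definition cqs_monoid (n q : nat) : {pred int * int} :=
  fun u => [&& 0 <= u.1, 0 <= u.2 & (n%:Z %| u.1 + q%:Z * u.2)%Z].

Fact cqs_monoid_closed n q : addr_closed (cqs_monoid n q).
Proof.
split=> [|[a b] [c d] /and3P[/= a0 b0 ab] /and3P[/= c0 d0 cd]].
  by apply/and3P; split; rewrite //= mulr0 addr0 dvdz0.
apply/and3P; split; rewrite /= ?addr_ge0 //.
by rewrite mulrDr addrACA; apply: rpredD.
Qed.
HB.instance Definition _ n q :=
  GRing.isAddClosed.Build (int * int)%type (cqs_monoid n q)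
    (cqs_monoid_closed n q).

Definition cqs_ring (K : fieldType) (n q : nat) : comAlgType K :=
  sgalg K (submonoid (cqs_monoid n q)).

(* the torus-fixed point, where x^0 = 1 and x^u = 0 for u != 0          *)
Definition cqs_point (K : fieldType) (n q : nat) : cqs_ring K n q -> K :=
  monalg.mcoeff 0%R.

(* The result of blowing down does not depend on the order of the steps. *)
Definition chain_singularity (K : fieldType) (b : seq int)
    (A : comAlgType K) (E : set A) (x : A -> K) : Prop :=
  exists2 t, blows_down_to b t &
    (t = [:: 1] \/ t = [:: 1; 1]) /\ smooth_at E x
    \/ exists m c : nat, [/\ coprime m c, (0 < c < m)%N, expands m c t &
         same_singularity E x (set0 : set (cqs_ring K m c))
           (@cqs_point K m c)].

Section Slices.
Context (R : realType).

Definition lattice_N (n q : nat) : set (R * R) :=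
  [set v | exists i j k : int,
     v = (i%:~R + k%:~R / n%:R, j%:~R + k%:~R * q%:R / n%:R)].

Definition pairing (v : R * R) (u : int * int) : R :=
  v.1 * u.1%:~R + v.2 * u.2%:~R.

(* the minimal generators w^1, ..., w^e, listed as w = [:: w^1; ...; w^e] *)
Definition wgen (w : seq (int * int)) (i : nat) : int * int :=
  nth (0, 0) w i.-1.

(* the entry a_i of the chain (a_2, ..., a_(e-1))                       *)
Definition chain_entry (a : seq int) (i : nat) : int := nth 0 a (i - 2).

Definition minimal_generators (n q : nat) (a : seq int)
    (w : seq (int * int)) : Prop :=
  let e := (size a + 2)%N in
  [/\ size w = e, uniq w,
      forall u, u \in w <-> hilbert_basis (cqs_monoid n q) u,
      wgen w 1 = (n%:Z, 0) /\ wgen w e = (0, n%:Z) &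
      forall i, (2 <= i <= e - 1)%N ->
        wgen w i.-1 + wgen w i.+1 = wgen w i *~ chain_entry a i].

Definition line (o delta : R * R) (t : R) : R * R :=
  (o.1 + t * delta.1, o.2 + t * delta.2).

(* t |-> o + t delta identifies R with H^h and Z with L^h = N \cap H^h;
   in this coordinate Q is [beta, gamma], where w^e vanishes at beta and
   w^1 at gamma, which also fixes the orientation.                      *)
Definition slice_coordinates (n q : nat) (w : seq (int * int)) (h : nat)
    (o delta : R * R) (beta gamma : R) : Prop :=
  [/\ forall v, lattice_N n q v /\ pairing v (wgen w h) = 1
        <-> exists k : int, v = line o delta k%:~R,
      forall t, (0 <= (line o delta t).1 /\ 0 <= (line o delta t).2)
        <-> beta <= t <= gamma,
      pairing (line o delta beta) (wgen w (size w)) = 0 &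
      pairing (line o delta gamma) (wgen w 1) = 0].

Definition nb_lattice_points (beta gamma : R) : nat :=
  #|` fset_set [set k : int | beta <= k%:~R <= gamma]|%fset.

(* Q = [beta0, gamma0] + [beta1, gamma1], the second summand being mult
   times a segment                                                      *)
Record decomposition := Decomposition {
  beta0 : R; gamma0 : R; beta1 : R; gamma1 : R; mult : nat }.

Definition decomposition_D (beta gamma : R) (p d : nat) : decomposition :=
  Decomposition beta (gamma - (p * d)%:R) 0 (p * d)%:R p.

Definition decomposition_Dbar (beta gamma : R) (d : nat) : decomposition :=
  let c : R :=
    (Num.ceil (beta + (nb_lattice_points beta gamma)%:R - d%:R))%:~R in
  Decomposition beta c 0 (gamma - c) 1.

Definition pairing' (v : R * R * R) (u : int * int * int) : R :=
  v.1.1 * u.1.1%:~R + v.1.2 * u.1.2%:~R + v.2 * u.2%:~R.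

Definition sigma'_gens (D : decomposition) : seq (R * R * R) :=
  [:: (beta0 D, 1, 0); (gamma0 D, 1, 0);
      (beta1 D / (mult D)%:R, 0, 1); (gamma1 D / (mult D)%:R, 0, 1)].

(* M' \cap sigma'^vee                                                   *)
Definition total_monoid (D : decomposition) : {pred int * int * int} :=
  fun u => all (fun v => 0 <= pairing' v u) (sigma'_gens D).

Fact total_monoid_closed D : addr_closed (total_monoid D).
Proof.
split=> [|u v]; rewrite !unfold_in.
  by apply/allP=> x _; rewrite /pairing' /= !mulr0 !addr0.
move=> /allP uD /allP vD; apply/allP=> x xD.
have -> : pairing' x (u + v) = pairing' x u + pairing' x v.
  rewrite /pairing' /= !rmorphD /= !mulrDr.
  by rewrite [X in X + _]addrACA [LHS]addrACA.
by rewrite addr_ge0 ?uD ?vD.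
Qed.
HB.instance Definition _ D :=
  GRing.isAddClosed.Build (int * int * int)%type (total_monoid D)
    (total_monoid_closed D).

Definition total_ring (D : decomposition) : comAlgType R[i] :=
  sgalg R[i] (submonoid (total_monoid D)).

Definition tmonomial (D : decomposition) (u : int * int * int) : total_ring D :=
  monomial R[i] (total_monoid D) u.

(* the equation of the fibre of pi over lambda, in X                    *)
Definition fibre (D : decomposition) (lambda : R[i]) : set (total_ring D) :=
  [set tmonomial D (0, 0, 1) - tmonomial D (0, (mult D)%:Z, 0) - lambda%:A].
Arguments fibre D lambda : clear implicits.

(* v \in M' restricts to u \in M along phi : N -> N', which sends the
   point of L^h with coordinate k to (k, 1, p)                          *)
Definition restricts_to (o delta : R * R) (D : decomposition)
    (v : int * int * int) (u : int * int) : Prop :=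
  forall k : int,
    pairing (line o delta k%:~R) u = pairing' (k%:~R, 1, (mult D)%:R) v.

(* x is the origin: all x_i = x^(v^i) vanish at x                       *)
Definition is_origin (w : seq (int * int)) (h : nat) (o delta : R * R)
    (D : decomposition) (x : total_ring D -> R[i]) : Prop :=
  forall i v, (1 <= i <= size w)%N ->
    hilbert_basis (total_monoid D) v -> restricts_to o delta D v (wgen w i) ->
    (i = h -> v = (0, 1, 0)) ->
    x (tmonomial D v) = 0.

(* The fibre has the singularity denoted by b in the origin. A chain that
   blows down to (1, 1) belongs to a cone that degenerates to a ray; the
   origin then need not lie on the fibre, and the condition is that it is
   not a singular point of the fibre.                                   *)
Definition origin_singularity (w : seq (int * int)) (h : nat)
    (o delta : R * R) (D : decomposition) (lambda : R[i]) (b : seq int)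
    : Prop :=
  (exists x, [/\ scheme_point (fibre D lambda) x, is_origin w h o delta x &
     chain_singularity b (fibre D lambda) x])
  \/ (blows_down_to b [:: 1; 1] /\
      forall x, scheme_point (fibre D lambda) x -> is_origin w h o delta x ->
        smooth_at (fibre D lambda) x).

(* for all lambda in a dense Zariski open subset of the affine line     *)
Definition general (P : R[i] -> Prop) : Prop :=
  exists bad : seq R[i], forall lambda, lambda \notin bad -> P lambda.

End Slices.

Arguments fibre {R} D lambda _.

(* Main.v *)
Require Import Defs.
From HB Require Import structures.
From mathcomp Require Import all_boot all_order all_algebra.
From mathcomp Require Import boolp classical_sets reals complex.
From mathcomp Require Import separable finmap cardinality ring lra zify.
From mathcomp Require Import (canonicals) mpoly.
From mathcomp Require Import monalg.

(** Write [s] for the first coordinate of an exponent. The part of degree [s]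
    of the total ring is free of rank one over the polynomials in
    y0 = x^(0,1,0) and y1 = x^(0,0,1): its exponents are the (s, r0, r1) with
    r0 >= n0 s and r1 >= n1 s, where n0 and n1 come from the two segments of
    the decomposition. The fibre over [lambda] is cut out by
    y1 = y0^p + lambda, so it is a surface with an action of the
    multiplicative group, fibred over the line with coordinate y0.

    Let [lambda] be nonzero and look at the fibre near y0 = rho, with
    z = y0 - rho. Of y0 and y0^p + lambda at most one vanishes at [rho], and
    then to order one; each is thus z^e times a unit, with e = 0 or 1.
    Replacing x^(s, r0, r1) by the monomial of degree [s] and z-order
    e0 r0 + e1 r1, multiplied by the units to the powers [r0] and [r1], is
    multiplicative. The inverses of the units are polynomials modulo each
    power of the maximal ideal, so this gives an isomorphism of all jets, hence
    of completed local rings, with a toric surface ([local_model]). Its cone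
    is the cone over (beta0, gamma0) when rho = 0, over (beta1, gamma1) / p
    when rho^p = - lambda, and a ray otherwise ([modelled_over_0],
    [modelled_over_root], [modelled_elsewhere]).

    On the toric surface of the cone over a segment, the points on z = 0 are
    regular, except possibly the one fixed by the torus ([smooth_slab]). Thus the
    fibre is regular outside one point over y0 = 0, which is the origin
    because the Hilbert basis elements over w^i, for i distinct from h, have
    nonzero degree ([vertex_origin]), and one point over each of the p roots
    of - lambda ([singular_points]).

    The singularity at a fixed point is read off from a fan. The w^i are affine
    functions on the slice; as vectors (slope, value) they satisfy
    u_(i-1) + u_(i+1) = a_i u_i, consecutive ones form bases, and
    u_h = (0, 1). Shearing those on the left of u_h by an integer k turns the
    right end gamma of the segment into gamma - k, and changes nothing in the
    recursion except the entry a_h, which becomes a_h - k. So the chains of the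
    statement belong to sequences of vectors in the dual cones of the segments
    at hand, with any two neighbours forming a basis. Blowing down an entry 1
    deletes a vector of the sequence ([blow_down_fan]); the remaining vectors
    lie in a half-plane, which is why the entries stay positive
    ([positive_chain_blows_down]); and once the entries are at least 2, the
    continued fraction identifies the cyclic quotient singularity
    ([chain_singularity_at_vertex]). If the segment shrinks to a point, the
    dual cone is a half-plane, the chain blows down to (1, 1)
    ([degenerate_chain_blows_down]), and the fibre is regular along y0 = 0
    ([modelled_ray_smooth]). Over the roots of - lambda, the first family
    has the segment (0, d), with singularity xy = z^d; in the second one the
    fan is the left half of the above one, closed by the vector (1, 0). *)

Set Implicit Arguments.
Unset Strict Implicit.
Unset Printing Implicit Defensive.

Import Order.TTheory GRing.Theory Num.Theory.

Local Open Scope ring_scope.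

(** * Multiples of vectors *)

Lemma pairMn (t : int * int) (n : nat) : t *+ n = (t.1 * n%:Z, t.2 * n%:Z).
Proof.
elim: n => [|n IHn]; first by rewrite mulr0n !mulr0.
by rewrite mulrS IHn; case: t {IHn} => a b; congr (_, _) => /=; rewrite -[n.+1]add1n PoszD; ring.
Qed.

Lemma pairMz (t : int * int) (k : int) : t *~ k = (t.1 * k, t.2 * k).
Proof.
case: k => n; first by rewrite -pmulrn pairMn.
by rewrite NegzE mulrNz -pmulrn pairMn !mulrN.
Qed.

Lemma tripleMn (a b c : int) (m : nat) :
  ((a, b, c) : int * int * int) *+ m = (a * m%:Z, b * m%:Z, c * m%:Z).
Proof.
elim: m => [|m IHm]; rewrite ?mulr0n ?mulrS ?IHm ?mulr0 //.
by congr (_, _, _); rewrite -[m.+1]add1n PoszD mulrDr mulr1.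
Qed.

(** * Semigroup algebras and their monomials *)

Section LinearExtension.
Context (K : fieldType) (G : zmodType) (P : addrClosed G).
Local Notation A := (sgalg K (submonoid P)).
Local Notation mon := (monomial K P).

Lemma monomialE u (Pu : u \in P) : mon u = << 1 *g (Sub u Pu : submonoid P) >>.
Proof. by rewrite /monomial insubT. Qed.

Lemma monomial0 : mon 0 = 1.
Proof.
rewrite (monomialE (rpred0 P)); congr (<< _ *g _ >>).
exact: val_inj.
Qed.

Lemma monomialD u v : u \in P -> v \in P -> mon (u + v) = mon u * mon v.
Proof.
move=> Pu Pv; rewrite (monomialE Pu) (monomialE Pv) (monomialE (rpredD Pu Pv)).
rewrite [RHS]sgmulUU mulr1; congr (<< _ *g _ >>); exact: val_inj.
Qed.

Lemma sgalgE (f : A) : f = \sum_(s <- msupp f) f@_s *: mon (val s).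
Proof.
rewrite {1}(monalgE f); apply: eq_bigr => s _.
rewrite (monomialE (valP s)); apply/malgP => v.
by rewrite mcoeffZ !mcoeffU mulrnAr mulr1; congr (_ *+ (_ == _)); apply: val_inj.
Qed.

Lemma monomial_mcoeff u (s : submonoid P) :
  u \in P -> (mon u)@_s = (val s == u)%:R.
Proof. by move=> Pu; rewrite (monomialE Pu) mcoeffU -val_eqE /= eq_sym. Qed.

Definition linear_extension (V : lmodType K) (F : G -> V) (f : A) : V :=
  \sum_(s <- msupp f) f@_s *: F (val s).

Lemma linear_extension_supp (V : lmodType K) (F : G -> V) (d : {fset submonoid P}) (f : A) :
  (msupp f `<=` d)%fset -> linear_extension F f = \sum_(s <- d) f@_s *: F (val s).
Proof.
move=> le_d; rewrite /linear_extension (big_fset_incl _ le_d) //= => s _ /mcoeff_outdom ->.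
by rewrite scale0r.
Qed.

Fact linear_extension_is_linear (V : lmodType K) (F : G -> V) : linear (linear_extension F).
Proof.
move=> c f g; pose d := (msupp f `|` msupp g `|` msupp (c *: f + g))%fset.
rewrite (@linear_extension_supp _ _ d f) ?(@linear_extension_supp _ _ d g)
  ?(@linear_extension_supp _ _ d (_ + _)).
- rewrite scaler_sumr -big_split; apply: eq_bigr => s _ /=.
  by rewrite mcoeffD mcoeffZ scalerDl scalerA.
- exact: fsubsetUr.
- by rewrite /d -fsetUA fsetUCA fsubsetUl.
- by rewrite /d -fsetUA fsubsetUl.
Qed.
HB.instance Definition _ (V : lmodType K) (F : G -> V) :=
  GRing.isLinear.Build K A V _ (linear_extension F) (linear_extension_is_linear F).

Lemma linear_extensionX (V : lmodType K) (F : G -> V) u :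
  u \in P -> linear_extension F (mon u) = F u.
Proof.
move=> Pu; rewrite (@linear_extension_supp _ _ [fset (Sub u Pu : submonoid P)]%fset).
  by rewrite big_seq_fset1 monomial_mcoeff //= eqxx scale1r.
by rewrite (monomialE Pu) msuppU_le.
Qed.

Lemma sgalg_ind (V : A -> Prop) :
    (forall c f g, V f -> V g -> V (c *: f + g)) -> V 0 ->
    (forall u, u \in P -> V (mon u)) ->
  forall f, V f.
Proof.
move=> VD V0 Vm f; rewrite (sgalgE f); elim: (enum_fset _) => [|s r IHr].
  by rewrite big_nil.
by rewrite big_cons; apply: VD => //; apply: Vm; apply: valP.
Qed.

End LinearExtension.
Arguments linear_extension {K G P V} F f.

(** What the geometry below uses of a semigroup algebra. Working from this
    interface keeps the concrete product out of sight. *)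
Record monoid_algebra (K : fieldType) (G : zmodType) (P : addrClosed G)
    (A : comAlgType K) (mon : G -> A) : Prop := MonoidAlgebra {
  mon0 : mon 0 = 1;
  monD : forall u v, u \in P -> v \in P -> mon (u + v) = mon u * mon v;
  mon_ind : forall V : A -> Prop,
    (forall c f g, V f -> V g -> V (c *: f + g)) -> V 0 ->
    (forall u, u \in P -> V (mon u)) -> forall f, V f;
  mon_ext : forall (V : lmodType K) (F : G -> V),
    exists L : A -> V, linear L /\ forall u, u \in P -> L (mon u) = F u }.

Lemma monomial_algebra (K : fieldType) (G : zmodType) (P : addrClosed G) :
  @monoid_algebra K G P (sgalg K (submonoid P)) (monomial K P).
Proof.
split; [exact: monomial0|exact: monomialD|exact: sgalg_ind|].
move=> V F; exists (linear_extension F); split; first exact: linear_extension_is_linear.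
by move=> u; exact: linear_extensionX.
Qed.

Section MonoidAlgebra.
Context (K : fieldType) (G : zmodType) (P : addrClosed G).
Context (A : comAlgType K) (mon : G -> A).
Hypothesis hA : monoid_algebra P mon.

Lemma monMn u n : u \in P -> mon (u *+ n) = mon u ^+ n.
Proof.
move=> Pu; elim: n => [|n IHn]; first by rewrite mulr0n (mon0 hA).
by rewrite mulrS exprS (monD hA) ?IHn // rpredMn.
Qed.

Lemma eq_on_monomials (V : zmodType) (s : K -> V -> V) (F1 F2 : A -> V) :
    linear_for s F1 -> linear_for s F2 ->
    (forall u, u \in P -> F1 (mon u) = F2 (mon u)) ->
  F1 =1 F2.
Proof.
move=> L1 L2 E12.
have E0 : F1 0 = F2 0.
  have := L1 (-1) (mon 0) (mon 0); have := L2 (-1) (mon 0) (mon 0).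
  by rewrite scaleN1r addNr E12 ?rpred0 // => -> ->.
apply: (mon_ind hA) => // c f g Ef Eg.
by rewrite L1 L2 Ef Eg.
Qed.

Lemma linear_B (B : lmodType K) (L : A -> B) : linear L -> zmod_morphism L.
Proof.
move=> LL f g; have := LL (-1) g f.
by rewrite !scaleN1r ![- _ + _]addrC.
Qed.

Lemma linear_Z (B : lmodType K) (L : A -> B) : linear L -> forall c f, L (c *: f) = c *: L f.
Proof.
move=> LL c f; have L0 : L 0 = 0 by have := linear_B LL 0 0; rewrite !subrr.
by have := LL c f 0; rewrite L0 !addr0.
Qed.

(** Multiplicativity of a linear map out of a monoid algebra, after a further
    morphism [q], is a matter of monomials. *)
Lemma morphism_on_monomials (B : comAlgType K) (Q : comNzRingType)
    (q : {rmorphism B -> Q}) (L : A -> B) :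
    linear L -> q (L (mon 0)) = 1 ->
    (forall u v, u \in P -> v \in P ->
       q (L (mon (u + v))) = q (L (mon u)) * q (L (mon v))) ->
  exists F : {rmorphism A -> Q}, forall f, F f = q (L f).
Proof.
move=> LL FO FM; pose F f := q (L f).
have FB : zmod_morphism F by move=> f g; rewrite /F linear_B // rmorphB.
have FZ c f : F (c *: f) = q c%:A * F f by rewrite /F (linear_Z LL) -[c *: L f]mulr_algl rmorphM.
have F0 : F 0 = 0 by have := FB 0 0; rewrite !subrr.
have FD f g : F (f + g) = F f + F g.
  by have := FB (f + g) g; rewrite addrK => ->; rewrite subrK.
have FL c f g : F (c *: f + g) = q c%:A * F f + F g by rewrite FD FZ.
have FMul : {morph F : f g / f * g}.
  move=> f g; move: f; apply: (mon_ind hA) => [c f1 f2 E1 E2||u Pu].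
  - by rewrite mulrDl -scalerAl !FL E1 E2 mulrDl mulrA.
  - by rewrite mul0r F0 mul0r.
  move: g; apply: (mon_ind hA) => [c f1 f2 E1 E2||v Pv].
  - by rewrite mulrDr -scalerAr !FL E1 E2 mulrDr mulrCA.
  - by rewrite mulr0 F0 mulr0.
  by rewrite -(monD hA) // /F FM.
have F1 : monoid_morphism F by split=> //; rewrite -(mon0 hA).
by exists (HB.pack F (GRing.isZmodMorphism.Build A Q F FB)
  (GRing.isMonoidMorphism.Build A Q F F1) : {rmorphism A -> Q}).
Qed.
End MonoidAlgebra.

(** * Powers of the maximal ideal of a point *)

Section Ideals.
Context (K : fieldType) (A : comAlgType K).
Implicit Types (E : set A) (x : A -> K).

Lemma ideal_span_sub E (I : set A) :
    I 0 -> (forall f g, I f -> I g -> I (f + g)) -> (forall c f, I f -> I (c * f)) ->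
  (forall f, E f -> I f) -> forall f, ideal_span E f -> I f.
Proof.
move=> I0 ID IM EI f [m [c [g [Eg ->]]]].
by elim/big_ind: _ => // i _; apply/IM/EI.
Qed.

Lemma ideal_span0 E : ideal_span E 0.
Proof. by exists 0, (fun=> 0), (fun=> 0); split=> [[]|]; rewrite ?big_ord0. Qed.

Lemma ideal_spanM E c f : ideal_span E f -> ideal_span E (c * f).
Proof.
case=> m [d [g [Eg ->]]]; exists m, (fun i => c * d i), g; split=> //.
by rewrite mulr_sumr; apply: eq_bigr => i _; rewrite mulrA.
Qed.

Lemma ideal_spanD E f g : ideal_span E f -> ideal_span E g -> ideal_span E (f + g).
Proof.
case=> m [c [u [Eu ->]]] [n [d [v [Ev ->]]]].
pose glue (a : 'I_m -> A) (b : 'I_n -> A) i :=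
  match split i with inl j => a j | inr j => b j end.
exists (m + n)%N, (glue c d), (glue u v); split.
  by move=> i; rewrite /glue; case: (split i).
rewrite big_split_ord /=; congr (_ + _); apply: eq_bigr => i _; rewrite /glue.
  by rewrite -[lshift n i]/(unsplit (inl i)) unsplitK.
by rewrite -[rshift m i]/(unsplit (inr i)) unsplitK.
Qed.

Lemma ideal_span_gen E f : E f -> ideal_span E f.
Proof.
move=> Ef; exists 1, (fun=> 1), (fun=> f); split=> //.
by rewrite big_ord_recl big_ord0 mul1r addr0.
Qed.
End Ideals.

Section MaximalIdealPowers.
Context (K : fieldType) (A : comAlgType K) (E : set A) (x : A -> K).
Local Notation mp := (maxideal_pow E x).

Lemma mp0 k : mp k 0. Proof. exact: ideal_span0. Qed.

Lemma mpD k f g : mp k f -> mp k g -> mp k (f + g).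
Proof. exact: ideal_spanD. Qed.

Lemma mpM k c f : mp k f -> mp k (c * f).
Proof. exact: ideal_spanM. Qed.

Lemma mpZ k (c : K) f : mp k f -> mp k (c *: f).
Proof. by rewrite -mulr_algl; apply: mpM. Qed.

Lemma mpN k f : mp k f -> mp k (- f).
Proof. by rewrite -mulN1r; apply: mpM. Qed.

Lemma mpB k f g : mp k f -> mp k g -> mp k (f - g).
Proof. by move=> ? ?; apply/mpD/mpN. Qed.

Lemma mp_trans k f g h : mp k (f - g) -> mp k (g - h) -> mp k (f - h).
Proof. by move=> fg gh; rewrite -(subrKA g); apply: mpD. Qed.

Lemma mp_sym k f g : mp k (f - g) -> mp k (g - f).
Proof. by move=> fg; rewrite -opprB; apply: mpN. Qed.

Lemma mp_mulB k f f' g g' : mp k (f - f') -> mp k (g - g') -> mp k (f * g - f' * g').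
Proof.
move=> ff gg.
have -> : f * g - f' * g' = g * (f - f') + f' * (g - g') by ring.
by apply: mpD; apply: mpM.
Qed.

Lemma mp_E k f : E f -> mp k f.
Proof. by move=> Ef; apply: ideal_span_gen; right. Qed.

Lemma mp_prod k (g : 'I_k -> A) : (forall i, x (g i) = 0) -> mp k (\prod_i g i).
Proof. by move=> xg; apply: ideal_span_gen; left; exists g. Qed.

Lemma mp_exp k z : x z = 0 -> mp k (z ^+ k).
Proof.
by move=> xz; have := mp_prod (k := k) (fun _ => xz); rewrite prodr_const card_ord.
Qed.

Lemma mp_all f : mp 0 f.
Proof.
rewrite -[f]mulr1; apply: mpM.
have := @mp_prod 0 (fun=> 0); rewrite big_ord0; apply; by case.
Qed.

Section Point.
Hypothesis hx : scheme_point E x.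

(** Points are algebra morphisms; they are repackaged so that the general
    theory of morphisms applies. *)
Lemma point_morphism : exists x' : {rmorphism A -> K}, (x' = x :> (A -> K)).
Proof.
case: hx => xs xm _.
have xa : zmod_morphism x.
  by move=> u v; have := xs (-1) v u; rewrite scaleN1r mulN1r ![- _ + _]addrC.
exists (HB.pack x (GRing.isZmodMorphism.Build A K x xa)
  (GRing.isMonoidMorphism.Build A K x xm) : {rmorphism A -> K}).
by [].
Qed.

Lemma pointZ c f : x (c *: f) = c * x f.
Proof.
case: hx => xs _ _; have [x' Ex] := point_morphism.
by have := xs c f 0; rewrite addr0 -Ex rmorph0 addr0.
Qed.

Lemma pointA c : x c%:A = c.
Proof. by rewrite pointZ; case: hx => _ [-> _] _; rewrite mulr1. Qed.

Lemma mp_point k f : mp k.+1 f -> x f = 0.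
Proof.
have [x' Ex] := point_morphism; rewrite -[x f]/(x f) -{2}Ex.
move: f; apply: (@ideal_span_sub _ _ _ (fun f => x' f = 0)); [exact: rmorph0| | |].
- by move=> g h xg xh; rewrite rmorphD xg xh addr0.
- by move=> c g xg; rewrite rmorphM xg mulr0.
move=> g [[u [xu ->]]|].
  by rewrite rmorph_prod big_ord_recl Ex xu mul0r.
by case: hx => _ _ xE; rewrite Ex; apply: xE.
Qed.

(** The ring of jets of order [k] at [x]. Congruences modulo a power of the
    maximal ideal become equations in it, and the functions that do not
    vanish at [x] become units, with negative powers. *)
Lemma jet_ring k : (0 < k)%N ->
  exists (Q : comUnitRingType) (q : {rmorphism A -> Q}),
    forall f, q f = 0 <-> mp k f.
Proof.
move=> k_gt0; pose I : {pred A} := fun f => `[< mp k f >].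
have memI f : (f \in I) = `[< mp k f >] by [].
have I_ideal : idealr_closed I.
  split=> [||a u v]; rewrite ?memI; first by apply/asboolP/mp0.
    apply/asboolP; case: k k_gt0 {I memI} => // k _ /mp_point.
    by case: hx => _ [-> _] _; apply/eqP/oner_neq0.
  move=> uI vI; have /asboolP mu : `[< mp k u >] := uI.
  have /asboolP mv : `[< mp k v >] := vI.
  by apply/asboolP/mpD => //; apply: mpM.
pose J : idealr A := HB.pack I (isIdealr.Build A I I_ideal).
pose T : comNzRingType := {ideal_quot J}.
pose un : {pred T} := fun a => `[< exists b, b * a = 1 >].
pose iv (a : T) := if pselect (exists b, b * a = 1) is left h then projT1 (cid h) else a.
have ivP : {in un, left_inverse 1 iv *%R}.
  move=> a /asboolP ua; rewrite /iv; case: pselect => // h.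
  exact: (projT2 (cid h)).
have unP (a b : T) : b * a = 1 -> un a by move=> ba; apply/asboolP; exists b.
have iv_out : {in [predC un], iv =1 id}.
  move=> a; rewrite inE => ua; rewrite /iv; case: pselect => // h.
  by case/negP: ua; apply/asboolP.
pose Q : comUnitRingType := HB.pack (T : Type)
  (GRing.ComNzRing.on T) (GRing.ComNzRing_hasMulInverse.Build T ivP unP iv_out).
pose p : {rmorphism A -> T} := \pi_({ideal_quot J})%qT.
pose q : {rmorphism A -> Q} := p.
exists Q, q => f; have -> : (q f = 0) = (p f = p 0) by rewrite rmorph0.
split=> [/eqP|mf].
  by rewrite -Quotient.idealrBE subr0 => /asboolP.
by apply/eqP; rewrite -Quotient.idealrBE subr0; apply/asboolP.
Qed.

End Point.
End MaximalIdealPowers.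

(** * Jets and isomorphisms of completed local rings *)

Section Jets.
Context (K : fieldType).

(** A morphism of the rings of jets of order [k]. Only the values of [phi]
    modulo the k-th power of the ideal of [y] matter; lifting them to a linear
    map between the algebras avoids forming quotients. *)
Record jet_map (A : comAlgType K) (E : set A) (x : A -> K)
    (B : comAlgType K) (F : set B) (y : B -> K) (k : nat) (phi : A -> B) : Prop :=
  JetMap {
    jet_lin : linear phi;
    jet_one : maxideal_pow F y k (phi 1 - 1);
    jet_mul : forall f g, maxideal_pow F y k (phi (f * g) - phi f * phi g);
    jet_eqn : forall f, E f -> maxideal_pow F y k (phi f);
    jet_pt : forall f, y (phi f) = x f }.

(** A morphism of completed local rings, given by compatible approximations
    of all orders. *)
Definition jets (A : comAlgType K) (E : set A) (x : A -> K)
    (B : comAlgType K) (F : set B) (y : B -> K) (phi : nat -> A -> B) : Prop :=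
  (forall k, jet_map E x F y k (phi k)) /\
  (forall k f, maxideal_pow F y k (phi k.+1 f - phi k f)).

(** Asking for approximations in both directions makes the relation stronger
    than an isomorphism of completions: it also transports the cotangent
    space, and composes order by order. *)
Definition jet_equiv (A : comAlgType K) (E : set A) (x : A -> K)
    (B : comAlgType K) (F : set B) (y : B -> K) : Prop :=
  exists (phi : nat -> A -> B) (psi : nat -> B -> A),
    [/\ jets E x F y phi, jets F y E x psi,
        forall k f, maxideal_pow E x k (psi k (phi k f) - f) &
        forall k g, maxideal_pow F y k (phi k (psi k g) - g)].

Section JetMap.
Context (A : comAlgType K) (E : set A) (x : A -> K).
Context (B : comAlgType K) (F : set B) (y : B -> K) (k : nat) (phi : A -> B).
Hypothesis jm : jet_map E x F y k phi.

Lemma jetD f g : phi (f + g) = phi f + phi g.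
Proof. by have := jet_lin jm 1 f g; rewrite !scale1r. Qed.

Lemma jet0 : phi 0 = 0.
Proof.
have := jetD 0 0; rewrite addr0 => /esym/eqP.
by rewrite -subr_eq0 addrK => /eqP.
Qed.

Lemma jetZ c f : phi (c *: f) = c *: phi f.
Proof. by have := jet_lin jm c f 0; rewrite jet0 !addr0. Qed.

Lemma jetB f g : phi (f - g) = phi f - phi g.
Proof. by rewrite -scaleN1r jetD jetZ scaleN1r. Qed.

(** A product of [k] functions that vanish at [x] goes, up to the k-th power
    of the ideal of [y], to a product of [k] functions that vanish at [y]. *)
Lemma jet_pow f : maxideal_pow E x k f -> maxideal_pow F y k (phi f).
Proof.
move: f; apply: (@ideal_span_sub _ _ _ (fun f => maxideal_pow F y k (phi f))).
- by rewrite jet0; apply: mp0.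
- by move=> f g mf mg; rewrite jetD; apply: mpD.
- move=> c f mf; rewrite -[phi _](subrK (phi c * phi f)).
  by apply: mpD; [exact: (jet_mul jm) | apply: mpM].
move=> f [[g [xg ->]]|]; last exact: (jet_eqn jm).
have prodE : maxideal_pow F y k (phi (\prod_i g i) - \prod_i phi (g i)).
  apply: (big_ind2 (fun a b => maxideal_pow F y k (phi a - b))) => //.
  - exact: (jet_one jm).
  - move=> a a' b b' ma mb; apply: mp_trans ((jet_mul jm) _ _) _.
    exact: mp_mulB.
  by move=> i _; rewrite subrr; apply: mp0.
rewrite -[phi _](subrK (\prod_i phi (g i))); apply: mpD => //.
by apply: mp_prod => i; rewrite (jet_pt jm).
Qed.

Lemma jet_powB f g :
  maxideal_pow E x k (f - g) -> maxideal_pow F y k (phi f - phi g).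
Proof. by rewrite -jetB; apply: jet_pow. Qed.
End JetMap.

Section JetComposition.
Context (A : comAlgType K) (E : set A) (x : A -> K).
Context (B : comAlgType K) (F : set B) (y : B -> K).
Context (C : comAlgType K) (G : set C) (z : C -> K).

Lemma jets_comp phi phi' :
    jets E x F y phi -> jets F y G z phi' ->
  jets E x G z (fun k f => phi' k (phi k f)).
Proof.
move=> [jm c] [jm' c']; split=> [k|k f].
  split.
  - by move=> a f g; rewrite (jetD (jm k)) (jetZ (jm k)) (jetD (jm' k)) (jetZ (jm' k)).
  - exact: mp_trans (jet_powB (jm' k) (jet_one (jm k))) (jet_one (jm' k)).
  - move=> f g; apply: mp_trans (jet_powB (jm' k) (jet_mul (jm k) f g)) _.
    exact: (jet_mul (jm' k)).
  - by move=> f /(jet_eqn (jm k)) /(jet_pow (jm' k)).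
  - by move=> f; rewrite (jet_pt (jm' k)) (jet_pt (jm k)).
apply: mp_trans (c' k _) _; apply: (jet_powB (jm' k)); exact: c.
Qed.

End JetComposition.

Lemma jet_equiv_trans (A : comAlgType K) (E : set A) (x : A -> K)
    (B : comAlgType K) (F : set B) (y : B -> K)
    (C : comAlgType K) (G : set C) (z : C -> K) :
  jet_equiv E x F y -> jet_equiv F y G z -> jet_equiv E x G z.
Proof.
move=> [phi [psi [jp jq qp pq]]] [phi' [psi' [jp' jq' qp' pq']]].
exists (fun k f => phi' k (phi k f)), (fun k f => psi k (psi' k f)).
split; [exact: (jets_comp jp jp')|exact: (jets_comp jq' jq)| |].
- move=> k f; apply: mp_trans (jet_powB (jq.1 k) (qp' k _)) _; exact: qp.
- move=> k f; apply: mp_trans (jet_powB (jp'.1 k) (pq k _)) _; exact: pq'.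
Qed.

Lemma jet_equiv_sym (A : comAlgType K) (E : set A) (x : A -> K)
    (B : comAlgType K) (F : set B) (y : B -> K) :
  jet_equiv E x F y -> jet_equiv F y E x.
Proof. by move=> [phi [psi [jp jq qp pq]]]; exists psi, phi. Qed.

Section JetConsequences.
Context (A : comAlgType K) (E : set A) (x : A -> K).
Context (B : comAlgType K) (F : set B) (y : B -> K).

Lemma jets_adic phi f : jets E x F y phi -> adic_seq E x f ->
  adic_seq F y (fun k => phi k (f k)).
Proof.
move=> [jm c] af k; apply: mp_trans (c k _) _.
exact: (jet_powB (jm k) (af k)).
Qed.

Lemma jets_completion phi : jets E x F y phi ->
  completion_morphism E x F y (fun f k => phi k (f k)).
Proof.
move=> jp; have [jm c] := jp; split.
- move=> f af; split; first exact: jets_adic.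
  by move=> g ag fg k; apply: (jet_powB (jm k) (fg k)).
- move=> a k; rewrite (jetZ (jm k)) -scalerBr; apply: mpZ; exact: jet_one (jm k).
- by move=> f g af ag k; rewrite (jetD (jm k)) subrr; apply: mp0.
- by move=> f g af ag k; apply: (jet_mul (jm k)).
Qed.

End JetConsequences.

(** A coherent sequence is mapped by applying the approximation of order [k]
    to its k-th term. *)
Lemma jet_equiv_same (A : comAlgType K) (E : set A) (x : A -> K)
    (B : comAlgType K) (F : set B) (y : B -> K) :
  jet_equiv E x F y -> same_singularity E x F y.
Proof.
move=> [phi [psi [jp jq qp pq]]].
exists (fun f k => phi k (f k)), (fun f k => psi k (f k)); split.
- exact: jets_completion.
- exact: jets_completion.
- by move=> f _ k; apply: qp.
- by move=> f _ k; apply: pq.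
Qed.

(** Jets of order two determine the cotangent space. *)
Lemma jet_equiv_smooth (A : comAlgType K) (E : set A) (x : A -> K)
    (B : comAlgType K) (F : set B) (y : B -> K) :
  jet_equiv E x F y -> smooth_at F y -> smooth_at E x.
Proof.
move=> [phi [psi [[jp _] [jq _] qp pq]]] [g1 [g2 [y1 y2 sm]]].
exists (psi 2 g1), (psi 2 g2); split; rewrite ?(jet_pt (jq 2)) //.
have combo c : phi 2 (c.1 *: psi 2 g1 + c.2 *: psi 2 g2) =
    c.1 *: phi 2 (psi 2 g1) + c.2 *: phi 2 (psi 2 g2).
  by rewrite (jetD (jp 2)) !(jetZ (jp 2)).
have near c : maxideal_pow F y 2
    (phi 2 (c.1 *: psi 2 g1 + c.2 *: psi 2 g2) - (c.1 *: g1 + c.2 *: g2)).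
  rewrite combo opprD addrACA -!scalerBr; apply: mpD; apply: mpZ; exact: pq.
move=> g xg; have yg : y (phi 2 g) = 0 by rewrite (jet_pt (jp 2)).
have [c [mc uc]] := sm _ yg; exists c; split.
  apply: mp_trans (mp_sym (qp 2 g)) _.
  have := jet_powB (jq 2) mc; rewrite (jetD (jq 2)) !(jetZ (jq 2)); exact.
move=> c' mc'; apply: uc; apply: mp_trans (jet_powB (jp 2) mc') _.
exact: near.
Qed.
End Jets.

(** * Regular points of toric surfaces *)

Lemma scale_alg (K : fieldType) (A : comAlgType K) (c : K) (f : A) :
  c *: f = GRing.in_alg A c * f.
Proof. by rewrite /GRing.in_alg mulr_algl. Qed.

Section SmoothCriterion.
Context (K : fieldType) (A : comAlgType K) (E : set A) (x : A -> K).
Hypothesis hx : scheme_point E x.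
Context (f1 f2 : A).
Hypotheses (xf1 : x f1 = 0) (xf2 : x f2 = 0).

(** If all functions have such an expansion, the classes of [f1] and [f2]
    generate the cotangent space at [x]. *)
Definition taylor (f : A) : Prop :=
  exists c : K * K, maxideal_pow E x 2 (f - (x f)%:A - (c.1 *: f1 + c.2 *: f2)).

Lemma mp2_mul f g : x f = 0 -> x g = 0 -> maxideal_pow E x 2 (f * g).
Proof.
move=> xf xg.
have := @mp_prod _ _ E x 2 (fun i => if i == ord0 then f else g).
rewrite big_ord_recl big_ord1 /=; apply=> i; by case: ifP.
Qed.

Lemma taylor_linear c f g : taylor f -> taylor g -> taylor (c *: f + g).
Proof.
move=> [a ma] [b mb]; exists (c * a.1 + b.1, c * a.2 + b.2) => /=.
have [x' Ex] := point_morphism hx.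
have -> : x (c *: f + g) = c * x f + x g by rewrite -Ex rmorphD /= Ex (pointZ hx).
have := mpD (mpZ c ma) mb; congr (maxideal_pow _ _ _ _).
rewrite !scalerBr !scalerDr !scalerDl !scalerA; ring.
Qed.

Lemma taylor_const c : taylor c%:A.
Proof.
by exists (0, 0); rewrite (pointA hx) !scale0r subrr addr0 subr0; apply: mp0.
Qed.

Lemma taylor_mul f g : taylor f -> taylor g -> taylor (f * g).
Proof.
move=> [a ma] [b mb].
have [x' Ex] := point_morphism hx.
exists (x g * a.1 + x f * b.1, x g * a.2 + x f * b.2) => /=.
have -> : x (f * g) = x f * x g by rewrite -Ex rmorphM.
have mfg : maxideal_pow E x 2 ((f - (x f)%:A) * (g - (x g)%:A)).
  by apply: mp2_mul; rewrite -Ex rmorphB /= Ex (pointA hx) subrr.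
have := mpD (mpD mfg (mpZ (x g) ma)) (mpZ (x f) mb); congr (maxideal_pow _ _ _ _).
rewrite !scale_alg; ring.
Qed.

(** Needed for the monomials with a negative exponent in a coordinate that
    does not vanish at [x]: they have an expansion because their product with
    a power of that coordinate does. *)
Lemma taylor_div u f : x u != 0 -> taylor u -> taylor (u * f) -> taylor f.
Proof.
move=> xu [a ma] [b mb].
have [x' Ex] := point_morphism hx; have xuf : x (u * f) = x u * x f by rewrite -Ex rmorphM.
exists ((x u)^-1 * (b.1 - x f * a.1), (x u)^-1 * (b.2 - x f * a.2)) => /=.
have muf : maxideal_pow E x 2 ((u - (x u)%:A) * (f - (x f)%:A)).
  by apply: mp2_mul; rewrite -Ex rmorphB /= Ex (pointA hx) subrr.
have := mpZ (x u)^-1 (mpB (mpB mb muf) (mpZ (x f) ma)).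
congr (maxideal_pow _ _ _ _); rewrite xuf.
have : GRing.in_alg A (x u)^-1 * GRing.in_alg A (x u) = 1.
  by rewrite -rmorphM /= mulVf //= scale1r.
rewrite !scale_alg !rmorphM !rmorphB !rmorphM /=.
move: (GRing.in_alg A (x u)^-1) (GRing.in_alg A (x u)) => v w vw.
rewrite !mulr1.
apply/eqP; rewrite -subr_eq0; apply/eqP.
ring: vw.
Qed.

Section Derivations.
Context (D1 D2 : A -> K).
Hypotheses (D1s : scalar D1) (D2s : scalar D2).
Hypotheses (D1M : forall f g, D1 (f * g) = x f * D1 g + x g * D1 f)
  (D2M : forall f g, D2 (f * g) = x f * D2 g + x g * D2 f).
Hypotheses (D1E : forall f, E f -> D1 f = 0) (D2E : forall f, E f -> D2 f = 0).
Hypotheses (D11 : D1 f1 = 1) (D12 : D1 f2 = 0) (D21 : D2 f1 = 0) (D22 : D2 f2 = 1).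

(** By the Leibniz rule, a derivation at [x] kills the products of two
    functions that vanish at [x]. *)
Lemma derivation_mp2 (D : A -> K) : scalar D ->
    (forall f g, D (f * g) = x f * D g + x g * D f) ->
    (forall f, E f -> D f = 0) ->
  forall f, maxideal_pow E x 2 f -> D f = 0.
Proof.
move=> Ds DM DE; have [x' Ex] := point_morphism hx.
have DD f g : D (f + g) = D f + D g by have := Ds 1 f g; rewrite scale1r mul1r.
have D0 : D 0 = 0 by apply/eqP; rewrite -(inj_eq (addrI (D 0))) -DD !addr0.
suff H f : maxideal_pow E x 2 f -> x f = 0 /\ D f = 0 by move=> f /H[].
apply: (@ideal_span_sub _ _ _ (fun f => x f = 0 /\ D f = 0)) f
  => [|f g [xf Df] [xg Dg]|c f [xf Df]|f].
- by rewrite D0 -Ex rmorph0.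
- by rewrite DD Df Dg -Ex rmorphD Ex xf xg addr0.
- by rewrite DM xf Df -Ex rmorphM Ex xf !(mul0r, mulr0) addr0.
case=> [[g [xg ->]]|Ef]; last by rewrite DE //; case: hx => _ _ ->.
by rewrite big_ord_recl big_ord1 DM -Ex rmorphM Ex !xg !mul0r addr0.
Qed.

(** Derivations dual to [f1] and [f2] show that their classes in the cotangent
    space are independent. *)
Lemma smooth_of_derivations : (forall f, taylor f) -> smooth_at E x.
Proof.
move=> T; exists f1, f2; split=> // g xg.
have [c mc] := T g; rewrite xg scale0r subr0 in mc.
exists c; split=> // c' mc'.
have lin (D : A -> K) : scalar D -> D (c.1 *: f1 + c.2 *: f2 - (c'.1 *: f1 + c'.2 *: f2)) =
   (c.1 - c'.1) * D f1 + (c.2 - c'.2) * D f2.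
  move=> Ds.
  have DD u v : D (u + v) = D u + D v by have := Ds 1 u v; rewrite scale1r mul1r.
  have D0 : D 0 = 0 by apply/eqP; rewrite -(inj_eq (addrI (D 0))) -DD !addr0.
  have DZ a u : D (a *: u) = a * D u by have := Ds a u 0; rewrite D0 !addr0.
  by rewrite opprD addrACA -!scalerBl DD !DZ.
have m2 := mp_trans (mp_sym mc) mc'.
have := derivation_mp2 D1s D1M D1E m2; have := derivation_mp2 D2s D2M D2E m2.
rewrite !lin // D11 D12 D21 D22 !(mulr0, mulr1) addr0 add0r.
move=> /subr0_eq e2 /subr0_eq e1.
by case: (c) (c') e1 e2 => [? ?] [? ?] /= -> ->.
Qed.
End Derivations.
End SmoothCriterion.

Section Leibniz.
Context (K : fieldType) (A : comAlgType K) (E : set A) (x : A -> K).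
Hypothesis hx : scheme_point E x.
Context (D : A -> K) (Ds : scalar D).

Definition leibniz f g := D (f * g) = x f * D g + x g * D f.

Lemma leibnizC f g : leibniz f g -> leibniz g f.
Proof. by rewrite /leibniz mulrC addrC. Qed.

Lemma leibniz0 g : leibniz 0 g.
Proof.
have [x' Ex] := point_morphism hx; rewrite /leibniz -Ex mul0r rmorph0 mul0r add0r.
have -> : D 0 = 0.
  have := Ds 1 0 0; rewrite scale1r mul1r addr0 => /esym/eqP.
  by rewrite -subr_eq0 addrK => /eqP.
by rewrite mulr0.
Qed.

Lemma leibniz_linear c f1 f2 g : leibniz f1 g -> leibniz f2 g -> leibniz (c *: f1 + f2) g.
Proof.
rewrite /leibniz => E1 E2; have [x' Ex] := point_morphism hx.
have -> : x (c *: f1 + f2) = c * x f1 + x f2 by rewrite -Ex rmorphD /= Ex (pointZ hx).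
by rewrite mulrDl -scalerAl !Ds E1 E2; ring.
Qed.
End Leibniz.

Section SmoothToric.
Context (K : fieldType) (P : addrClosed (int * int)%type).
Context (A : comAlgType K) (mon : int * int -> A).
Hypothesis hA : monoid_algebra P mon.
Context (x : A -> K) (hx : scheme_point set0 x).

(** For a linear map it is enough to test the Leibniz rule on monomials. *)
Lemma toric_derivation (F : int * int -> K) :
    (forall u v, u \in P -> v \in P ->
       F (u + v) = x (mon u) * F v + x (mon v) * F u) ->
  exists D : A -> K, [/\ scalar D, forall f g, leibniz x D f g &
    forall u, u \in P -> D (mon u) = F u].
Proof.
move=> FM; have [D [Ds DF]] := mon_ext hA (V := K^o) F.
exists D; split=> //.
have Ds' : scalar D by exact: Ds.
have leibP := leibniz_linear hx Ds'; have leib0 := leibniz0 hx Ds'.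
move=> f g; move: f; apply: (mon_ind hA) => [c f1 f2 E1 E2||u Pu];
  [exact: leibP|exact: leib0|].
move: g; apply: (mon_ind hA) => [c f1 f2 E1 E2||v Pv]; apply/leibnizC.
- by apply/leibP; apply/leibnizC.
- exact: leib0.
by rewrite /leibniz mulrC -(monD hA) // !DF ?rpredD // FM // addrC.
Qed.

(** In the basis [u1], [u2] of the lattice the monomials are X^c1 Y^c2, with
    c2 >= 0, and with c1 >= 0 unless [X] is invertible at [x]. So the surface
    looks like a plane near [x], and the partial derivatives of X^c1 Y^c2 give
    the derivations needed for regularity. *)
Lemma smooth_toric (u1 u2 : int * int) (c1 c2 : int * int -> int) :
    u1 \in P -> u2 \in P ->
    zmod_morphism c1 -> zmod_morphism c2 ->
    c1 u1 = 1 -> c1 u2 = 0 -> c2 u1 = 0 -> c2 u2 = 1 ->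
    (forall v, v \in P -> v = u1 *~ c1 v + u2 *~ c2 v) ->
    (forall v, v \in P -> 0 <= c2 v) ->
    (forall v, v \in P -> 0 <= c1 v \/ x (mon u1) != 0) ->
  smooth_at set0 x.
Proof.
move=> P1 P2 c1B c2B c11 c12 c21 c22 vE c2_ge0 c1_ge0.
have [x' Ex] := point_morphism hx.
pose X := x (mon u1); pose Y := x (mon u2).
have c1D u v : c1 (u + v) = c1 u + c1 v.
  by have := c1B (u + v) v; rewrite addrK => ->; rewrite subrK.
have c2D u v : c2 (u + v) = c2 u + c2 v.
  by have := c2B (u + v) v; rewrite addrK => ->; rewrite subrK.
(* Multiplying by a power of X makes the first exponent nonnegative; the
   formulas for the monomials are then proved without inverses. *)
have monE (v : int * int) (Pv : v \in P) (k : nat) : c1 v + k%:Z = absz (c1 v + k%:Z) ->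
    mon (u1 *+ k) * mon v = mon u1 ^+ absz (c1 v + k%:Z) * mon u2 ^+ absz (c2 v).
  move=> ck; rewrite -(monD hA) ?rpredMn // -!(monMn hA) // -(monD hA) ?rpredMn //.
  congr (mon _); rewrite {1}(vE v Pv) addrA; congr (_ + _).
    by rewrite !pmulrn -mulrzDr addrC ck.
  by rewrite pmulrn gez0_abs // c2_ge0.
have monN (v : int * int) (Pv : v \in P) :
    exists2 k : nat, c1 v + k%:Z = absz (c1 v + k%:Z) & k = 0%N \/ X != 0.
  case: (c1_ge0 v Pv) => [c0|X0].
    by exists 0%N; [rewrite addr0 gez0_abs|left].
  exists `|c1 v|%N; last by right.
  by rewrite [RHS]gez0_abs //; lia.
have xE v : v \in P -> x (mon v) = X ^ c1 v * Y ^ c2 v.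
  move=> Pv; have [k ck kX] := monN v Pv.
  have := congr1 x' (monE v Pv k ck).
  rewrite !(rmorphM, rmorphXn) /= (monMn hA) // rmorphXn /= Ex -/X -/Y => E1.
  have -> : Y ^ c2 v = Y ^+ absz (c2 v) by rewrite -[in LHS](gez0_abs (c2_ge0 v Pv)).
  case: kX E1 ck => [->|X0] E1 ck.
    by move: E1 ck; rewrite expr0 mul1r addr0 => -> ck; rewrite [in RHS]ck.
  apply: (mulfI (expf_neq0 k X0)); rewrite E1 mulrA; congr (_ * _).
  by rewrite -[X ^+ k]/(X ^ k%:Z) -expfzDr // [in RHS]addrC [in RHS]ck.
(* the partial derivatives of X^c1 Y^c2 at x; here X and Y are the values *)
pose F1 v := (c1 v)%:~R * X ^ (c1 v - 1) * Y ^ c2 v.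
pose F2 v := X ^ c1 v * ((c2 v)%:~R * Y ^ (c2 v - 1)).
have powD (Z : K) (a b : int) : (0 <= a /\ 0 <= b) \/ Z != 0 -> Z ^ (a + b) = Z ^ a * Z ^ b.
  case=> [[a0 b0]|]; last by move=> ?; rewrite expfzDr.
  by rewrite exprzD_ss // a0 b0.
(* The derivative of Z^(a + b), also for Z = 0, where 0^(-1) is harmless
   because its coefficient vanishes. *)
have powB (Z : K) (a b : int) : (0 <= a /\ 0 <= b) \/ Z != 0 ->
    (a + b)%:~R * Z ^ (a + b - 1) =
    Z ^ a * (b%:~R * Z ^ (b - 1)) + Z ^ b * (a%:~R * Z ^ (a - 1)).
  have [->|Z0] := eqVneq Z 0; last first.
    move=> _; have e c : Z ^ (c - 1) = Z ^ c * Z^-1 by rewrite expfzDr.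
    by rewrite !e expfzDr // intrD; ring.
  case=> // -[]; case: a => // a _; case: b => // b _.
  case: a => [|a]; case: b => [|b];
    rewrite ?addr0 ?add0r ?mul0r ?mulr0 ?expr0z ?mul1r ?addr0 ?add0r //.
  have -> : (Posz a.+1 + Posz b.+1 - 1) = (a + b.+1)%:Z by lia.
  by rewrite -!exprnP addnS !exprS !mul0r !mulr0 addr0.
have orc v1 v2 : v1 \in P -> v2 \in P -> (0 <= c1 v1 /\ 0 <= c1 v2) \/ X != 0.
  by move=> /c1_ge0[] a /c1_ge0[] b; [left|right|right|right].
have F1M u v : u \in P -> v \in P -> F1 (u + v) = x (mon u) * F1 v + x (mon v) * F1 u.
  move=> Pu Pv; rewrite !xE // /F1 c1D c2D powB; last exact: orc.
  rewrite (powD Y); first by ring.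
  by left; split; apply: c2_ge0.
have F2M u v : u \in P -> v \in P -> F2 (u + v) = x (mon u) * F2 v + x (mon v) * F2 u.
  move=> Pu Pv; rewrite !xE // /F2 c1D c2D powB; last first.
    by left; split; apply: c2_ge0.
  by rewrite (powD X); [ring|exact: orc].
have x1 : x 1 = 1 by case: hx => _ [].
have xB f c : x (f - c%:A) = x f - c by rewrite -Ex rmorphB /= Ex (pointA hx).
have [D1 [D1s D1M D1E]] := toric_derivation F1M.
have [D2 [D2s D2M D2E]] := toric_derivation F2M.
have Dc D c : scalar D -> (forall f g, leibniz x D f g) -> forall f, D (f - c%:A) = D f.
  move=> Ds DM f; have D10 : D 1 = 0.
    have := DM 1 1; rewrite /leibniz mulr1 x1 mul1r => /esym/eqP.
    by rewrite -subr_eq0 addrK => /eqP.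
  by rewrite -scaleNr addrC Ds D10 mulr0 add0r.
apply: (@smooth_of_derivations _ _ _ _ hx (mon u1 - X%:A) (mon u2 - Y%:A) _ _ D1 D2).
- by rewrite xB subrr.
- by rewrite xB subrr.
- exact: D1s.
- exact: D2s.
- exact: D1M.
- exact: D2M.
- by [].
- by [].
- by rewrite Dc // D1E // /F1 c11 c21 subrr !expr0z !mulr1.
- by rewrite Dc // D1E // /F1 c12 mul0r mul0r.
- by rewrite Dc // D2E // /F2 c21 mul0r mulr0.
- by rewrite Dc // D2E // /F2 c12 c22 subrr !expr0z !mulr1.
apply: (mon_ind hA) => [c f g||v Pv]; first exact: taylor_linear.
  by have := taylor_const hx (mon u1 - X%:A) (mon u2 - Y%:A) 0; rewrite scale0r.
have t1 : taylor set0 x (mon u1 - X%:A) (mon u2 - Y%:A) (mon u1).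
  by exists (1, 0); rewrite /= scale1r scale0r addr0 subrr; apply: mp0.
have t2 : taylor set0 x (mon u1 - X%:A) (mon u2 - Y%:A) (mon u2).
  by exists (0, 1); rewrite /= scale1r scale0r add0r subrr; apply: mp0.
have tX f : taylor set0 x (mon u1 - X%:A) (mon u2 - Y%:A) f -> forall k,
    taylor set0 x (mon u1 - X%:A) (mon u2 - Y%:A) (f ^+ k).
  move=> tf; elim=> [|k IHk]; last by rewrite exprS; apply: taylor_mul; rewrite // xB subrr.
  by have := taylor_const hx (mon u1 - X%:A) (mon u2 - Y%:A) 1; rewrite scale1r.
have [k ck kX] := monN v Pv.
have [k0|X0] := kX.
  have := monE v Pv k ck; rewrite k0 mulr0n (mon0 hA) mul1r => ->.
  by apply: taylor_mul; rewrite ?xB ?subrr //; apply: tX.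
apply: (taylor_div (u := mon (u1 *+ k)) hx).
- by rewrite (monMn hA) // -Ex rmorphXn Ex expf_neq0.
- by rewrite (monMn hA) //; apply: tX.
by rewrite monE //; apply: taylor_mul; rewrite ?xB ?subrr //; apply: tX.
Qed.
End SmoothToric.

(** * Toric models of a fibration in curves *)

Section TruncatedPowers.
Context (K : fieldType).
Implicit Types U : {poly K}.

(** The inverse of [U] modulo 'X^(k+1), by the geometric series in
    1 - U / U(0). *)
Definition trunc_inv (k : nat) U : {poly K} :=
  (U.[0])^-1 *: \sum_(i < k.+1) (1 - (U.[0])^-1 *: U) ^+ i.

(** The n-th power of [U] modulo 'X^(k+1), for [U] invertible at 0 and an
    integer n of any sign. *)
Definition trunc_pow (k : nat) U (n : int) : {poly K} :=
  match n with Posz m => U ^+ m | Negz m => trunc_inv k U ^+ m.+1 end.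

Lemma dvd_polyX U : U.[0] = 0 -> exists W, U = 'X * W.
Proof.
move=> /eqP; rewrite -rootE => /factor_theorem[W ->].
by exists W; rewrite polyC0 subr0 mulrC.
Qed.

Lemma trunc_powE (Q : comUnitRingType) (ev : {rmorphism {poly K} -> Q}) k U :
    ev 'X ^+ k.+1 = 0 -> U.[0] != 0 ->
  ev U \is a GRing.unit /\ forall n, ev (trunc_pow k U n) = ev U ^ n.
Proof.
move=> X0 U0.
have geo (d : {poly K}) : (1 - d) * (\sum_(i < k.+1) d ^+ i) = 1 - d ^+ k.+1.
  by rewrite -[RHS]opprB subrX1 -mulNr opprB.
have inv1 : ev U * ev (trunc_inv k U) = 1.
  rewrite -rmorphM /trunc_inv -scalerAr scalerAl.
  set c := _ *: U; have {1}-> : c = 1 - (1 - c) by rewrite opprB addrC subrK.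
  have [W WE] : exists W, 1 - c = 'X * W.
    by apply: dvd_polyX; rewrite !hornerE /= mulVf // subrr.
  rewrite geo.
  by rewrite rmorphB rmorph1 WE exprMn rmorphM /= rmorphXn /= X0 mul0r subr0.
have uU : ev U \is a GRing.unit by apply/unitrP; exists (ev (trunc_inv k U)); rewrite mulrC inv1.
split=> // -[m|m] /=; first by rewrite rmorphXn.
rewrite rmorphXn NegzE /=.
have -> : ev (trunc_inv k U) = (ev U)^-1 by rewrite -[RHS]mulr1 -inv1 mulKr.
by rewrite exprVn.
Qed.
End TruncatedPowers.

Lemma poly_morphism_eq (K : fieldType) (Q : nzRingType) (f g : {rmorphism {poly K} -> Q}) :
  (forall c, f c%:P = g c%:P) -> f 'X = g 'X -> f =1 g.
Proof.
move=> fgC fgX p; elim/poly_ind: p => [|p c IHp]; first by rewrite !rmorph0.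
by rewrite !rmorphD !rmorphM /= IHp fgX fgC.
Qed.

Lemma exprn_exprz (Q : comUnitRingType) (a : Q) (m : nat) (l : int) :
  a \is a GRing.unit -> a ^+ m * a ^ l = a ^ (m%:Z + l).
Proof. by move=> ua; rewrite exprzDr. Qed.

(** A family of linear maps is a family of jets as soon as its reduction
    modulo each power of the maximal ideal is a morphism of rings. *)
Lemma jets_of_family (K : fieldType) (A : comAlgType K) (E : set A) (x : A -> K)
    (B : comAlgType K) (F : set B) (y : B -> K) (phi : nat -> A -> B) :
    scheme_point E x -> scheme_point F y -> (forall k, linear (phi k)) ->
    (forall k f, y (phi k f) = x f) ->
    (forall k, (0 < k)%N -> forall (Q : comUnitRingType) (q : {rmorphism B -> Q}),
       (forall g, q g = 0 <-> maxideal_pow F y k g) ->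
       (exists G : {rmorphism A -> Q}, (forall f, G f = q (phi k f)) /\
          forall f, E f -> G f = 0) /\
       forall f, q (phi k.+1 f) = q (phi k f)) ->
  jets E x F y phi.
Proof.
move=> hx hy phiL pt red; split=> [k|[|k] f]; last 2 first.
- exact: mp_all.
- have [Q [q qP]] := jet_ring hy (ltn0Sn k).
  by have [_ eq] := red _ (ltn0Sn k) Q q qP; apply/qP; rewrite rmorphB /= eq subrr.
split=> //; case: k => [|k]; try by move=> *; apply: mp_all.
all: have [Q [q qP]] := jet_ring hy (ltn0Sn k).
all: have [[G [GE G0]] _] := red _ (ltn0Sn k) Q q qP.
- by apply/qP; rewrite rmorphB /= -GE !rmorph1 subrr.
- by move=> f g; apply/qP; rewrite rmorphB rmorphM /= -!GE rmorphM subrr.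
- by move=> f /G0; rewrite GE => /qP.
Qed.

(** The data of a fibre and of its model near y0 = rho. The part of degree [s]
    of the algebra [A] starts at the exponents [n0 s] of y0 and [n1 s] of y1;
    the equation [E] is that of the fibre over [lam]. In the local coordinate
    z = y0 - rho one has y0 = z^e0 U and y1 = z^e1 V with units [U] and [V],
    so the part of degree [s] of the model [B] starts at the z-order
    e0 (n0 s) + e1 (n1 s). *)
Section LocalModel.
Context (K : fieldType) (P : addrClosed (int * int * int)%type)
  (S : addrClosed (int * int)%type) (n0 n1 : int -> int).
Context (A : comAlgType K) (monP : int * int * int -> A).
Context (B : comAlgType K) (monS : int * int -> B).
Hypotheses (hA : monoid_algebra P monP) (hB : monoid_algebra S monS).
Context (p : nat) (lam rho : K) (e0 e1 : nat) (U V : {poly K}).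
Local Notation E := ([set monP (0, 0, 1) - monP (0, p%:Z, 0) - lam%:A]%classic : set A).

Hypothesis memP : forall u, (u \in P) = (n0 u.1.1 <= u.1.2) && (n1 u.1.1 <= u.2).
Hypothesis memS : forall v, (v \in S) = (e0%:Z * n0 v.1 + e1%:Z * n1 v.1 <= v.2).
Hypotheses (n00 : n0 0 = 0) (n10 : n1 0 = 0).
Hypothesis UE : 'X + rho%:P = 'X^e0 * U.
Hypothesis VE : ('X + rho%:P) ^+ p + lam%:P = 'X^e1 * V.
Hypotheses (U0 : U.[0] != 0) (V0 : V.[0] != 0).

Let zA : A := monP (0, 1, 0) - rho%:A.
Let zB : B := monS (0, 1).

(** the exponent of the generator of the part of degree [s] *)
Let base (s : int) : int * int * int := (s, n0 s, n1 s).
(** the z-order of y0^r0 y1^r1 *)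
Let wt (r0 r1 : int) : int := e0%:Z * r0 + e1%:Z * r1.

(** The units are kept in [phi], and divided out in [psi], whose monomials
    start from the generators [base] and are multiplied by powers of z. *)
Context (phi : nat -> A -> B) (psi : nat -> B -> A).
Hypotheses (phiL : forall k, linear (phi k)) (psiL : forall k, linear (psi k)).
Hypothesis phiE : forall k u, u \in P -> phi k (monP u) =
  monS (u.1.1, wt u.1.2 u.2) *
    horner_alg zB (trunc_pow k U u.1.2 * trunc_pow k V u.2).
Hypothesis psiE : forall k v, v \in S -> psi k (monS v) =
  monP (base v.1) *
    horner_alg zA ('X^(absz (v.2 - wt (n0 v.1) (n1 v.1))) *
      (trunc_pow k U (- n0 v.1) * trunc_pow k V (- n1 v.1))).

Let base_in s : base s \in P.
Proof. by rewrite memP /= !lexx. Qed.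

Let y0_in : ((0, 1, 0) : int * int * int) \in P.
Proof. by rewrite memP /= n00 n10 lexx. Qed.

Let y1_in : ((0, 0, 1) : int * int * int) \in P.
Proof. by rewrite memP /= n00 n10 lexx. Qed.

Let zB_in : ((0, 1) : int * int) \in S.
Proof. by rewrite memS /= n00 n10 !mulr0. Qed.

Let weight_in u : u \in P -> (u.1.1, wt u.1.2 u.2) \in S.
Proof.
rewrite memP memS /= => /andP[le0 le1].
by apply: lerD; apply: ler_wpM2l.
Qed.

Let base_diff u : u \in P ->
  u = base u.1.1 + (((0, 1, 0) : int * int * int) *+ absz (u.1.2 - n0 u.1.1)
                 + ((0, 0, 1) : int * int * int) *+ absz (u.2 - n1 u.1.1)).
Proof.
move=> Pu; rewrite memP in Pu; case/andP: Pu; case: u => [[s r0] r1] /= le0 le1.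
by rewrite !tripleMn !gez0_abs ?subr_ge0 //; congr (_, _, _) => /=; lia.
Qed.

(** Computations modulo a power of the maximal ideal of [A] are made in an
    arbitrary ring [Q] in which z is nilpotent and the equation of the fibre
    holds; there [U] and [V] have honest inverses. *)
Section JetsA.
Context (Q : comUnitRingType) (k : nat) (q : {rmorphism A -> Q}).
Hypothesis (qE : forall f, E f -> q f = 0) (qz : q zA ^+ k.+1 = 0).

Context (ev : {rmorphism {poly K} -> Q}).
Hypothesis evE : forall T, q (horner_alg zA T) = ev T.

Let evX : ev 'X = q zA. Proof. by rewrite -evE horner_algX. Qed.
Let evC c : ev c%:P = q c%:A. Proof. by rewrite -evE horner_algC. Qed.
Let evXk : ev 'X ^+ k.+1 = 0. Proof. by rewrite evX. Qed.
Let uU : ev U \is a GRing.unit. Proof. by have [] := trunc_powE evXk U0. Qed.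
Let uV : ev V \is a GRing.unit. Proof. by have [] := trunc_powE evXk V0. Qed.

Let q_lin : q (monP (0, 1, 0)) = ev ('X + rho%:P).
Proof. by rewrite rmorphD evX evC -rmorphD /zA subrK. Qed.

Let q_y0 : q (monP (0, 1, 0)) = ev 'X ^+ e0 * ev U.
Proof. by rewrite q_lin UE rmorphM rmorphXn. Qed.

Let q_y1 : q (monP (0, 0, 1)) = ev 'X ^+ e1 * ev V.
Proof.
have E1 : q (monP (0, 0, 1)) = q (monP (0, 1, 0)) ^+ p + q lam%:A.
  have /eqP := qE (erefl : E _).
  rewrite !rmorphB /= -addrA -opprD subr_eq0 => /eqP ->.
  by rewrite -rmorphXn -(monMn hA) // tripleMn !mul0r mul1r.
rewrite E1 q_lin -evC -rmorphXn -rmorphD VE rmorphM; congr (_ * _).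
exact: rmorphXn.
Qed.

Let q_mon u : u \in P -> q (monP u) = q (monP (base u.1.1)) *
  ((ev 'X ^+ e0 * ev U) ^+ absz (u.1.2 - n0 u.1.1) *
   (ev 'X ^+ e1 * ev V) ^+ absz (u.2 - n1 u.1.1)).
Proof.
move=> Pu; rewrite {1}(base_diff Pu) (monD hA) ?(monD hA) ?rpredD ?rpredMn //.
by rewrite !rmorphM !(monMn hA) // !rmorphXn /= q_y0 q_y1.
Qed.

Lemma from_modelX v : v \in S -> q (psi k (monS v)) = q (monP (base v.1)) *
  (ev 'X ^+ absz (v.2 - wt (n0 v.1) (n1 v.1)) *
    (ev U ^ (- n0 v.1) * ev V ^ (- n1 v.1))).
Proof.
move=> Sv; rewrite psiE // rmorphM /=; congr (_ * _).
rewrite evE !rmorphM rmorphXn.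
have [_ ->] := trunc_powE evXk U0; have [_ ->] := trunc_powE evXk V0.
by [].
Qed.

(** The product of the generators of degrees [s] and [s'] is the generator of
    degree [s + s'] times y0^i0 y1^i1; since y0 = z^e0 U and y1 = z^e1 V in
    [Q], the surplus splits into a power of z, which is the one prescribed by
    the exponents of [B], and powers of the units, which are linear in the
    exponents. *)
Lemma from_model_morphism : exists F : {rmorphism B -> Q},
  (forall f, F f = q (psi k f)) /\ (forall T, F (horner_alg zB T) = ev T).
Proof.
have zS : (0 : int * int) \in S by apply: rpred0.
have psi0 : q (psi k (monS 0)) = 1.
  rewrite from_modelX //= n00 n10 /wt !mulr0 subr0 expr0 !expr0z !mulr1.
  by rewrite -[base 0]/(0, n0 0, n1 0) n00 n10 (mon0 hA) rmorph1.
have [F FE] : exists F : {rmorphism B -> Q}, forall f, F f = q (psi k f).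
  apply: (morphism_on_monomials hB) => // -[s r] [s' r'] Su Sv.
  have := rpredD Su Sv; set w := _ + _ => Sw.
  rewrite !from_modelX //=.
  have := q_mon (rpredD (base_in s) (base_in s')).
  rewrite (monD hA) // rmorphM /=; set i0 := n0 s + n0 s' - _; set i1 := n1 s + n1 s' - _.
  move=> E1.
  have : base s + base s' \in P by apply: rpredD.
  rewrite memP /= => /andP[]; rewrite -subr_ge0 -/i0 => i0_ge0.
  rewrite -subr_ge0 -/i1 => i1_ge0.
  have wS t : t \in S -> 0 <= t.2 - wt (n0 t.1) (n1 t.1) by rewrite memS subr_ge0.
  have := wS _ Su; have := wS _ Sv; have := wS _ Sw => /= ge0'' ge0' ge0.
  rewrite [RHS]mulrACA E1 -!mulrA; congr (_ * _); rewrite !exprMn -!exprM.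
  set a := ev U; set b := ev V; set t := ev 'X.
  have -> : - n0 (s + s') = (absz i0)%:Z + (- n0 s - n0 s').
    by rewrite gez0_abs // /i0; ring.
  have -> : - n1 (s + s') = (absz i1)%:Z + (- n1 s - n1 s').
    by rewrite gez0_abs // /i1; ring.
  set j := r - _ in ge0 *; set j' := r' - _ in ge0' *; set j'' := r + r' - _ in ge0'' *.
  have -> : `|j''|%N = (e0 * `|i0| + e1 * `|i1| + `|j| + `|j'|)%N.
    apply/eqP; rewrite -eqz_nat !PoszD !PoszM !gez0_abs //; apply/eqP.
    by rewrite /j /j' /j'' /i0 /i1 /wt; ring.
  rewrite -!exprn_exprz // !exprzDr // !exprD; ring.
exists F; split=> //; move=> T.
apply: (poly_morphism_eq (f := F \o horner_alg zB) (g := ev)) => [c|] /=.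
  by rewrite horner_algC FE (linear_Z (psiL k)) -(mon0 hB) -mulr_algl rmorphM /= psi0 mulr1 evC.
rewrite horner_algX FE from_modelX //= n00 n10 /wt !mulr0 subr0 expr1 !expr0z !mulr1.
by rewrite -[base 0]/(0, n0 0, n1 0) n00 n10 (mon0 hA) rmorph1 mul1r.
Qed.

Lemma from_to_model f : q (psi k (phi k f)) = q f.
Proof.
have [F [FE Fev]] := from_model_morphism; rewrite -FE.
have qA c g : q (c *: g) = q c%:A * q g by rewrite -[c *: g]mulr_algl rmorphM.
have FA c g : F (c *: g) = q c%:A * F g.
  by rewrite -[c *: g]mulr_algl rmorphM -(horner_algC zB) Fev evC.
move: f; apply: (eq_on_monomials hA (s := fun c z => q c%:A * z)).
- by move=> c f g /=; rewrite (phiL k) rmorphD FA.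
- by move=> c f g; rewrite rmorphD qA.
move=> u Pu; rewrite phiE // rmorphM Fev FE from_modelX ?weight_in // (q_mon Pu) /=.
rewrite rmorphM; have [_ ->] := trunc_powE evXk U0; have [_ ->] := trunc_powE evXk V0.
move: (Pu); rewrite memP; case: u Pu => [[s r0] r1] /= Pu /andP[le0 le1].
rewrite -!mulrA; congr (_ * _); rewrite !exprMn -!exprM.
set a := ev U; set b := ev V; set t := ev 'X.
have i0_ge0 : 0 <= r0 - n0 s by rewrite subr_ge0.
have i1_ge0 : 0 <= r1 - n1 s by rewrite subr_ge0.
set i0 := r0 - _ in i0_ge0 *; set i1 := r1 - _ in i1_ge0 *.
have -> : `|wt r0 r1 - wt (n0 s) (n1 s)|%N = (e0 * `|i0| + e1 * `|i1|)%N.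
  apply/eqP; rewrite -eqz_nat !PoszD !PoszM.
  have -> : wt r0 r1 - wt (n0 s) (n1 s) = e0%:Z * i0 + e1%:Z * i1 by rewrite /wt /i0 /i1; ring.
  by rewrite !gez0_abs // addr_ge0 // mulr_ge0.
have powE (c : Q) n r i : c \is a GRing.unit -> 0 <= i -> i = r - n ->
    c ^+ `|i|%N = c ^ (- n) * c ^ r.
  by move=> uc i_ge0 iE; rewrite -exprzDr // addrC -iE -[in RHS](gez0_abs i_ge0).
rewrite (powE a _ _ _ uU i0_ge0 erefl) (powE b _ _ _ uV i1_ge0 erefl) exprD.
ring.
Qed.
End JetsA.

Section JetsB.
Context (Q : comUnitRingType) (k : nat) (q : {rmorphism B -> Q}).
Hypothesis (qz : q zB ^+ k.+1 = 0).
Context (ev : {rmorphism {poly K} -> Q}).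
Hypothesis evE : forall T, q (horner_alg zB T) = ev T.

Let evX : ev 'X = q zB. Proof. by rewrite -evE horner_algX. Qed.
Let evC c : ev c%:P = q c%:A. Proof. by rewrite -evE horner_algC. Qed.
Let evXk : ev 'X ^+ k.+1 = 0. Proof. by rewrite evX. Qed.
Let uU : ev U \is a GRing.unit. Proof. by have [] := trunc_powE evXk U0. Qed.
Let uV : ev V \is a GRing.unit. Proof. by have [] := trunc_powE evXk V0. Qed.

Lemma to_modelX u : u \in P -> q (phi k (monP u)) =
  q (monS (u.1.1, wt u.1.2 u.2)) * (ev U ^ u.1.2 * ev V ^ u.2).
Proof.
move=> Pu; rewrite phiE // rmorphM evE rmorphM.
by have [_ ->] := trunc_powE evXk U0; have [_ ->] := trunc_powE evXk V0.
Qed.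

Let q_z r : q (monS (0, r%:Z)) = ev 'X ^+ r.
Proof. by rewrite evX -rmorphXn -(monMn hB) // pairMn /= mul0r mul1r. Qed.

(** The units appear with exponents linear in those of the monomials, so the
    map is multiplicative; it sends y0 to z + rho and y1 to (z + rho)^p + lam,
    hence kills the equation of the fibre. *)
Lemma to_model_morphism : exists F : {rmorphism A -> Q},
  [/\ forall f, F f = q (phi k f), forall T, F (horner_alg zA T) = ev T &
      forall f, E f -> F f = 0].
Proof.
have phi0 : q (phi k (monP 0)) = 1.
  rewrite to_modelX ?rpred0 //= /wt !mulr0 addr0 !expr0z !mulr1.
  by rewrite (mon0 hB) rmorph1.
have [F FE] : exists F : {rmorphism A -> Q}, forall f, F f = q (phi k f).
  apply: (morphism_on_monomials hA) => // u v Pu Pv.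
  rewrite !to_modelX ?rpredD //= !exprzDr //.
  have -> : (u.1.1 + v.1.1, wt (u.1.2 + v.1.2) (u.2 + v.2)) =
      (u.1.1, wt u.1.2 u.2) + (v.1.1, wt v.1.2 v.2) :> (int * int)%type.
    by congr (_, _); rewrite /wt /=; ring.
  rewrite (monD hB) ?weight_in // rmorphM; ring.
have FC c : F c%:A = ev c%:P.
  by rewrite FE (linear_Z (phiL k)) -(mon0 hA) -mulr_algl rmorphM /= phi0 mulr1 evC.
have F0 : F (monP (0, 1, 0)) = ev ('X + rho%:P).
  rewrite FE to_modelX //= /wt mulr0 mulr1 addr0 expr1z expr0z mulr1 q_z.
  by rewrite UE rmorphM rmorphXn.
have F1 : F (monP (0, 0, 1)) = ev (('X + rho%:P) ^+ p + lam%:P).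
  rewrite FE to_modelX //= /wt mulr0 mulr1 add0r expr1z expr0z mul1r q_z.
  by rewrite VE rmorphM rmorphXn.
exists F; split=> //.
- move=> T; apply: (poly_morphism_eq (f := F \o horner_alg zA) (g := ev)) => [c|] /=.
    by rewrite horner_algC FC.
  by rewrite horner_algX /zA rmorphB F0 rmorphD /= FC addrK.
move=> f ->; rewrite !rmorphB F1 /= FC.
have -> : (0, p%:Z, 0) = ((0, 1, 0) : int * int * int) *+ p.
  by rewrite tripleMn !mul0r mul1r.
by rewrite (monMn hA) // rmorphXn /= F0 rmorphD rmorphXn /= addrAC addrK subrr.
Qed.

Lemma to_from_model g : q (phi k (psi k g)) = q g.
Proof.
have [F [FE Fev _]] := to_model_morphism; rewrite -FE.
have qA c h : q (c *: h) = q c%:A * q h by rewrite -[c *: h]mulr_algl rmorphM.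
have FA c h : F (c *: h) = q c%:A * F h.
  by rewrite -[c *: h]mulr_algl rmorphM -(horner_algC zA) Fev evC.
move: g; apply: (eq_on_monomials hB (s := fun c z => q c%:A * z)).
- by move=> c f g /=; rewrite (psiL k) rmorphD FA.
- by move=> c f g; rewrite rmorphD qA.
move=> v Sv; rewrite psiE // rmorphM Fev FE to_modelX //=.
rewrite !rmorphM rmorphXn /=.
have [_ ->] := trunc_powE evXk U0; have [_ ->] := trunc_powE evXk V0.
have := Sv; rewrite memS -subr_ge0 => ge0; case: v Sv ge0 => s r /= Sv.
set i := r - _ => i_ge0.
have -> : (s, r) = (s, wt (n0 s) (n1 s)) + (0, `|i|%N%:Z) :> (int * int)%type.
  by congr (_, _) => /=; rewrite ?addr0 // gez0_abs // /i /wt; ring.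
rewrite (monD hB) ?(weight_in (base_in s)) //; last first.
  by rewrite memS /= n00 n10 !mulr0 addr0.
rewrite rmorphM /= q_z -!mulrA; congr (_ * _).
have inv (c : Q) n : c \is a GRing.unit -> c ^ n * c ^ (- n) = 1.
  by move=> uc; rewrite -exprzDr // subrr expr0z.
transitivity (ev 'X ^+ `|i|%N * (ev U ^ n0 s * ev U ^ (- n0 s)) * (ev V ^ n1 s * ev V ^ (- n1 s))).
  by ring.
by rewrite !inv // !mulr1.
Qed.
End JetsB.

Section Point.
Context (x : A -> K).
Hypotheses (hx : scheme_point E x) (xz : x zA = 0).

Let y g := x (psi 0 g).

(** The point of the model is induced by any [psi k]: at [x] one has z = 0, so
    the precision of the truncation does not matter. *)
Lemma model_point : [/\ scheme_point set0 y, y zB = 0,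
  forall k g, x (psi k g) = y g & forall k f, y (phi k f) = x f].
Proof.
have [x' xE] := point_morphism hx.
have x'E f : E f -> x' f = 0 by rewrite xE; case: hx => _ _; apply.
have x'z k : x' zA ^+ k.+1 = 0 by rewrite xE xz expr0n.
pose ev : {rmorphism {poly K} -> K} := x' \o horner_alg zA.
have evE T : x' (horner_alg zA T) = ev T by [].
have yS : scalar y by move=> c f g; rewrite /y (psiL 0); case: hx => ->.
have y_psi k : (fun g => x (psi k g)) =1 y.
  apply: (eq_on_monomials hB (s := *%R)) => [c f g||v Sv]; last 1 first.
  - rewrite /y -xE (from_modelX (x'z k) evE Sv).
    by rewrite (from_modelX (x'z 0) evE Sv).
  - by rewrite (psiL k); case: hx => ->.
  exact: yS.
have [F [FE Fev]] := from_model_morphism x'E (x'z 0) evE.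
have yF g : y g = F g by rewrite FE xE.
split=> //; last 1 first.
- by move=> k f; rewrite -(y_psi k) -xE (from_to_model x'E (x'z k) evE).
- split=> //; split; rewrite ?yF ?rmorph1 // => f g; rewrite !yF; exact: rmorphM.
- by rewrite yF -(horner_algX zB) Fev -evE horner_algX xE.
Qed.

Lemma model_jet_equiv : jet_equiv E x set0 y.
Proof.
have [hy yz y_psi y_phi] := model_point.
exists phi, psi; split.
- apply: jets_of_family => // k k_gt0 Q q qP.
  have qz j : (k <= j.+1)%N -> q zB ^+ j.+1 = 0.
    move=> le_kj; rewrite -(subnK le_kj) exprD -[q zB ^+ k]rmorphXn /=.
    by rewrite [q (zB ^+ k)](iffRL (qP _)) ?mulr0 //; apply: mp_exp.
  pose ev : {rmorphism {poly K} -> Q} := q \o horner_alg zB.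
  have evE T : q (horner_alg zB T) = ev T by [].
  have qk : q zB ^+ k.+1 = 0 by apply: qz.
  have qk1 : q zB ^+ k.+2 = 0 by apply: qz; apply: leq_trans (leqnSn k) _.
  split; first by have [F [FE _ F0]] := to_model_morphism qk evE; exists F.
  apply: (eq_on_monomials hA (s := fun c z => q c%:A * z)) => [c f g|c f g|u Pu].
  + by rewrite (phiL k.+1) rmorphD -[c *: phi k.+1 f]mulr_algl rmorphM.
  + by rewrite (phiL k) rmorphD -[c *: phi k f]mulr_algl rmorphM.
  by rewrite (to_modelX qk evE Pu) (to_modelX qk1 evE Pu).
- apply: jets_of_family => // k k_gt0 Q q qP.
  have qE f : E f -> q f = 0 by move=> Ef; apply/qP; apply: mp_E.
  have qz j : (k <= j.+1)%N -> q zA ^+ j.+1 = 0.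
    move=> le_kj; rewrite -(subnK le_kj) exprD -[q zA ^+ k]rmorphXn /=.
    by rewrite [q (zA ^+ k)](iffRL (qP _)) ?mulr0 //; apply: mp_exp.
  pose ev : {rmorphism {poly K} -> Q} := q \o horner_alg zA.
  have evE T : q (horner_alg zA T) = ev T by [].
  have qk : q zA ^+ k.+1 = 0 by apply: qz.
  have qk1 : q zA ^+ k.+2 = 0 by apply: qz; apply: leq_trans (leqnSn k) _.
  split; first by have [F [FE _]] := from_model_morphism qE qk evE; exists F.
  apply: (eq_on_monomials hB (s := fun c z => q c%:A * z)) => [c f g|c f g|v Sv].
  + by rewrite (psiL k.+1) rmorphD -[c *: psi k.+1 f]mulr_algl rmorphM.
  + by rewrite (psiL k) rmorphD -[c *: psi k f]mulr_algl rmorphM.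
  by rewrite (from_modelX qk evE Sv) (from_modelX qk1 evE Sv).
- case=> [|k] f; first exact: mp_all.
  have [Q [q qP]] := jet_ring hx (ltn0Sn k).
  have qE g : E g -> q g = 0 by move=> Eg; apply/qP; apply: mp_E.
  apply/qP; rewrite rmorphB /=.
  rewrite (from_to_model (k := k.+1) qE (ev := q \o horner_alg zA) _ (fun=> erefl)) ?subrr //.
  by rewrite exprS -rmorphXn /= [q (zA ^+ k.+1)](iffRL (qP _)) ?mulr0 //; apply: mp_exp.
- case=> [|k] g; first exact: mp_all.
  have [Q [q qP]] := jet_ring hy (ltn0Sn k).
  apply/qP; rewrite rmorphB /=.
  rewrite (to_from_model (k := k.+1) (ev := q \o horner_alg zB) _ (fun=> erefl)) ?subrr //.
  by rewrite exprS -rmorphXn /= [q (zB ^+ k.+1)](iffRL (qP _)) ?mulr0 //; apply: mp_exp.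
Qed.
End Point.
End LocalModel.

(** The last two clauses say that the point [y] is fixed by the torus exactly
    when [x] is: the monomials of nonzero degree correspond up to units. *)
Theorem local_model (K : fieldType) (P : addrClosed (int * int * int)%type)
    (S : addrClosed (int * int)%type) (n0 n1 : int -> int)
    (A : comAlgType K) (monP : int * int * int -> A)
    (B : comAlgType K) (monS : int * int -> B)
    (hA : monoid_algebra P monP) (hB : monoid_algebra S monS)
    (p : nat) (lam rho : K) (e0 e1 : nat) (U V : {poly K}) :
    (forall u, (u \in P) = (n0 u.1.1 <= u.1.2) && (n1 u.1.1 <= u.2)) ->
    (forall v, (v \in S) = (e0%:Z * n0 v.1 + e1%:Z * n1 v.1 <= v.2)) ->
    n0 0 = 0 -> n1 0 = 0 ->
    'X + rho%:P = 'X^e0 * U -> ('X + rho%:P) ^+ p + lam%:P = 'X^e1 * V ->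
    U.[0] != 0 -> V.[0] != 0 ->
  let E := [set monP (0, 0, 1) - monP (0, p%:Z, 0) - lam%:A]%classic in
  forall x, scheme_point E x -> x (monP (0, 1, 0)) = rho ->
  exists y, [/\ scheme_point set0 y, jet_equiv E x set0 y, y (monS (0, 1)) = 0,
    forall u, u \in P -> x (monP u) != 0 ->
      y (monS (u.1.1, e0%:Z * u.1.2 + e1%:Z * u.2)) != 0 &
    (forall u, u \in P -> u.1.1 != 0 -> x (monP u) = 0) ->
    forall v, v \in S -> v.1 != 0 -> y (monS v) = 0].
Proof.
move=> memP memS n00 n10 UE VE U0 V0 E x hx xy0.
have [phi phiP] := choice (fun k => mon_ext hA (fun u =>
  monS (u.1.1, e0%:Z * u.1.2 + e1%:Z * u.2) *
    horner_alg (monS (0, 1)) (trunc_pow k U u.1.2 * trunc_pow k V u.2))).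
pose wt (r0 r1 : int) : int := e0%:Z * r0 + e1%:Z * r1.
have [psi psiP] := choice (fun k => mon_ext hB (fun v =>
  monP (v.1, n0 v.1, n1 v.1) *
    horner_alg (monP (0, 1, 0) - rho%:A)
      ('X^(absz (v.2 - wt (n0 v.1) (n1 v.1))) *
      (trunc_pow k U (- n0 v.1) * trunc_pow k V (- n1 v.1))))).
have phiL k : linear (phi k) by case: (phiP k).
have psiL k : linear (psi k) by case: (psiP k).
have phiE k := (phiP k).2; have psiE k := (psiP k).2.
have xz : x (monP (0, 1, 0) - rho%:A) = 0.
  by have [x' xE] := point_morphism hx; rewrite -xE rmorphB /= xE xy0 (pointA hx) subrr.
have hy := model_point hA hB memP memS n00 n10 UE VE U0 V0 phiL psiL phiE psiE hx xz.
have jy := model_jet_equiv hA hB memP memS n00 n10 UE VE U0 V0 phiL psiL phiE psiE hx xz.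
case: hy => hy yz y_psi y_phi.
exists (fun g => x (psi 0 g)); split=> //.
- move=> u Pu; rewrite -(y_phi 0) phiE //=.
  have [y' yE] := point_morphism hy; apply: contraNneq => y0.
  by rewrite -[x _]/((fun g => x (psi 0 g)) _) -yE rmorphM /= yE y0 mul0r.
move=> x0 v Sv v0; rewrite psiE //.
have [x' xE] := point_morphism hx; rewrite -xE rmorphM /= xE x0 ?mul0r //.
by rewrite memP /= !lexx.
Qed.

(** * Cones over a segment *)

Section Slab.
Context (R : archiRealFieldType).

(** The value of the exponent [v] = (s, r) on the vector (theta, 1), that is on
    the point [theta] of a slice placed at height one. *)
Definition height (theta : R) (v : int * int) : R :=
  theta * v.1%:~R + v.2%:~R.

Lemma heightD theta u v : height theta (u + v) = height theta u + height theta v.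
Proof. by rewrite /height /= !rmorphD /=; ring. Qed.

Lemma heightMn theta u n : height theta (u *+ n) = height theta u *+ n.
Proof.
elim: n => [|n IHn]; last by rewrite !mulrS heightD IHn.
by rewrite !mulr0n /height /= mulr0 addr0.
Qed.

Lemma large_multiple (c b : R) : 0 < c -> exists N : nat, b <= c *+ N.
Proof.
move=> c_gt0; exists (Num.bound `|b / c|).
rewrite -mulr_natr mulrC -ler_pdivrMr //; apply: ltW.
exact: (le_lt_trans (ler_norm _) (archi_boundP (normr_ge0 _))).
Qed.

(** the exponents in the dual of the cone over the segment (beta, gamma) *)
Definition slab (beta gamma : R) : {pred int * int} :=
  fun v => (0 <= height beta v) && (0 <= height gamma v).

Fact slab_closed beta gamma : addr_closed (slab beta gamma).
Proof.
split=> [|u v]; first by rewrite unfold_in /slab /height !mulr0 !addr0 lexx.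
rewrite !unfold_in /slab => /andP[? ?] /andP[? ?].
by rewrite !heightD; apply/andP; split; apply: addr_ge0.
Qed.
HB.instance Definition _ beta gamma :=
  GRing.isAddClosed.Build (int * int)%type (slab beta gamma) (slab_closed beta gamma).

Section SmoothSlab.
Context (beta gamma : R) (P : addrClosed (int * int)%type).
Hypothesis memP : forall v, (v \in P) = (0 <= height beta v) && (0 <= height gamma v).
Context (K : fieldType) (A : comAlgType K) (mon : int * int -> A).
Hypothesis hA : monoid_algebra P mon.
Context (x : A -> K) (hx : scheme_point set0 x).

(** The primitive vector u1 on the edge of [u0] is invertible at [x]. It can be
    completed to a basis of the lattice by a vector of [P]: start from any
    complement on the correct side and add multiples of u1. *)
Lemma smooth_slab_edge u0 : u0 \in P -> u0.1 != 0 -> x (mon u0) != 0 ->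
  height beta u0 = 0 -> smooth_at set0 x.
Proof.
case: u0 => s0 r0 /= Pu s0_neq0 xu0 hu0.
have [x' xE] := point_morphism hx.
pose g := gcdz s0 r0.
have g_gt0 : 0 < g by rewrite /g /gcdz ltz_nat gcdn_gt0 absz_gt0 s0_neq0.
have g_neq0 : g != 0 by rewrite gt_eqF.
pose s1 := (s0 %/ g)%Z; pose r1 := (r0 %/ g)%Z.
have s0E : s0 = g * s1 by rewrite mulrC divzK // dvdz_gcdl.
have r0E : r0 = g * r1 by rewrite mulrC divzK // dvdz_gcdr.
have [a [b abE]] := Bezoutz s0 r0.
have ab1 : a * s1 + b * r1 = 1.
  by apply: (mulfI g_neq0); rewrite mulr1 -[RHS]abE s0E r0E; ring.
have s1_neq0 : s1 != 0 by apply: contraNneq s0_neq0 => s10; rewrite s0E s10 mulr0.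
pose e := sgz s1.
have ee : e * e = 1 by rewrite /e; case: sgzP s1_neq0.
have es1 : 0 < e * s1 by rewrite -abszEsg ltz_nat absz_gt0.
pose u1 : int * int := (s1, r1).
pose w0 : int * int := (- e * b, e * a).
have gN : exists2 m : nat, (0 < m)%N & g = m%:Z.
  by exists `|g|%N; rewrite ?absz_gt0 // gtz0_abs.
have [m m_gt0 gm] := gN.
have u0E : (s0, r0) = u1 *+ m.
  by rewrite pairMn /= s0E r0E gm; congr (_, _); rewrite mulrC.
have hE th : height th (s0, r0) = height th u1 *+ m by rewrite u0E heightMn.
have hu1 : height beta u1 = 0.
  by move/eqP: hu0; rewrite hE mulrn_eq0 -leqn0 leqNgt m_gt0 => /eqP.
have hu1g : 0 <= height gamma u1.
  by move: Pu; rewrite memP hE => /andP[_]; rewrite hE pmulrn_lge0.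
have Pu1 : u1 \in P by rewrite memP hu1 lexx hu1g.
have hs t : s1%:~R * height beta t = (s1 * t.2 - r1 * t.1)%:~R.
  move: hu1; rewrite /height /= => /eqP; rewrite addr_eq0 => /eqP hb.
  by rewrite mulrDr mulrA [s1%:~R * beta]mulrC hb rmorphB !rmorphM /=; ring.
have c2_ge0 t : t \in P -> 0 <= e * (s1 * t.2 - r1 * t.1).
  rewrite memP => /andP[h0 _]; rewrite -(ler0z R) rmorphM /= -hs mulrA -rmorphM /=.
  by rewrite mulr_ge0 // ler0z ltW.
have hw0 : 0 <= height beta w0.
  have : 0 < (e * s1)%:~R :> R by rewrite ltr0z.
  move/pmulr_rge0 <-; rewrite rmorphM -mulrA hs -rmorphM /= ler0z.
  have -> : e * (s1 * (e * a) - r1 * (- e * b)) = (e * e) * (a * s1 + b * r1) by ring.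
  by rewrite ee ab1.
have [N hN] : exists N : nat, 0 <= height gamma w0 + height gamma u1 *+ N.
  have [h1|h1] := eqVneq (height gamma u1) 0.
    exists 0%N; rewrite addr0; suff <- : beta = gamma by [].
    have : (beta - gamma) * s1%:~R = 0.
      by move: hu1 h1; rewrite /height /= => h0 h1; rewrite -[RHS](subrr 0) -{1}h0 -h1; ring.
    by move/eqP; rewrite mulf_eq0 intr_eq0 (negPf s1_neq0) orbF subr_eq0 => /eqP.
  have h1_gt0 : 0 < height gamma u1 by rewrite lt0r h1.
  have [N hN] := large_multiple (- height gamma w0) h1_gt0.
  by exists N; rewrite addrC -[X in _ + X]opprK subr_ge0.
pose w := w0 + u1 *+ N.
have Pw : w \in P by rewrite memP !heightD !heightMn hu1 mul0rn addr0 hw0.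
pose c2 (t : int * int) := e * (s1 * t.2 - r1 * t.1).
pose c1 (t : int * int) := a * t.1 + b * t.2 - N%:Z * c2 t.
have wE : w = (- e * b + N%:Z * s1, e * a + N%:Z * r1).
  by rewrite /w pairMn; congr (_, _) => /=; ring.
apply: (smooth_toric hA hx (u1 := u1) (u2 := w) (c1 := c1) (c2 := c2)) => //.
- by move=> u v; rewrite /c1 /c2 /=; ring.
- by move=> u v; rewrite /c2 /=; ring.
- by rewrite /c1 /c2 /= -[RHS]ab1; ring.
- rewrite wE /c1 /c2 /=.
  have -> : a * (- e * b + N%:Z * s1) + b * (e * a + N%:Z * r1)
     - N%:Z * (e * (s1 * (e * a + N%:Z * r1) - r1 * (- e * b + N%:Z * s1))) =
     N%:Z * (a * s1 + b * r1) * (1 - e * e) by ring.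
  by rewrite ee subrr mulr0.
- by rewrite /c2 /=; ring.
- rewrite wE /c2 /=.
  have -> : e * (s1 * (e * a + N%:Z * r1) - r1 * (- e * b + N%:Z * s1)) =
     (e * e) * (a * s1 + b * r1) by ring.
  by rewrite ee ab1.
- move=> [t1 t2] _; rewrite !pairMz wE /c1 /c2 /=; congr (_, _) => /=.
    have -> : s1 * (a * t1 + b * t2 - N%:Z * (e * (s1 * t2 - r1 * t1))) +
      (- e * b + N%:Z * s1) * (e * (s1 * t2 - r1 * t1)) =
      (a * s1 + b * r1) * t1 + (1 - e * e) * b * (s1 * t2 - r1 * t1) by ring.
    by rewrite ab1 ee; ring.
  have -> : r1 * (a * t1 + b * t2 - N%:Z * (e * (s1 * t2 - r1 * t1))) +
    (e * a + N%:Z * r1) * (e * (s1 * t2 - r1 * t1)) =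
    (a * s1 + b * r1) * t2 - (1 - e * e) * a * (s1 * t2 - r1 * t1) by ring.
  by rewrite ab1 ee; ring.
move=> v _; right; apply: contraNneq xu0 => x0.
by rewrite u0E (monMn hA) // -xE rmorphXn /= xE x0 expr0n -leqn0 leqNgt m_gt0.
Qed.

Lemma unit_height_in : ((0, 1) : int * int) \in P.
Proof. by rewrite memP /height /= !mulr0 !add0r ler01. Qed.

Lemma height_unit theta : height theta (0, 1) = 1.
Proof. by rewrite /height /= mulr0 add0r. Qed.
End SmoothSlab.

(** A monomial in the interior of the dual cone has a multiple that is
    divisible by z, so it vanishes with z; the exponent [u] is thus on an
    edge. *)
Lemma smooth_slab (beta gamma : R) (P : addrClosed (int * int)%type)
    (K : fieldType) (A : comAlgType K) (mon : int * int -> A) (x : A -> K) u :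
    (forall v, (v \in P) = (0 <= height beta v) && (0 <= height gamma v)) ->
    monoid_algebra P mon -> scheme_point set0 x -> x (mon (0, 1)) = 0 ->
    u \in P -> u.1 != 0 -> x (mon u) != 0 ->
  smooth_at set0 x.
Proof.
move=> memP hA hx xz Pu u0 xu; have [x' xE] := point_morphism hx.
have memP' v : (v \in P) = (0 <= height gamma v) && (0 <= height beta v).
  by rewrite memP andbC.
have [hb|hb] := eqVneq (height beta u) 0; first exact: (smooth_slab_edge memP hA hx Pu).
have [hg|hg] := eqVneq (height gamma u) 0; first exact: (smooth_slab_edge memP' hA hx Pu).
have /andP[hb0 hg0] : (0 <= height beta u) && (0 <= height gamma u) by rewrite -memP.
have [N1 hN1] : exists N : nat, 1 <= height beta u *+ N by apply: large_multiple; rewrite lt0r hb.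
have [N2 hN2] : exists N : nat, 1 <= height gamma u *+ N by apply: large_multiple; rewrite lt0r hg.
pose N := (N1 + N2)%N; pose w := u *+ N - (0, 1).
have heightB theta : height theta w = height theta u *+ N - 1.
  apply/eqP; rewrite eq_sym subr_eq -heightMn -(height_unit theta) -heightD.
  by rewrite /w subrK.
have Pw : w \in P.
  rewrite memP !heightB !subr_ge0 /N !mulrnDr; apply/andP; split.
    by rewrite (le_trans hN1) // lerDl mulrn_wge0.
  by rewrite (le_trans hN2) // lerDr mulrn_wge0.
have : x (mon (u *+ N)) = 0.
  have -> : u *+ N = (0, 1) + w by rewrite addrC subrK.
  by rewrite (monD hA) ?(unit_height_in memP) // -xE rmorphM /= xE xz mul0r.
rewrite (monMn hA) // -xE rmorphXn /= xE => /eqP; rewrite expf_eq0 (negPf xu) andbF.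
by [].
Qed.

(** The only monomials of degree 0 are the powers of z. *)
Lemma slab_vertex (beta gamma : R) (P : addrClosed (int * int)%type)
    (K : fieldType) (A : comAlgType K) (mon : int * int -> A) (x : A -> K) :
    (forall v, (v \in P) = (0 <= height beta v) && (0 <= height gamma v)) ->
    monoid_algebra P mon -> scheme_point set0 x -> x (mon (0, 1)) = 0 ->
    (forall v, v \in P -> v.1 != 0 -> x (mon v) = 0) ->
  forall v, v \in P -> x (mon v) = (v == 0)%:R.
Proof.
move=> memP hA hx xz x0 v Pv; have [x' xE] := point_morphism hx.
have [->|] := eqVneq v 0; first by rewrite (mon0 hA) -xE rmorph1.
case: v Pv => s r Pv v0; have [s0|s_neq0] := eqVneq s 0; last exact: x0.
subst s; move: (Pv); rewrite memP /height /= !mulr0 !add0r andbb ler0z => r_ge0.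
have -> : (0, r) = ((0, 1) : int * int) *+ absz r by rewrite pairMn mul0r mul1r gez0_abs.
rewrite (monMn hA) ?(unit_height_in memP) // -xE rmorphXn /= xE xz expr0n absz_eq0.
by have [r0|//] := eqVneq r 0; rewrite r0 eqxx in v0.
Qed.
End Slab.

(** * Isomorphisms of jets from isomorphisms of algebras *)

(** A surjection of algebras with kernel spanned by the equations [F] of the
    source identifies the two schemes, hence the jets at their points. *)
Lemma jet_equiv_of_surjection (K : fieldType) (A B : comAlgType K) (F : set B)
    (x : A -> K) (y : B -> K) (psi : {rmorphism B -> A}) (phi : A -> B) :
    linear phi -> linear psi -> cancel phi psi ->
    (forall g, psi g = 0 -> ideal_span F g) -> (forall g, F g -> psi g = 0) ->
    (forall g, y g = x (psi g)) ->
  jet_equiv set0 x F y.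
Proof.
move=> phiL psiL phiK kerF F0 yE.
have inF k g : psi g = 0 -> maxideal_pow F y k g.
  move=> /kerF; apply: ideal_span_sub; [exact: mp0|exact: mpD|exact: mpM|].
  by move=> f Ff; apply: mp_E.
exists (fun=> phi), (fun=> psi); split.
- split=> [k|k f]; last by rewrite subrr; apply: mp0.
  split=> //.
  + by apply: inF; rewrite rmorphB /= phiK rmorph1 subrr.
  + by move=> f g; apply: inF; rewrite rmorphB rmorphM /= !phiK subrr.
  + by move=> f; rewrite yE phiK.
- split=> [k|k f]; last by rewrite subrr; apply: mp0.
  split=> //.
  + by rewrite rmorph1 subrr; apply: mp0.
  + by move=> f g; rewrite rmorphM subrr; apply: mp0.
  + by move=> f /F0 ->; apply: mp0.
- by move=> k f; rewrite phiK subrr; apply: mp0.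
by move=> k g; apply: inF; rewrite rmorphB /= phiK subrr.
Qed.

(** As [g] is additive, the linear map that sends the monomial of [v] to that of
    [g v] is a morphism of algebras; [f] provides its linear inverse. *)
Lemma jet_equiv_of_monoid_iso (K : fieldType) (G H : zmodType)
    (P : addrClosed G) (Q : addrClosed H) (A B : comAlgType K)
    (monA : G -> A) (monB : H -> B) (x : A -> K) (y : B -> K)
    (f : G -> H) (g : H -> G) :
    monoid_algebra P monA -> monoid_algebra Q monB ->
    zmod_morphism g -> (forall u, u \in P -> f u \in Q) -> (forall v, v \in Q -> g v \in P) ->
    {in P, cancel f g} -> {in Q, cancel g f} ->
    scheme_point set0 x -> scheme_point set0 y ->
    (forall v, v \in Q -> y (monB v) = x (monA (g v))) ->
  jet_equiv set0 x set0 y.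
Proof.
move=> hA hB gB fQ gP fK gK hx hy xy.
have [phi [phiL phiE]] := mon_ext hA (fun u => monB (f u)).
have [psi0 [psiL psiE]] := mon_ext hB (fun v => monA (g v)).
have gD u v : g (u + v) = g u + g v.
  by have := gB (u + v) v; rewrite addrK => ->; rewrite subrK.
have g0 : g 0 = 0 by have := gB 0 0; rewrite !subrr.
have [psi psi0E] : exists F : {rmorphism B -> A}, forall h, F h = psi0 h.
  apply: (morphism_on_monomials hB (q := idfun)) => //=.
    by rewrite psiE ?rpred0 // g0 (mon0 hA).
  by move=> u v Qu Qv; rewrite !psiE ?rpredD // gD (monD hA) ?gP.
have psiL' : linear psi by move=> c u v; rewrite !psi0E psiL.
have psiK : cancel psi phi.
  apply: (eq_on_monomials hB (s := *:%R)) => // [c u v|v Qv]; first by rewrite psiL' phiL.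
  by rewrite psi0E psiE // phiE ?gP // gK.
apply: (jet_equiv_of_surjection (psi := psi) (phi := phi)) => //.
- apply: (eq_on_monomials hA (s := *:%R)) => // [c u v|u Pu]; first by rewrite phiL psiL'.
  by rewrite phiE // psi0E psiE ?fQ // fK.
- move=> h h0; have := linear_B phiL 0 0; rewrite !subrr => phi0.
  by rewrite -[h]psiK h0 phi0; apply: ideal_span0.
apply: (eq_on_monomials hB (s := *%R)) => [||v Qv].
- by case: hy.
- by move=> c u v; rewrite psiL'; case: hx => ->.
by rewrite xy // psi0E psiE.
Qed.

Section TypeA.
Context (K : fieldType) (R : archiRealFieldType) (d : nat) (d_gt0 : (0 < d)%N).
Context (P : addrClosed (int * int)%type) (A : comAlgType K) (mon : int * int -> A).
Hypothesis memP : forall v,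
  (v \in P) = (0 <= height (0 : R) v) && (0 <= height (d%:R : R) v).
Hypothesis hA : monoid_algebra P mon.
Context (x : A -> K) (hx : scheme_point set0 x).
Hypothesis xE : forall v, v \in P -> x (mon v) = (v == 0)%:R.

Local Notation B := (mpoly.mpoly 3 K).
Let X (i : 'I_3) : B := mpoly.mpolyX K (mpoly.mnm1 i).
Local Notation X0 := (X (inord 0)).
Local Notation X1 := (X (inord 1)).
Local Notation X2 := (X (inord 2)).
Local Notation F := ([set X0 * X1 - X2 ^+ d]%classic : set B).

Let memE v : (v \in P) = (0 <= v.2) && (0 <= d%:Z * v.1 + v.2).
Proof.
rewrite memP /height mul0r add0r ler0z; congr (_ && _).
by rewrite -(ler0z R) rmorphD rmorphM /=.
Qed.

Let prod3 (T : comNzRingType) (G : 'I_3 -> T) :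
  \prod_i G i = G (inord 0) * G (inord 1) * G (inord 2).
Proof.
rewrite !big_ord_recl big_ord0 mulr1 mulrA; congr (G _ * G _ * G _);
  by apply/val_inj; rewrite /= inordK.
Qed.

(** The dual cone is generated by (1, 0), (-1, d) and (0, 1), with the single
    relation (1, 0) + (-1, d) = d (0, 1). Modulo XY = Z^d each polynomial is a
    combination of monomials without the factor XY, and these correspond to
    the exponents of the cone, according to the sign of the degree. *)
Lemma jet_equiv_type_A : jet_equiv set0 x F (mpoly.meval (fun=> 0)).
Proof.
pose h (i : 'I_3) : A :=
  match nat_of_ord i with 0%N => mon (1, 0) | 1%N => mon (-1, d%:Z) | _ => mon (0, 1) end.
pose psi : {rmorphism B -> A} := mpoly.mmap (GRing.in_alg A) h.
have psiX i : psi (X i) = h i by rewrite /psi /= mpoly.mmapX mpoly.mmap1U.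
have P0 : ((1, 0) : int * int) \in P by rewrite memE /= mulr1 addr0.
have P1 : ((-1, d%:Z) : int * int) \in P by rewrite memE /= mulrN1 addNr lexx.
have P2 : ((0, 1) : int * int) \in P by rewrite memE /= mulr0.
have h0 : h (inord 0) = mon (1, 0) by rewrite /h inordK.
have h1 : h (inord 1) = mon (-1, d%:Z) by rewrite /h inordK.
have h2 : h (inord 2) = mon (0, 1) by rewrite /h inordK.
have psi_rel : psi (X0 * X1) = psi (X2 ^+ d).
  rewrite rmorphM rmorphXn /= !psiX h0 h1 h2 -(monD hA) // -(monMn hA) //.
  by rewrite pairMn; congr (mon (_, _)); rewrite /= ?subrr ?add0r ?mul0r ?mul1r.
have psiZ c g : psi (c *: g) = c *: psi g.
  by rewrite /psi /= mpoly.mmapZ mulr_algl.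
have psiL : linear psi by move=> c u v; rewrite rmorphD /= psiZ.
(* the normal forms: X^s Z^r for s >= 0, and Y^(-s) Z^(d s + r) for s < 0 *)
have [phi [phiL phiE]] := mon_ext hA (fun v : int * int =>
  if 0 <= v.1 then X0 ^+ absz v.1 * X2 ^+ absz v.2
  else X1 ^+ absz v.1 * X2 ^+ absz (d%:Z * v.1 + v.2)).
have psi_mono (a b c : nat) : psi (X0 ^+ a * X1 ^+ b * X2 ^+ c) =
    mon (a%:Z - b%:Z, c%:Z + d%:Z * b%:Z).
  rewrite !rmorphM !rmorphXn /= !psiX h0 h1 h2 -!(monMn hA) // -!(monD hA) ?rpredD ?rpredMn //.
  by rewrite !pairMn; congr (mon (_, _)) => /=; ring.
have Pabc (a b c : nat) : ((a%:Z - b%:Z, c%:Z + d%:Z * b%:Z) : int * int) \in P.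
  rewrite memE /=.
  have -> : d%:Z * (a%:Z - b%:Z) + (c%:Z + d%:Z * b%:Z) = c%:Z + d%:Z * a%:Z by ring.
  by rewrite addr_ge0 // mulr_ge0.
have phiK : cancel phi psi.
  apply: (eq_on_monomials hA (s := *:%R)) => // [c u v|v Pv]; first by rewrite phiL psiL.
  rewrite phiE //; case: v Pv => s r; rewrite memE /= => /andP[r_ge0 sr_ge0].
  case: ifP => s_sign.
    have := psi_mono `|s|%N 0%N `|r|%N; rewrite expr0 mulr1 => ->.
    by rewrite !gez0_abs // mulr0 subr0 addr0.
  pose ht : int := d%:Z * s + r.
  have := psi_mono 0%N `|s|%N `|ht|%N; rewrite expr0 mul1r => ->.
  have htE : Posz (absz ht) = ht by rewrite gez0_abs.
  have sE : Posz (absz s) = - s by rewrite ltz0_abs // ltNge s_sign.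
  by rewrite htE sE /ht; congr (mon (_, _)); ring.
have in_span (f g : B) : ideal_span F (f - g) -> forall k, ideal_span F (f ^+ k - g ^+ k).
  move=> fg; elim=> [|k IHk]; first by rewrite subrr; apply: ideal_span0.
  have -> : f ^+ k.+1 - g ^+ k.+1 = f ^+ k * (f - g) + g * (f ^+ k - g ^+ k).
    by rewrite !exprS; ring.
  by apply: ideal_spanD; apply: ideal_spanM.
have rel k : ideal_span F ((X0 * X1) ^+ k - (X2 ^+ d) ^+ k).
  by apply: in_span; apply: ideal_span_gen.
have normal g : ideal_span F (g - phi (psi g)).
  elim/mpoly.mpolyind: g => [|c m g _ _ IHg].
    have := linear_B phiL 0 0; rewrite rmorph0 !subrr => ->.
    by rewrite subrr; apply: ideal_span0.
  rewrite psiL phiL opprD addrACA -scalerBr; apply: ideal_spanD => //.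
  rewrite -mulr_algl; apply: ideal_spanM.
  rewrite mpoly.mpolyXE_id prod3 -!/(X _).
  move: (mpoly.fun_of_multinom m (inord 0)) (mpoly.fun_of_multinom m (inord 1))
    (mpoly.fun_of_multinom m (inord 2)) => a b c'; rewrite psi_mono phiE ?Pabc //=.
  case: ifP => ab.
    have le_ba : (b <= a)%N by rewrite subr_ge0 in ab.
    have -> : `|a%:Z - b%:Z|%N = (a - b)%N by rewrite subzn.
    rewrite [(c' + d * b)%N]addnC.
    rewrite -{1}(subnK le_ba) !exprD exprM.
    have := ideal_spanM (X0 ^+ (a - b) * X2 ^+ c') (rel b); congr (ideal_span _ _).
    by rewrite exprMn; ring.
  have le_ab : (a <= b)%N by rewrite ltnW // ltnNge -lez_nat -subr_ge0 ab.
  have -> : `|a%:Z - b%:Z|%N = (b - a)%N by rewrite distnC subzn.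
  have -> : absz (d%:Z * (a%:Z - b%:Z) + (c'%:Z + d%:Z * b%:Z))%R = (d * a + c')%N.
    have -> : d%:Z * (a%:Z - b%:Z) + (c'%:Z + d%:Z * b%:Z) = (d * a + c')%N%:Z.
      by rewrite PoszD PoszM; ring.
    by [].
  rewrite -{1}(subnK le_ab) !exprD exprM.
  have := ideal_spanM (X1 ^+ (b - a) * X2 ^+ c') (rel a); congr (ideal_span _ _).
  by rewrite exprMn; ring.
apply: (jet_equiv_of_surjection (psi := psi) (phi := phi)) => //.
- by move=> g g0; have := normal g; rewrite g0 (_ : phi 0 = 0) ?subr0 //;
    have := linear_B phiL 0 0; rewrite !subrr.
- by move=> g ->; rewrite rmorphB /= psi_rel subrr.
have [x' x'E] := point_morphism hx.
elim/mpoly.mpolyind => [|c m g _ _ IHg]; first by rewrite mpoly.meval0 rmorph0 -x'E rmorph0.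
rewrite mpoly.mevalD mpoly.mevalZ IHg psiL -x'E rmorphD /= x'E (pointZ hx).
congr (c * _ + _); rewrite mpoly.mevalX mpoly.mpolyXE_id !prod3 -!/(X _).
move: (mpoly.fun_of_multinom m (inord 0)) (mpoly.fun_of_multinom m (inord 1))
    (mpoly.fun_of_multinom m (inord 2)) => a b c'; rewrite psi_mono xE ?Pabc //.
rewrite !expr0n xpair_eqE /= -PoszM -PoszD subr_eq0 !eqz_nat addn_eq0 muln_eq0.
rewrite -(prednK d_gt0) /= -!natrM !mulnb; congr (nat_of_bool _)%:R.
by case: (eqVneq b 0%N) => [->|b0]; rewrite ?andbF ?andbT.
Qed.
End TypeA.

(** * Chains and fans *)

Section Chains.

(** The sign is chosen such that the bases met below, which run clockwise from
    the left edge of a dual cone to its right edge, have determinant 1. *)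
Definition det2 (u v : int * int) : int := v.1 * u.2 - u.1 * v.2.

(** From two neighbouring rays of a fan to the next two. On the surface of the
    fan, - x is the self-intersection number of the curve of the second ray. *)
Definition turn (uv : (int * int) * (int * int)) (x : int) :=
  (uv.2, uv.2 *~ x - uv.1).

Definition chain_end (u v : int * int) (b : seq int) : int * int :=
  (foldl turn (u, v) b).2.

Lemma det2_next u v w (x : int) : det2 w (v *~ x - u) = x * det2 w v - det2 w u.
Proof. by rewrite /det2 pairMz /=; ring. Qed.

Lemma det2C u v : det2 v u = - det2 u v. Proof. by rewrite /det2; ring. Qed.

Lemma det2uu u : det2 u u = 0. Proof. by rewrite /det2; ring. Qed.

Lemma det2_turn u v x : det2 u v = 1 -> det2 v (v *~ x - u) = 1.
Proof. by move=> uv; rewrite det2_next det2uu mulr0 sub0r det2C opprK. Qed.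

Context (R : realDomainType) (L : int * int -> R).
Hypothesis LB : zmod_morphism L.

Let L0 : L 0 = 0. Proof. by have := LB 0 0; rewrite !subrr. Qed.
Let LN u : L (- u) = - L u. Proof. by rewrite -sub0r LB L0 sub0r. Qed.
Let LD u v : L (u + v) = L u + L v.
Proof. by rewrite -[v]opprK LB LN !opprK. Qed.
Let LMn u n : L (u *+ n) = L u *+ n.
Proof. by elim: n => [|n IHn]; rewrite ?mulr0n ?L0 // !mulrS LD IHn. Qed.
Let LMz u k : L (u *~ k) = k%:~R * L u.
Proof.
case: k => n; first by rewrite -pmulrn LMn -mulr_natl.
by rewrite NegzE mulrNz LN -pmulrn LMn mulrNz mulNr -mulr_natl.
Qed.
Let Lnext u v x : L (v *~ x - u) = x%:~R * L v - L u.
Proof. by rewrite LB LMz. Qed.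

(** The inner vectors of the fan that starts with [u], [v] and has entries [b]
    lie in the open half-plane L > 0, and the last one in its closure. Unlike
    positivity of the entries, this survives the deletion of a vector. *)
Fixpoint positive_chain (u v : int * int) (b : seq int) : Prop :=
  if b is x :: b' then 0 < L v /\ positive_chain v (v *~ x - u) b' else 0 <= L v.

(** L v_(i-1) + L v_(i+1) = b_i L v_i, where the left hand side is positive. *)
Lemma positive_entries u v b : positive_chain u v b -> 0 < L u ->
  all (fun x : int => 1 <= x) b.
Proof.
elim: b u v => //= x b IHb u v [Lv_gt0 pb] Lu_gt0; rewrite (IHb _ _ pb Lv_gt0) andbT.
have : 0 <= L (v *~ x - u) by case: b pb {IHb} => //= y b [/ltW].
rewrite Lnext subr_ge0 => /(lt_le_trans Lu_gt0).
by rewrite pmulr_lgt0 // ltr0z.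
Qed.

Lemma positive_entries2 u v b : positive_chain u v b -> 0 <= L u -> (1 < size b)%N ->
  all (fun x : int => 1 <= x) b.
Proof.
case: b => // x [//|y b] [Lv pb] Lu _.
have yb := @positive_entries v (v *~ x - u) (y :: b) pb Lv.
have x1 : 1 <= x.
  case: pb; rewrite Lnext subr_gt0 => /(le_lt_trans Lu).
  by rewrite pmulr_lgt0 // ltr0z.
by apply/andP; split.
Qed.

(** With entries at least 2 the values of [L] are convex along the chain. *)
Lemma increasing_chain u v b : all (fun x : int => 2 <= x) b -> 0 <= L u -> L u < L v ->
  0 < L (chain_end u v b).
Proof.
elim: b u v => [|x b IHb] u v /=; first by move=> _; apply: le_lt_trans.
move=> /andP[x2 b2] Lu Luv; apply: IHb => //; first by rewrite ltW // (le_lt_trans Lu).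
rewrite Lnext ltrBrDr -{1}[L v]mul1r.
have Lv : 0 < L v by apply: le_lt_trans Luv.
apply: lt_le_trans (_ : 2%:~R * L v <= _).
  by rewrite (_ : 2%:~R = 1 + 1) // mulrDl !mul1r ltrD2l.
by rewrite ler_pM2r // ler_int.
Qed.

Lemma chain_end_cat u v s t : chain_end u v (s ++ t) =
  chain_end (foldl turn (u, v) s).1 (foldl turn (u, v) s).2 t.
Proof. by rewrite /chain_end foldl_cat -surjective_pairing. Qed.

(** Blowing down deletes a vector of the fan; the two ends stay. *)
Lemma blow_down_fan u v b b' : positive_chain u v b -> det2 u v = 1 -> blow_down b b' ->
  exists v', [/\ positive_chain u v' b', det2 u v' = 1 & chain_end u v' b' = chain_end u v b].
Proof.
move=> pb uv bb'; case: bb' pb => [s x y t|y t|s x].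
- move=> pb; exists v; split=> //.
    elim: s u v uv pb => [|z s IHs] u v uv /=; last first.
      by case=> Lv /(IHs _ _ (det2_turn z uv)).
    case=> Lv [Lv1 [Lv2 pt]]; split=> //.
    have e1 : v *~ (x - 1) - u = (v *~ x - u) *~ 1 - v.
      by rewrite !pairMz; congr (_, _) => /=; ring.
    rewrite e1; split=> //; move: pt; congr (positive_chain _ _ _).
    by rewrite !pairMz; congr (_, _) => /=; ring.
  rewrite !chain_end_cat; move: (foldl _ _ s) => [u' v'] /=.
  rewrite /chain_end /= /turn /=; congr ((foldl turn _ t).2).
  by rewrite !pairMz; congr (_, _); congr (_, _) => /=; ring.
- move=> /= [Lv [Lv1 pt]]; exists (v *~ 1 - u); split=> /=.
  + split=> //; move: pt; congr (positive_chain _ _ _).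
    by rewrite !pairMz; congr (_, _) => /=; ring.
  + by rewrite det2_next uv det2uu mul1r subr0.
  rewrite /chain_end /= /turn /=; congr ((foldl turn _ t).2).
  by rewrite !pairMz; congr (_, _); congr (_, _) => /=; ring.
move=> pb; exists v; split=> //.
  elim: s u v uv pb => [|z s IHs] u v uv /=; last first.
    by case=> Lv /(IHs _ _ (det2_turn z uv)).
  case=> Lv [Lv1 Lv2]; split=> //.
  move: Lv2; congr (is_true (0 <= L _)).
  by rewrite !pairMz; congr (_, _) => /=; ring.
rewrite !chain_end_cat; move: (foldl _ _ s) => [u' v'] /=.
by rewrite /chain_end /= !pairMz; congr (_, _) => /=; ring.
Qed.

Lemma blow_down_exists b : ~~ all (fun x : int => 2 <= x) b ->
    all (fun x : int => 1 <= x) b -> (1 < size b)%N ->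
  exists2 b', blow_down b b' & size b = (size b').+1.
Proof.
rewrite -has_predC => /hasP[z zb /= z2] /allP b1 sb.
have z1 : z = 1 by apply/eqP; rewrite eq_le b1 // andbT; lia.
subst z; case/splitPr: zb sb b1 => s t sb b1 {z2}.
case/lastP: s sb b1 => [|s x] sb b1.
  case: t sb b1 => // y t _ _; exists (y - 1 :: t); [exact: BlowFirst|by []].
rewrite cat_rcons; case: t sb b1 => [|y t] sb b1.
  by exists (s ++ [:: x - 1]); [exact: BlowLast|rewrite !size_cat addnS].
by exists (s ++ [:: x - 1, y - 1 & t]); [exact: BlowInner|rewrite !size_cat /= !addnS].
Qed.

(** As long as some entry is below 2, it is 1 and can be blown down, which
    shortens the chain; the argument stops at a chain with entries at least 2
    or at a single entry 1. *)
Lemma positive_chain_blows_down u v b : positive_chain u v b -> 0 < L u ->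
    det2 u v = 1 -> (0 < size b)%N ->
  exists t v', [/\ blows_down_to b t, (0 < size t)%N, t = [:: 1] \/ all (fun x : int => 2 <= x) t,
    det2 u v' = 1 & chain_end u v' t = chain_end u v b].
Proof.
elim: {b}(size b) {-2}b (erefl (size b)) v => [|n IHn] b sb v pb Lu uv; first by rewrite sb.
have b1 := positive_entries pb Lu.
have [b2|b2] := boolP (all (fun x : int => 2 <= x) b).
  by exists b, v; split=> //; [exact: BlowDone|right].
have [sb1|sb1] := leqP (size b) 1%N.
  case: b b1 b2 sb sb1 {pb} => [//|z [|//]] /=; rewrite !andbT => z1 z2 _ _ _.
  have -> : z = 1 by lia.
  by exists [:: 1], v; split=> //; [exact: BlowDone|left].
have [b' bb' sbb'] := blow_down_exists b2 b1 sb1.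
have [v' [pb' uv' ev']] := blow_down_fan pb uv bb'.
have sb' : size b' = n by move: sb; rewrite sbb' => -[].
have sb'0 : (0 < size b')%N by rewrite -ltnS -sbb'.
have [t [w [bt st tt uw ew]]] := IHn b' sb' v' pb' Lu uv' sb'0.
by exists t, w; split=> //; [apply: BlowStep bb' bt|rewrite ew].
Qed.

(** Both ends are on the line L = 0. The entries cannot all be at least 2,
    because then [L] would increase along the chain. For two entries the
    condition at the end reads x y = 1. *)
Lemma degenerate_chain_blows_down u v b : positive_chain u v b ->
    L u = 0 -> L (chain_end u v b) = 0 -> det2 u v = 1 -> (1 < size b)%N ->
  blows_down_to b [:: 1; 1].
Proof.
elim: {b}(size b) {-2}b (erefl (size b)) v => [|n IHn] b sb v pb Lu Le uv sb1.
  by rewrite sb in sb1.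
have b1 : all (fun x : int => 1 <= x) b by apply: positive_entries2 pb _ sb1; rewrite Lu.
have b2 : ~~ all (fun x : int => 2 <= x) b.
  have Lv : 0 < L v by move: pb sb1; case: (b) => //= x b' [].
  apply/negP => b2; have := increasing_chain b2 (_ : 0 <= L u) (_ : L u < L v).
  rewrite Le ltxx Lu lexx => H; suff: false by []; apply: H => //.
have [sb2|sb2] := leqP (size b) 2.
  case: b pb sb Le sb1 b1 b2 sb2 => [|x [|y [|]]] //= [Lv _] _ Le _ /and3P[x1 y1 _] _ _.
  suff xy : x * y = 1.
    have xe : x = 1 by nia.
    have ye : y = 1 by nia.
    by rewrite xe ye; apply: BlowDone.
  move: Le; rewrite /chain_end /= !Lnext Lu subr0 mulrA -{2}[L v]mul1r -mulrBl => /eqP.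
  rewrite mulf_eq0 (gt_eqF Lv) orbF -[1]/(1%:~R) -rmorphM -rmorphB intr_eq0 subr_eq0.
  by rewrite mulrC => /eqP.
have [b' bb' sbb'] := blow_down_exists b2 b1 sb1.
have [v' [pb' uv' ev']] := blow_down_fan pb uv bb'.
apply: BlowStep bb' _ => //; apply: (IHn b' _ v') => //; last by rewrite -ltnS -sbb'.
  by move: sb; rewrite sbb' => -[].
by rewrite ev'.
Qed.

(** Dropping the first entry replaces ([u], [v]) by ([v], x v - u), and
    det2 u l = x det2 v l - det2 (x v - u) l, which is the recursion of the
    continued fraction. *)
Lemma hj_fraction_fan u v t : det2 u v = 1 -> (0 < size t)%N ->
    all (fun x : int => 2 <= x) t ->
  let l := chain_end u v t in
  [/\ 0 < det2 v l, det2 v l < det2 u l, coprimez (det2 u l) (det2 v l) &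
      hj_fraction t = (det2 u l)%:~R / (det2 v l)%:~R].
Proof.
elim: t u v => // x t IHt u v uv _ /= /andP[x2 t2]; rewrite /chain_end /=.
have vv : det2 v (v *~ x - u) = 1 by apply: det2_turn.
case: t IHt t2 => [|y t] IHt t2 /=.
  by rewrite vv det2_next det2uu uv subr0 mulr1 /coprimez gcdzC gcd1z divr1; split=> //; lia.
have := IHt v (v *~ x - u) vv isT t2; rewrite -/(chain_end _ _ (y :: t)).
set l := chain_end _ _ _ => -[k0 km cop hj].
have lE : det2 (v *~ x - u) l = x * det2 v l - det2 u l.
  by rewrite det2C det2_next ![det2 l _]det2C; ring.
have mE : det2 u l = x * det2 v l - det2 (v *~ x - u) l by rewrite lE; ring.
have v0 : 0 < det2 v l by apply: lt_trans km.
split=> //; first by rewrite mE; nia.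
  by rewrite coprimez_sym mE /coprimez gcdzMDl gcdzN.
transitivity (x%:Q - (hj_fraction (y :: t))^-1) => //.
have m0 : (det2 v l)%:~R != 0 :> rat by rewrite intr_eq0 gt_eqF.
have key : (det2 u l)%:~R = x%:~R * (det2 v l)%:~R - (det2 (v *~ x - u) l)%:~R :> rat.
  by rewrite -rmorphM -rmorphB -mE.
by rewrite hj invf_div key mulrBl mulfK.
Qed.
End Chains.

(** * Singularities of toric surfaces at the fixed point *)

Section Points.
Context (K : fieldType) (G : zmodType) (P : addrClosed G).
Context (A : comAlgType K) (mon : G -> A).
Hypothesis hA : monoid_algebra P mon.

Lemma point_of_monomials (F : G -> K) : F 0 = 1 ->
    (forall u v, u \in P -> v \in P -> F (u + v) = F u * F v) ->
  exists x : A -> K, [/\ scalar x, monoid_morphism x &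
    forall u, u \in P -> x (mon u) = F u].
Proof.
move=> F0 FM; have [L [LL LE]] := mon_ext hA (V := K^o) F.
have [x xE] : exists x : {rmorphism A -> K}, forall f, x f = L f.
  apply: (morphism_on_monomials hA (B := K^o) (q := idfun) (L := L)) => //=.
    by rewrite LE ?rpred0.
  by move=> u v Pu Pv; rewrite !LE ?rpredD // FM.
exists x; split=> [c f g||u Pu]; last by rewrite xE LE.
  by rewrite !xE LL.
by split=> [|f g]; rewrite ?rmorph1 ?rmorphM.
Qed.

Lemma eq_points (E : set A) (x y : A -> K) : scheme_point E x -> scheme_point E y ->
  (forall u, u \in P -> x (mon u) = y (mon u)) -> x = y.
Proof.
move=> [xs _ _] [ys _ _] xy; apply: funext.
exact: (eq_on_monomials hA (s := *%R)).
Qed.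
End Points.

Lemma cqs_pointX (K : fieldType) (m c : nat) v : v \in cqs_monoid m c ->
  @cqs_point K m c (monomial K (cqs_monoid m c) v) = (v == 0)%:R.
Proof.
by move=> Pv; rewrite /cqs_point monomial_mcoeff // eq_sym.
Qed.

(** The function that is 1 on the exponent 0 and 0 elsewhere is multiplicative,
    because 0 is the only invertible exponent. *)
Lemma cqs_pointP (K : fieldType) (m c : nat) :
  scheme_point set0 (@cqs_point K m c).
Proof.
pose P : addrClosed (int * int)%type := cqs_monoid m c.
have hA := monomial_algebra K P.
have pointed u v : u \in P -> v \in P -> (u + v == 0) = (u == 0) && (v == 0).
  case: u v => [a b] [a' b'] /and3P[/= a0 b0 _] /and3P[/= a0' b0' _].
  apply/eqP/andP => [[e1 e2]|[/eqP-> /eqP->]]; last by rewrite addr0.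
  by split; apply/eqP; congr (_, _); lia.
have FM u v : u \in P -> v \in P ->
    (u + v == 0)%:R = (u == 0)%:R * (v == 0)%:R :> K.
  by move=> Pu Pv; rewrite pointed // -natrM mulnb.
have F0 : ((0 : int * int) == 0)%:R = 1 :> K by rewrite eqxx.
have [x [xs xm xE]] := point_of_monomials hA (F := fun v => (v == 0)%:R) F0 FM.
suff <- : x = @cqs_point K m c by split.
apply: funext; apply: (eq_on_monomials hA (s := *%R)) => // [k f g|u Pu].
  by rewrite /cqs_point mcoeffD mcoeffZ.
by rewrite xE // cqs_pointX.
Qed.

Section ChainSingularity.
Context (K : fieldType) (R : realDomainType) (L : int * int -> R).
Hypothesis LB : zmod_morphism L.
Context (P : addrClosed (int * int)%type) (B : comAlgType K) (mon : int * int -> B).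
Hypothesis hB : monoid_algebra P mon.
Context (y : B -> K) (hy : scheme_point set0 y).
Hypothesis yE : forall v, v \in P -> y (mon v) = (v == 0)%:R.
Context (u v : int * int) (b : seq int).
Hypotheses (pb : positive_chain L u v b) (Lu : 0 < L u) (uv : det2 u v = 1).
Hypothesis b_neq0 : (0 < size b)%N.
Hypothesis memP : forall w,
  (w \in P) = (0 <= det2 u w) && (0 <= det2 w (chain_end u v b)).

(** Blow down the chain, keeping the cone. If the result is (1), the edges of
    the cone form a basis. Otherwise let [l] be the last vector, m = det2 u l
    and c = m - det2 v' l; then w |-> (det2 w l, det2 u w) identifies the
    exponents of the cone with those of the cyclic quotient (m, c), because the
    image of the lattice is given by a + c b = 0 modulo m. *)
Theorem chain_singularity_at_vertex (A : comAlgType K) (E : set A) (x : A -> K) :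
  jet_equiv E x set0 y -> chain_singularity b E x.
Proof.
move=> xy; have [t [v' [bt st tt uv' et]]] := positive_chain_blows_down LB pb Lu uv b_neq0.
exists t => //; move: memP; rewrite -et; set l := chain_end u v' t => memP'.
have basis w : w = u *~ det2 w v' + v' *~ det2 u w.
  rewrite !pairMz; case: w => a c; congr (_, _) => /=.
    by rewrite -[LHS]mulr1 -uv' /det2 /=; ring.
  by rewrite -[LHS]mulr1 -uv' /det2 /=; ring.
have detB w w1 w2 : det2 w (w1 - w2) = det2 w w1 - det2 w w2 by rewrite /det2 /=; ring.
have detBl w w1 w2 : det2 (w1 - w2) w = det2 w1 w - det2 w2 w by rewrite /det2 /=; ring.
case: tt => [t1|t2].
  left; split; first by left.
  apply: jet_equiv_smooth xy _.
  have lE : l = v' - u by rewrite /l t1 /chain_end /= mulr1z.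
  have ul : det2 u l = 1 by rewrite lE detB det2uu subr0.
  have Pu : u \in P by rewrite memP' det2uu ul lexx.
  have Pl : l \in P by rewrite memP' det2uu ul lexx.
  apply: (smooth_toric hB hy (c1 := fun w => det2 w l) (c2 := det2 u) Pu Pl) => //.
  - by rewrite det2uu.
  - by rewrite det2uu.
  - move=> w _; rewrite !pairMz; case: (w) => a c; congr (_, _) => /=.
      by rewrite -[LHS]mulr1 -ul /det2 /=; ring.
    by rewrite -[LHS]mulr1 -ul /det2 /=; ring.
  - by move=> w; rewrite memP' => /andP[].
  - by move=> w; rewrite memP' => /andP[_]; left.
right; have [k_gt0 km cop hj] := hj_fraction_fan uv' st t2; rewrite -/l in k_gt0 km cop hj.
have m_gt0 := lt_trans k_gt0 km.
pose m := absz (det2 u l); pose c := absz (det2 u l - det2 v' l).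
have mE : m%:Z = det2 u l by rewrite gtz0_abs.
have cE : c%:Z = det2 u l - det2 v' l by rewrite gtz0_abs // subr_gt0.
exists m, c; split.
- rewrite -[coprime m c]/(coprimez m c) mE cE /coprimez.
  by rewrite addrC -{2}[det2 u l]mul1r addrC gcdzMDl gcdzN.
- by rewrite -!ltz_nat mE cE subr_gt0 km ltrBlDr ltrDl.
- split=> //; rewrite hj -[m%:R]/(m%:Z%:~R) -[c%:R]/(c%:Z%:~R) mE cE -rmorphB.
  by rewrite opprB addrC subrK.
apply: jet_equiv_same; apply: jet_equiv_trans xy _; apply: jet_equiv_sym.
have m_neq0 : det2 u l != 0 by rewrite gt_eqF.
have lattice w : det2 w l + c%:Z * det2 u w = (det2 w v' + det2 u w) * det2 u l.
  by rewrite {1}(basis w) !pairMz cE /det2 /=; ring.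
have detw w : det2 w l = det2 w v' * det2 u l + det2 u w * det2 v' l.
  by rewrite {1}(basis w) !pairMz /det2 /=; ring.
pose g w := (det2 w l, det2 u w).
pose f (w : int * int) := u *~ ((w.1 - w.2 * det2 v' l) %/ det2 u l)%Z + v' *~ w.2.
have fgE w : w \in cqs_monoid m c -> g (f w) = w.
  case: w => a b' /and3P[_ _ /=]; rewrite mE cE => dv.
  have /divzK zE : (det2 u l %| a - b' * det2 v' l)%Z.
    have -> : a - b' * det2 v' l = a + (det2 u l - det2 v' l) * b' - b' * det2 u l by ring.
    by rewrite rpredB // dvdz_mull.
  move: zE; rewrite /g /f /=; set z := (_ %/ _)%Z => zE; rewrite !pairMz; congr (_, _).
    have -> : det2 ((u.1 * z, u.2 * z) + (v'.1 * b', v'.2 * b')) l = z * det2 u l + b' * det2 v' l.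
      by rewrite /det2 /=; ring.
    by rewrite zE subrK.
  have -> : det2 u ((u.1 * z, u.2 * z) + (v'.1 * b', v'.2 * b')) = b' * det2 u v'.
    by rewrite /det2 /=; ring.
  by rewrite uv' mulr1.
have gfE w : f (g w) = w by rewrite /f /g /= detw addrK mulzK // -basis.
apply: (jet_equiv_of_monoid_iso (f := f) (g := g) (monomial_algebra K (cqs_monoid m c)) hB) => //.
- by move=> w1 w2; rewrite /g detB detBl.
- move=> w Pw; rewrite memP' -[det2 _ l]/((g (f w)).1) -[det2 u _]/((g (f w)).2) fgE //.
  by case/and3P: Pw => -> ->.
- move=> w; rewrite memP' => /andP[wl uw]; apply/and3P; split=> //=.
  by rewrite lattice mE dvdz_mull.
- exact: cqs_pointP.
move=> w Pw; rewrite yE // cqs_pointX; last first.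
  move: Pw; rewrite memP' => /andP[wl uw]; apply/and3P; split=> //=.
  by rewrite lattice mE dvdz_mull.
congr (nat_of_bool _)%:R; apply/eqP/eqP => [->|gw0].
  by rewrite /g /det2 /= !mulr0 !mul0r subrr.
by rewrite -[w]gfE gw0 /f /= mul0r subr0 div0z !mulr0z.
Qed.
End ChainSingularity.

(** * The fibres of the deformation *)

Section Fibre.
Context (R : realType) (D : decomposition R) (lambda : R[i]).
Hypotheses (lambda_neq0 : lambda != 0) (p_gt0 : (0 < mult D)%N).

Local Notation p := (mult D).
Local Notation K := (R[i]).
Local Notation b0 := (beta0 D).
Local Notation g0 := (gamma0 D).
Local Notation b1 := (beta1 D / p%:R).
Local Notation g1 := (gamma1 D / p%:R).
Local Notation S beta gamma := (slab beta gamma : addrClosed (int * int)%type).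

Let hA : monoid_algebra (total_monoid D) (tmonomial D) :=
  monomial_algebra R[i] (total_monoid D).

Lemma total_monoidE u : (u \in total_monoid D) =
  [&& 0 <= height b0 (u.1.1, u.1.2), 0 <= height g0 (u.1.1, u.1.2),
      0 <= height b1 (u.1.1, u.2) & 0 <= height g1 (u.1.1, u.2)].
Proof.
rewrite unfold_in /total_monoid /= /pairing' /height /= !andbT.
by rewrite !mul1r !mul0r !addr0.
Qed.

(** the least [r] with (s, r) in the dual cone of the segment *)
Let least (beta gamma : R) (s : int) : int :=
  Num.ceil (Num.max (- (beta * s%:~R)) (- (gamma * s%:~R))).

Let leastP beta gamma s r :
  (least beta gamma s <= r) = (0 <= height beta (s, r)) && (0 <= height gamma (s, r)).
Proof.
have shift t : (- t <= r%:~R :> R) = (0 <= t + r%:~R).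
  by rewrite -subr_ge0 opprK addrC.
by rewrite /least ceil_le_int ge_max !shift.
Qed.

Let least0 beta gamma : least beta gamma 0 = 0.
Proof. by rewrite /least !mulr0 oppr0 maxxx ceil0. Qed.

Let memP u : (u \in total_monoid D) =
  (least b0 g0 u.1.1 <= u.1.2) && (least b1 g1 u.1.1 <= u.2).
Proof. by rewrite total_monoidE !leastP -!andbA. Qed.

(** The fixed points of the action that defines the grading by the first
    coordinate. *)
Definition over_vertex (x : total_ring D -> R[i]) : Prop :=
  forall u, u \in total_monoid D -> u.1.1 != 0 -> x (tmonomial D u) = 0.

(** Near [x] the fibre looks like the toric surface of the cone over
    (beta, gamma) near a point of z = 0, and that point is fixed by the torus
    when and only when [x] is. *)
Definition modelled_on (beta gamma : R) (x : total_ring D -> R[i]) : Prop :=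
  exists y : sgalg R[i] (submonoid (S beta gamma)) -> R[i],
    [/\ scheme_point set0 y, jet_equiv (fibre D lambda) x set0 y,
        y (monomial R[i] (S beta gamma) (0, 1)) = 0,
        ~ over_vertex x -> exists v, [/\ v \in S beta gamma, v.1 != 0 &
          y (monomial R[i] (S beta gamma) v) != 0] &
        over_vertex x -> forall v, v \in S beta gamma -> v.1 != 0 ->
          y (monomial R[i] (S beta gamma) v) = 0].

Let local_slab (beta gamma : R) (rho : R[i]) (e0 e1 : nat) (U V : {poly R[i]}) x :
    (forall v, (v \in S beta gamma) =
       (e0%:Z * least b0 g0 v.1 + e1%:Z * least b1 g1 v.1 <= v.2)) ->
    'X + rho%:P = 'X^e0 * U -> ('X + rho%:P) ^+ p + lambda%:P = 'X^e1 * V ->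
    U.[0] != 0 -> V.[0] != 0 ->
    scheme_point (fibre D lambda) x -> x (tmonomial D (0, 1, 0)) = rho ->
  modelled_on beta gamma x.
Proof.
move=> memS UE VE U0 V0 hx xy0.
have hB := monomial_algebra R[i] (S beta gamma).
have [y [hy jy yz yN y0]] :=
  local_model hA hB memP memS (least0 _ _) (least0 _ _) UE VE U0 V0 hx xy0.
exists y; split=> // nx.
have [u [Pu u0 xu]] : exists u, [/\ u \in total_monoid D, u.1.1 != 0 & x (tmonomial D u) != 0].
  apply: contrapT => nex; apply: nx => u Pu u0; apply/eqP/negPn/negP => xu.
  by apply: nex; exists u.
exists (u.1.1, e0%:Z * u.1.2 + e1%:Z * u.2); split=> //; last exact: yN.
rewrite memS /=; move: Pu; rewrite memP => /andP[le0 le1].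
by apply: lerD; apply: ler_wpM2l.
Qed.

(** Here y0 is the local coordinate and y0^p + lambda a unit. *)
Lemma modelled_over_0 x : scheme_point (fibre D lambda) x ->
  x (tmonomial D (0, 1, 0)) = 0 -> modelled_on b0 g0 x.
Proof.
move=> hx xy0.
apply: (local_slab (rho := 0) (e0 := 1) (e1 := 0) (U := 1) (V := 'X^p + lambda%:P)) => //.
- by case=> s r; rewrite -[_ \in _]/((_ <= _) && _) -leastP mul1r mul0r addr0.
- by rewrite polyC0 addr0 expr1 mulr1.
- by rewrite polyC0 addr0 expr0 mul1r.
- by rewrite hornerC oner_neq0.
by rewrite !hornerE expr0n eqn0Ngt p_gt0 add0r.
Qed.

(** Here y0 is a unit; the root [rho] of 'X^p + lambda is simple, so
    y0^p + lambda is the local coordinate up to a unit. *)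
Lemma modelled_over_root x : scheme_point (fibre D lambda) x ->
  x (tmonomial D (0, 1, 0)) ^+ p = - lambda -> modelled_on b1 g1 x.
Proof.
move=> hx; set rho := x _ => rhop.
pose f : {poly R[i]} := ('X + rho%:P) ^+ p + lambda%:P.
have [V VE] : exists V, f = 'X * V.
  by apply: dvd_polyX; rewrite /f !hornerE rhop addNr.
have rho_neq0 : rho != 0.
  apply: contraNneq lambda_neq0 => rho0; move: rhop.
  by rewrite rho0 expr0n eqn0Ngt p_gt0 => /esym/eqP; rewrite oppr_eq0.
apply: (local_slab (rho := rho) (e0 := 0) (e1 := 1) (U := 'X + rho%:P) (V := V)) => //.
- by case=> s r; rewrite -[_ \in _]/((_ <= _) && _) -leastP mul1r mul0r add0r.
- by rewrite expr0 mul1r.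
- by rewrite !hornerE.
have : f^`().[0] = V.[0] by rewrite VE derivM derivX mul1r !hornerE.
rewrite /f derivD derivC addr0 deriv_exp derivD derivX derivC addr0 mul1r.
rewrite hornerMn horner_exp !hornerE => <-.
by rewrite mulrn_eq0 negb_or -lt0n p_gt0 expf_neq0.
Qed.

Lemma modelled_elsewhere x : scheme_point (fibre D lambda) x ->
  x (tmonomial D (0, 1, 0)) != 0 -> x (tmonomial D (0, 1, 0)) ^+ p != - lambda ->
  modelled_on 0 0 x.
Proof.
move=> hx; set rho := x _ => rho0 rhop.
apply: (local_slab (rho := rho) (e0 := 0) (e1 := 0) (U := 'X + rho%:P)
  (V := ('X + rho%:P) ^+ p + lambda%:P)) => //.
- case=> s r; rewrite -[_ \in _]/((_ <= _) && _) -leastP.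
  by rewrite /least !mul0r oppr0 maxxx ceil0.
- by rewrite expr0 mul1r.
- by rewrite expr0 mul1r.
- by rewrite !hornerE.
by rewrite !hornerE -[lambda]opprK subr_eq0.
Qed.

Lemma modelled_smooth beta gamma x : modelled_on beta gamma x -> ~ over_vertex x ->
  smooth_at (fibre D lambda) x.
Proof.
move=> [y [hy jy yz yN _]] nx; have [v [Sv v0 yv]] := yN nx.
apply: jet_equiv_smooth jy _.
exact: (smooth_slab (beta := beta) (gamma := gamma) _ (monomial_algebra _ _) hy yz Sv v0 yv).
Qed.

(** When the segment is a point, the cone is a ray; the monomials on the
    boundary of the dual half-plane are then invertible. *)
Lemma modelled_ray_smooth beta x u : modelled_on beta beta x -> u.1 != 0 ->
  height beta u = 0 -> smooth_at (fibre D lambda) x.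
Proof.
move=> [y [hy jy yz _ _]] u0 hu; apply: jet_equiv_smooth jy _.
have hB := monomial_algebra R[i] (S beta beta).
have hNu : height beta (- u) = 0.
  have := heightD beta u (- u); rewrite subrr hu add0r => <-.
  by rewrite /height !mulr0 addr0.
have Su : u \in S beta beta by rewrite -[_ \in _]/(_ && _) hu lexx.
have SNu : - u \in S beta beta by rewrite -[_ \in _]/(_ && _) hNu lexx.
apply: (smooth_slab (u := u) (beta := beta) (gamma := beta) _ hB hy yz Su u0) => //.
have [y' yE] := point_morphism hy.
apply: contraTneq (oner_neq0 R[i]) => y0; rewrite negbK.
have := monD hB Su SNu; rewrite subrr (mon0 hB) => /(congr1 y').
by rewrite rmorph1 rmorphM /= yE y0 mul0r => ->.
Qed.

(** The point kills the monomials of nonzero degree. To respect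
    products, it must kill the product of two monomials of degrees s and - s
    for s distinct from 0: as the segment over [rho] is not a point, that
    product is divisible by the function, y0 or y1, that vanishes at [rho]. *)
Lemma fibre_vertex rho :
    (rho = 0 /\ b0 < g0) \/ (rho ^+ p = - lambda /\ b1 < g1) ->
  exists x, [/\ scheme_point (fibre D lambda) x, x (tmonomial D (0, 1, 0)) = rho &
    over_vertex x].
Proof.
move=> hrho; set rho1 := rho ^+ p + lambda.
pose F (u : int * int * int) : R[i] :=
  if u.1.1 == 0 then rho ^+ absz u.1.2 * rho1 ^+ absz u.2 else 0.
have gap (beta gamma : R) (s r r' : int) : beta < gamma -> s != 0 ->
    0 <= height beta (s, r) -> 0 <= height gamma (s, r) ->
    0 <= height beta (- s, r') -> 0 <= height gamma (- s, r') -> 0 < r + r'.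
  rewrite /height /= rmorphN /= !mulrN => bg s0 h1 h2 h3 h4; rewrite -(ltr0z R) rmorphD /=.
  case: (ltgtP s 0) s0 => // [s_lt|s_gt] _.
    have h5 : 0 < (beta - gamma) * s%:~R.
      by rewrite nmulr_rgt0 ?subr_lt0 // ltrz0.
    move: h5 h1 h2 h3 h4; rewrite mulrBl; lra.
  have h5 : 0 < (gamma - beta) * s%:~R by rewrite pmulr_rgt0 ?subr_gt0 // ltr0z.
  move: h5 h1 h2 h3 h4; rewrite mulrBl; lra.
have F0 : F 0 = 1 by rewrite /F /= !expr0 mulr1.
have FM u v : u \in total_monoid D -> v \in total_monoid D -> F (u + v) = F u * F v.
  case: u v => [[s r0] r1] [[s' r0'] r1'] Pu Pv; rewrite /F /=.
  move: (Pu) (Pv); rewrite !total_monoidE /= => /and4P[u1 u2 u3 u4] /and4P[v1 v2 v3 v4].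
  have [s0|s0] := eqVneq s 0.
    have [s0'|s0'] := eqVneq s' 0; last by rewrite s0 add0r (negPf s0') mulr0.
    subst s s'; rewrite addr0 eqxx.
    move: u1 u3 v1 v3; rewrite /height /= !mulr0 !add0r !ler0z => u1 u3 v1 v3.
    have absD (a b : int) : 0 <= a -> 0 <= b -> absz (a + b) = (absz a + absz b)%N.
      by move=> a0 b0; apply/eqP; rewrite -eqz_nat PoszD !gez0_abs ?addr_ge0.
    by rewrite !absD // !exprD mulrACA.
  rewrite mul0r; case: eqP => // ss'.
  have s'E : s' = - s by apply/eqP; rewrite -addr_eq0 addrC ss'.
  subst s'.
  case: hrho => [[rho0 lt_bg]|[rhop lt_bg]].
    have := gap _ _ _ _ _ lt_bg s0 u1 u2 v1 v2; rewrite rho0 expr0n absz_eq0 => gt0.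
    by rewrite gt_eqF // mul0r.
  have := gap _ _ _ _ _ lt_bg s0 u3 u4 v3 v4 => gt0.
  by rewrite /rho1 rhop addNr [0 ^+ _]expr0n absz_eq0 gt_eqF // mulr0.
have [x [xs xm xE]] := point_of_monomials hA F0 FM.
have P0 (a b : int) : 0 <= a -> 0 <= b -> (0, a, b) \in total_monoid D.
  by move=> a0 b0; rewrite total_monoidE /height /= !mulr0 !add0r !ler0z a0 b0.
have xy0 : x (tmonomial D (0, 1, 0)) = rho by rewrite xE ?P0 // /F /= expr1 expr0 mulr1.
exists x; split=> //; last first.
  by move=> u Pu u0; rewrite xE // /F (negPf u0).
have hx0 : scheme_point set0 x by split.
split=> // f ->; have [x' x'E] := point_morphism hx0.
rewrite -x'E !rmorphB /= x'E (pointA hx0).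
rewrite [x (tmonomial D (0, 0, 1))]xE ?P0 // [x (tmonomial D (0, _, 0))]xE ?P0 //.
by rewrite /F /= !expr0 expr1 /rho1; ring.
Qed.
End Fibre.

(** * Fans given by sequences of vectors *)

Lemma chain_of_vectors (R : realDomainType) (L : int * int -> R) (z : nat -> int * int)
    (b : seq int) :
    (forall i, (i < size b)%N -> z i + z i.+2 = z i.+1 *~ nth 0 b i) ->
    (forall i, (1 <= i <= size b)%N -> 0 < L (z i)) -> 0 <= L (z (size b).+1) ->
  positive_chain L (z 0%N) (z 1%N) b /\ chain_end (z 0%N) (z 1%N) b = z (size b).+1.
Proof.
elim: b z => [|x b IHb] z zrec zpos zend; first by [].
have nextE : z 1%N *~ x - z 0%N = z 2%N by rewrite -(zrec 0%N) // addrC addKr.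
have zpos' i : (1 <= i <= size b)%N -> 0 < L (z i.+1).
  by move=> /andP[_ ib]; apply: zpos.
have [pb ce] := IHb (fun i => z i.+1) (fun i ib => zrec i.+1 ib) zpos' zend.
rewrite /= nextE; split; first by split=> //; apply: zpos.
by rewrite /chain_end /= /turn /= nextE.
Qed.

(** A sequence of vectors whose ends are orthogonal to the rays over [gamma]
    and over [beta], so that they span the dual of the cone over the segment.
    The half-plane that contains the sequence is given by the sum of the
    heights over the two end points of the segment. *)
Section FanSingularity.
Context (R : realType) (beta gamma : R) (z : nat -> int * int) (b : seq int).
Hypothesis zrec : forall i, (i < size b)%N -> z i + z i.+2 = z i.+1 *~ nth 0 b i.
Hypothesis zdet : det2 (z 0%N) (z 1%N) = 1.
Hypotheses (z0 : height gamma (z 0%N) = 0) (zl : height beta (z (size b).+1) = 0).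
Hypothesis zpos : forall i, (1 <= i <= size b)%N ->
  0 < height beta (z i) + height gamma (z i).
Hypotheses (z0_left : (z 0%N).1 < 0) (zl_right : 0 < (z (size b).+1).1).

Let L (v : int * int) : R := height beta v + height gamma v.

Let LB : zmod_morphism L.
Proof. by move=> u v; rewrite /L /height /= !rmorphB /=; ring. Qed.

Lemma fan_blows_down : beta = gamma -> (1 < size b)%N -> blows_down_to b [:: 1; 1].
Proof.
move=> bg sb; have Lz : L (z (size b).+1) = 0 by rewrite /L -bg zl addr0.
have [|pb ce] := chain_of_vectors (L := L) zrec zpos; first by rewrite Lz.
apply: (degenerate_chain_blows_down LB pb) => //; last by rewrite ce.
by rewrite /L bg z0 addr0.
Qed.

Lemma fan_singularity (D : decomposition R) (lambda : R[i]) x :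
    beta < gamma -> (0 < size b)%N ->
    modelled_on lambda beta gamma x -> over_vertex x ->
  chain_singularity b (fibre D lambda) x.
Proof.
move=> bg sb [y [hy jy yz _ yv]] vx.
have heightDiff v : height gamma v = height beta v + (gamma - beta) * v.1%:~R.
  by rewrite /height; ring.
have Lz0 : 0 < L (z 0%N).
  have := heightDiff (z 0%N); rewrite z0 => /eqP; rewrite eq_sym addr_eq0 => /eqP hb.
  rewrite /L z0 addr0 hb -mulrN pmulr_rgt0 ?subr_gt0 //.
  by rewrite oppr_gt0 ltrz0.
have Lzl : 0 <= L (z (size b).+1).
  by rewrite /L heightDiff zl add0r add0r mulr_ge0 ?subr_ge0 ?ltW // ltr0z.
have [pb ce] := chain_of_vectors (L := L) zrec zpos Lzl.
have hB := monomial_algebra R[i] (slab beta gamma).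
have memS v : (v \in slab beta gamma) = (0 <= height beta v) && (0 <= height gamma v).
  by [].
have yE := slab_vertex memS hB hy yz (yv vx).
apply: (chain_singularity_at_vertex LB hB hy yE pb Lz0 zdet sb) jy.
move=> v; rewrite ce memS andbC; congr (_ && _).
  have -> : det2 (z 0%N) v = v.1 * (z 0%N).2 - (z 0%N).1 * v.2 by [].
  have z0E : (z 0%N).2%:~R = - (gamma * (z 0%N).1%:~R).
    by apply/eqP; rewrite -addr_eq0 addrC; apply/eqP.
  rewrite -(ler0z R) rmorphB !rmorphM /= z0E.
  have -> : v.1%:~R * - (gamma * (z 0%N).1%:~R) - (z 0%N).1%:~R * v.2%:~R =
     - (z 0%N).1%:~R * height gamma v by rewrite /height; ring.
  by rewrite pmulr_rge0 // oppr_gt0 ltrz0.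
set l := z _.
have lE : l.2%:~R = - (beta * l.1%:~R).
  by apply/eqP; rewrite -addr_eq0 addrC; apply/eqP.
rewrite -(ler0z R) /det2 rmorphB !rmorphM /= lE.
have -> : l.1%:~R * v.2%:~R - v.1%:~R * - (beta * l.1%:~R) =
    l.1%:~R * height beta v by rewrite /height; ring.
by rewrite pmulr_rge0 // ltr0z.
Qed.
End FanSingularity.

(** For d = 1 the vectors (1, 0) and (-1, 1) form a basis. *)
Lemma type_A_at_vertex (R : realType) (D : decomposition R) (lambda : R[i]) (d : nat) x :
    (0 < d)%N -> modelled_on lambda 0 d%:R x -> over_vertex x ->
  A_singularity d (fibre D lambda) x.
Proof.
move=> d_gt0 [y [hy jy yz _ yv]] vx.
pose P : addrClosed (int * int)%type := slab (0 : R) d%:R.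
have hB : monoid_algebra P (monomial R[i] P) := monomial_algebra R[i] P.
have memS v : (v \in P) = (0 <= height (0 : R) v) && (0 <= height (d%:R : R) v).
  by [].
rewrite /A_singularity; case: eqP => [d1|_].
  subst d; apply: jet_equiv_smooth jy _.
  have memE v : (v \in P) = (0 <= v.2) && (0 <= v.1 + v.2).
    by rewrite memS /height mul0r add0r mul1r -rmorphD /= !ler0z.
  have P1 : ((1, 0) : int * int) \in P by rewrite memE.
  have P2 : ((-1, 1) : int * int) \in P by rewrite memE.
  apply: (smooth_toric hB hy (c1 := fun v => v.1 + v.2) (c2 := fun v => v.2) P1 P2) => //.
  - by move=> u v /=; ring.
  - by case=> r s _; rewrite !pairMz; congr (_, _) => /=; ring.
  - by move=> v; rewrite memE => /andP[].
  - by move=> v; rewrite memE => /andP[_]; left.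
apply: jet_equiv_same; apply: jet_equiv_trans jy _.
have yE := slab_vertex memS hB hy yz (yv vx).
exact: (jet_equiv_type_A d_gt0 memS hB hy yE).
Qed.

(** the effect on exponents of the translation t |-> t + k of the slice *)
Definition shear (k : int) (v : int * int) : int * int := (v.1, v.2 + k * v.1).

Lemma shearD k u v : shear k (u + v) = shear k u + shear k v.
Proof. by apply: injective_projections => /=; ring. Qed.

Lemma shearMz k u m : shear k (u *~ m) = shear k u *~ m.
Proof. by rewrite !pairMz; apply: injective_projections => /=; ring. Qed.

Lemma det2_shear k u v : det2 (shear k u) (shear k v) = det2 u v.
Proof. by rewrite /det2 /=; ring. Qed.

Lemma height_shear (R : archiRealFieldType) (t : R) k v :
  height t (shear k v) = height (t + k%:~R) v.
Proof. by rewrite /height /= rmorphD rmorphM /=; ring. Qed.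

Lemma height_le (R : archiRealFieldType) (s t : R) (v : int * int) :
  s <= t -> 0 <= v.1 -> height s v <= height t v.
Proof. by move=> st v0; rewrite lerD2r ler_wpM2r // ler0z. Qed.

Lemma height_ge (R : archiRealFieldType) (s t : R) (v : int * int) :
  s <= t -> v.1 <= 0 -> height t v <= height s v.
Proof. by move=> st v0; rewrite lerD2r ler_wnM2r // lerz0. Qed.

(** The polynomial 'X^p - c is prime to its derivative. *)
Lemma roots_of_number (K : numClosedFieldType) (p : nat) (c : K) : (0 < p)%N -> c != 0 ->
  exists rt : 'I_p -> K, [/\ injective rt, forall i, rt i ^+ p = c &
    forall t, t ^+ p = c -> exists i, t = rt i].
Proof.
move=> p_gt0 c0; pose f : {poly K} := 'X^p - c%:P.
have sf : size f = p.+1 by rewrite size_XnsubC.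
have lf : lead_coef f = 1 by apply/monicP; apply: monicXnsubC.
have [rs fE] := closed_field_poly_normal f; rewrite lf scale1r in fE.
have rootE t : (t ^+ p == c) = (t \in rs).
  by rewrite -root_prod_XsubC -fE /root !hornerE subr_eq0.
have srs : size rs = p by apply: succn_inj; rewrite -sf fE size_prod_XsubC.
have urs : uniq rs.
  rewrite -separable_prod_XsubC -fE unlock.
  apply/Bezout_coprimepP; exists ((- p%:R)%:P, 'X) => /=.
  suff -> : (- p%:R)%:P * f + 'X * f^`() = (p%:R * c)%:P.
    by rewrite polyC_eqp1 mulf_neq0 // pnatr_eq0 -lt0n.
  rewrite /f derivB derivC subr0 derivXn mulrnAr -exprS prednK //.
  by rewrite polyCN polyCM -[p%:R%:P]/(polyC _) rmorph_nat -mulr_natl; ring.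
exists (fun i => nth 0 rs i); split.
- by move=> i j /eqP; rewrite nth_uniq ?srs // => /eqP/val_inj.
- by move=> i; apply/eqP; rewrite rootE mem_nth // srs.
move=> t /eqP; rewrite rootE => trs.
have it : (index t rs < p)%N by rewrite -srs index_mem.
by exists (Ordinal it); rewrite /= nth_index.
Qed.

(** * The singular points of a fibre *)

Section FibrePoints.
Context (R : realType) (D : decomposition R) (lambda : R[i]).
Hypotheses (lambda_neq0 : lambda != 0) (p_gt0 : (0 < mult D)%N).
Local Notation p := (mult D).
Hypothesis gap1 : beta1 D / p%:R < gamma1 D / p%:R.
Local Notation y0 := (tmonomial D (0, 1, 0)).

Let hA : monoid_algebra (total_monoid D) (tmonomial D) :=
  monomial_algebra R[i] (total_monoid D).

Let P0 (a b : int) : 0 <= a -> 0 <= b -> (0, a, b) \in total_monoid D.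
Proof. by move=> a0 b0; rewrite total_monoidE /height /= !mulr0 !add0r !ler0z a0 b0. Qed.

(** The monomials of degree 0 are products of y0 and y1 = y0^p + lambda. *)
Lemma vertex_unique x x' : scheme_point (fibre D lambda) x ->
    scheme_point (fibre D lambda) x' -> over_vertex x -> over_vertex x' ->
  x y0 = x' y0 -> x = x'.
Proof.
move=> hx hx' vx vx' xx'; apply: (eq_points hA hx hx') => u Pu.
have [u0|u0] := eqVneq u.1.1 0; last by rewrite [LHS]vx // [RHS]vx'.
have y1E z : scheme_point (fibre D lambda) z -> z (tmonomial D (0, 0, 1)) = z y0 ^+ p + lambda.
  move=> hz; have [z' zE] := point_morphism hz.
  have [_ _ /(_ _ erefl)] := hz; rewrite -zE !rmorphB /= zE (pointA hz) => /eqP.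
  rewrite -addrA -opprD subr_eq0 => /eqP ->; congr (_ + _).
  have -> : (0, p%:Z, 0) = ((0, 1, 0) : int * int * int) *+ p.
    by rewrite tripleMn !mul0r mul1r.
  by rewrite (monMn hA) ?P0 // -zE rmorphXn.
case: u Pu u0 => [[s r0] r1] Pu /= s0; subst s.
move: (Pu); rewrite total_monoidE /height /= !mulr0 !add0r !ler0z => /and4P[r0_ge0 _ r1_ge0 _].
have uE : (0, r0, r1) = ((0, 1, 0) : int * int * int) *+ absz r0
    + ((0, 0, 1) : int * int * int) *+ absz r1.
  by rewrite !tripleMn !gez0_abs // !mul0r !mul1r; congr (_, _, _); rewrite /= ?addr0 ?add0r.
have valE z : scheme_point (fibre D lambda) z ->
    z (tmonomial D (0, r0, r1)) = z y0 ^+ absz r0 * (z y0 ^+ p + lambda) ^+ absz r1.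
  move=> hz; have [z' zE] := point_morphism hz.
  rewrite uE (monD hA) ?rpredMn ?P0 // !(monMn hA) ?P0 // -zE rmorphM !rmorphXn /= zE.
  by rewrite y1E.
by rewrite (valE _ hx) (valE _ hx') xx'.
Qed.

(** If (0, 1, 0) is a sum, the summands have opposite degrees and last
    coordinates, so both are orthogonal to the two rays of the second segment,
    which are distinct. *)
Lemma y0_hilbert : hilbert_basis (total_monoid D) (0, 1, 0).
Proof.
split; [exact: P0|by rewrite !xpair_eqE|].
move=> [[s r0] r1] [[s' r0'] r1']; rewrite !total_monoidE /=.
move=> /and4P[u1 u2 u3 u4] /and4P[v1 v2 v3 v4].
move=> [sE rE r1E].
have s'E : s' = - s by apply/eqP; rewrite -addr_eq0 addrC -sE.
have r1'E : r1' = - r1 by apply/eqP; rewrite -addr_eq0 addrC -r1E.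
subst s' r1'.
have neg t : height t (- s, - r1) = - height t (s, r1) by rewrite /height /= !rmorphN /=; ring.
move: v3 v4; rewrite !neg !oppr_ge0 => v3 v4.
have e3 : height (beta1 D / p%:R) (s, r1) = 0 by apply/eqP; rewrite eq_le v3 u3.
have e4 : height (gamma1 D / p%:R) (s, r1) = 0 by apply/eqP; rewrite eq_le v4 u4.
have s0 : s = 0.
  have : (gamma1 D / p%:R - beta1 D / p%:R) * s%:~R = 0.
    by move: e3 e4; rewrite /height /= => e3 e4; rewrite -[RHS](subrr 0) -{1}e4 -e3; ring.
  by move/eqP; rewrite mulf_eq0 subr_eq0 (gt_eqF gap1) /= intr_eq0 => /eqP.
subst s; have r10 : r1 = 0.
  by move: e3; rewrite /height /= mulr0 add0r => /eqP; rewrite intr_eq0 => /eqP.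
subst r1; move: u1 v1; rewrite /height /= !oppr0 !mulr0 !add0r !ler0z => u1 v1.
have [r00|r00] := eqVneq r0 0; first by left; rewrite r00.
have r0'0 : r0' = 0 by move: u1 v1 rE r00; clear; lia.
by right; congr (_, _, _); rewrite r0'0.
Qed.

Lemma smooth_outside_vertices x : scheme_point (fibre D lambda) x ->
    (over_vertex x -> x y0 <> 0 /\ x y0 ^+ p <> - lambda) ->
  smooth_at (fibre D lambda) x.
Proof.
move=> hx nx.
have [x0|x0] := eqVneq (x y0) 0.
  by apply: (modelled_smooth (modelled_over_0 lambda_neq0 p_gt0 hx x0)) => /nx[].
have [xp|xp] := eqVneq (x y0 ^+ p) (- lambda).
  by apply: (modelled_smooth (modelled_over_root lambda_neq0 p_gt0 hx xp)) => /nx[].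
apply: (modelled_ray_smooth (u := (1, 0)) (modelled_elsewhere hx x0 xp)) => //.
by rewrite /height /= mul0r addr0.
Qed.

(** The second segment is not a point, so there is a vertex over each root. *)
Lemma root_vertices : exists xs : 'I_p -> (total_ring D -> R[i]),
  [/\ injective xs, forall j, scheme_point (fibre D lambda) (xs j),
      forall j, over_vertex (xs j), forall j, xs j y0 ^+ p = - lambda &
      forall x, scheme_point (fibre D lambda) x -> over_vertex x ->
        x y0 ^+ p = - lambda -> exists j, x = xs j].
Proof.
have nl : - lambda != 0 by rewrite oppr_eq0.
have [rt [rt_inj rtE rt_all]] := roots_of_number p_gt0 nl.
have [xs xsP] := choice (fun j => fibre_vertex (or_intror (conj (rtE j) gap1))).
exists xs; split.
- by move=> i j ij; apply: rt_inj; have [_ <- _] := xsP i; have [_ <- _] := xsP j; rewrite ij.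
- by move=> j; have [] := xsP j.
- by move=> j; have [] := xsP j.
- by move=> j; have [_ -> _] := xsP j.
move=> x hx vx /rt_all[j xj]; exists j; have [hj yj vj] := xsP j.
by apply: vertex_unique => //; rewrite xj yj.
Qed.
End FibrePoints.

(** * The generators of the dual cone *)

Section CyclicQuotient.
Context (n q : nat) (a : seq int) (w : seq (int * int)).
Hypotheses (n_ge3 : (3 <= n)%N) (q_bounds : (0 < q < n - 1)%N).
Hypothesis coprime_nq : coprime n q.
Hypothesis a_chain : expands n q a.
Hypothesis w_gens : minimal_generators n q a w.

Local Notation W := (wgen w).
Context (e : nat) (eE : size w = e).
Local Notation wx i := ((wgen w i).1).
Local Notation wy i := ((wgen w i).2).

Lemma size_gens : e = (size a + 2)%N. Proof. by rewrite -eE; case: w_gens. Qed.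

Lemma gen_mem i : (1 <= i <= e)%N -> W i \in w.
Proof. by case/andP; case: i => // i _ ie; rewrite /wgen mem_nth // eE. Qed.

Lemma gen_hilbert i : (1 <= i <= e)%N -> hilbert_basis (cqs_monoid n q) (W i).
Proof. by move=> /gen_mem; case: w_gens => _ _ wP _ _ /wP. Qed.

Lemma gen_cqs i : (1 <= i <= e)%N -> W i \in cqs_monoid n q.
Proof. by move=> /gen_hilbert[]. Qed.

Lemma gen_inj i j : (1 <= i <= e)%N -> (1 <= j <= e)%N -> W i = W j -> i = j.
Proof.
case: w_gens => _ uw _ _ _; case: i => // i; case: j => // j /= ie je.
by rewrite /wgen /= => /eqP; rewrite nth_uniq ?eE // => /eqP ->.
Qed.

Lemma gen_first : W 1 = (n%:Z, 0). Proof. by case: w_gens => _ _ _ []. Qed.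

Lemma gen_last : W e = (0, n%:Z).
Proof. by rewrite size_gens; case: w_gens => _ _ _ []. Qed.

Lemma gen_rec i : (2 <= i <= e - 1)%N -> W i.-1 + W i.+1 = W i *~ chain_entry a i.
Proof. by case: w_gens => sw _ _ _ H ie; apply: H; rewrite -sw eE. Qed.

Lemma entry_ge2 i : (2 <= i <= e - 1)%N -> 2 <= chain_entry a i.
Proof.
move=> /andP[i2 ie]; case: a_chain => /allP a2 _; apply: a2; rewrite mem_nth //.
by move: (size a) size_gens => s es; lia.
Qed.

Lemma gen_rec1 i : (2 <= i <= e - 1)%N -> wx i.-1 + wx i.+1 = wx i * chain_entry a i.
Proof. by move=> /gen_rec; rewrite pairMz => /(congr1 fst). Qed.

Lemma gen_rec2 i : (2 <= i <= e - 1)%N -> wy i.-1 + wy i.+1 = wy i * chain_entry a i.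
Proof. by move=> /gen_rec; rewrite pairMz => /(congr1 snd). Qed.

Lemma gen_x_ge0 i : (1 <= i <= e)%N -> 0 <= wx i.
Proof. by move=> /gen_cqs /and3P[]. Qed.

Lemma gen_y_ge0 i : (1 <= i <= e)%N -> 0 <= wy i.
Proof. by move=> /gen_cqs /and3P[]. Qed.

Let n_gt0 : 0 < n%:Z. Proof. by rewrite ltz_nat; lia. Qed.

Lemma axis_x_cqs x : ((x, 0) : int * int) \in cqs_monoid n q = (0 <= x) && (n%:Z %| x)%Z.
Proof. by rewrite -[_ \in _]/[&& _, _ & _] /= mulr0 addr0. Qed.

Lemma axis_y_cqs y :
  ((0, y) : int * int) \in cqs_monoid n q = (0 <= y) && (n%:Z %| y)%Z.
Proof. by rewrite -[_ \in _]/[&& _, _ & _] /= add0r Gauss_dvdzr. Qed.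

Let ge_dvd z : 0 <= z -> (n%:Z %| z)%Z -> z != 0 -> n%:Z <= z.
Proof.
move=> z0 /dvdzP[k zE] z_neq0; rewrite zE in z0 z_neq0 *.
rewrite -{1}[n%:Z]mul1r ler_pM2r //.
have k_neq0 : k != 0 by apply: contraNneq z_neq0 => ->; rewrite mul0r.
by move: z0; rewrite pmulr_lge0 // => k0; rewrite -gtz0_ge1 lt0r k_neq0.
Qed.

(** On the axis, every exponent is a multiple of the generator (n, 0), so no
    other one is irreducible. *)
Lemma gen_y_gt0 i : (1 < i <= e)%N -> 0 < wy i.
Proof.
move=> ie; have ie' : (1 <= i <= e)%N by lia.
rewrite lt0r gen_y_ge0 // andbT; apply/eqP => y0.
have [Wi Wi0 Wirr] := gen_hilbert ie'.
have WE : W i = (wx i, 0) by rewrite -y0 -surjective_pairing.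
have := Wi; rewrite WE axis_x_cqs => /andP[x0 dx].
have x_neq0 : wx i != 0 by apply: contra_neq Wi0 => x0'; rewrite WE x0'.
have xn := ge_dvd x0 dx x_neq0.
have [||||] := Wirr (n%:Z, 0) (wx i - n%:Z, 0).
- by rewrite axis_x_cqs dvdzz ltW.
- by rewrite axis_x_cqs subr_ge0 xn rpredB.
- by rewrite {1}WE; congr (_, _) => /=; ring.
- by case=> n0; have := n_gt0; rewrite n0.
case=> /eqP; rewrite subr_eq0 => /eqP xe.
have : W i = W 1 by rewrite WE xe gen_first.
by have ee : (1 <= 1 <= e)%N; [lia|move=> /(gen_inj ie' ee); lia].
Qed.

Lemma gen_x_gt0 i : (1 <= i < e)%N -> 0 < wx i.
Proof.
move=> ie; have ie' : (1 <= i <= e)%N by lia.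
rewrite lt0r gen_x_ge0 // andbT; apply/eqP => x0.
have [Wi Wi0 Wirr] := gen_hilbert ie'.
have WE : W i = (0, wy i) by rewrite -x0 -surjective_pairing.
have := Wi; rewrite WE axis_y_cqs // => /andP[y0 dy].
have y_neq0 : wy i != 0 by apply: contra_neq Wi0 => y0'; rewrite WE y0'.
have yn := ge_dvd y0 dy y_neq0.
have [||||] := Wirr (0, n%:Z) (0, wy i - n%:Z).
- by rewrite axis_y_cqs // dvdzz ltW.
- by rewrite axis_y_cqs // subr_ge0 yn rpredB.
- by rewrite {1}WE; congr (_, _) => /=; ring.
- by case=> n0; have := n_gt0; rewrite n0.
case=> /eqP; rewrite subr_eq0 => /eqP ye.
have : W i = W e by rewrite WE ye gen_last.
by have ee : (1 <= e <= e)%N; [lia|move=> /(gen_inj ie' ee); lia].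
Qed.

(** As the entries are at least 2, y_(i+1) - y_i >= y_i - y_(i-1). *)
Lemma gen_y_step i : (1 <= i < e)%N -> wy i < wy i.+1.
Proof.
elim: i => // i IHi /andP[_ ie]; case: i IHi ie => [_ ie|i IHi ie].
  by rewrite gen_first /= gen_y_gt0 //; lia.
have ii : (2 <= i.+2 <= e - 1)%N by lia.
have y_gt0 : 0 < wy i.+2 by apply: gen_y_gt0; lia.
have step : wy i.+1 < wy i.+2 by apply: IHi; lia.
have := entry_ge2 ii; have /= := gen_rec2 ii; nia.
Qed.

Lemma gen_x_step i : (1 <= i < e)%N -> wx i.+1 < wx i.
Proof.
move=> /andP[i1 ie]; have {ie}: (i + (e - i.+1) = e.-1)%N by lia.
move: (e - i.+1)%N => m; elim: m i i1 => [|m IHm] i i1 im.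
  have ei : i.+1 = e by lia.
  by rewrite ei gen_last /= gen_x_gt0 //; lia.
have step : wx i.+2 < wx i.+1 by apply: IHm; lia.
have ii : (2 <= i.+1 <= e - 1)%N by lia.
have x_gt0 : 0 < wx i.+1 by apply: gen_x_gt0; lia.
have := entry_ge2 ii; have /= := gen_rec1 ii; nia.
Qed.

Lemma gen_y_mono i j : (1 <= i)%N -> (i < j)%N -> (j <= e)%N -> wy i < wy j.
Proof.
move=> i1; elim: j => // j IHj; rewrite ltnS leq_eqVlt => /orP[/eqP <-|ij] je.
  by apply: gen_y_step; lia.
by apply: lt_trans (IHj ij (ltnW je)) _; apply: gen_y_step; lia.
Qed.

Lemma gen_x_mono i j : (1 <= i)%N -> (i < j)%N -> (j <= e)%N -> wx j < wx i.
Proof.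
move=> i1; elim: j => // j IHj; rewrite ltnS leq_eqVlt => /orP[/eqP <-|ij] je.
  by apply: gen_x_step; lia.
by apply: lt_trans (IHj ij (ltnW je)); apply: gen_x_step; lia.
Qed.

(** The exponent (n - q, 1) is irreducible, hence one of the generators; the
    second coordinates increase from 0. *)
Lemma gen_y2 : wy 2 = 1.
Proof.
pose v : int * int := (n%:Z - q%:Z, 1).
have v_in : v \in w.
  case: w_gens => _ _ wP _ _; apply/wP; split; [|by rewrite xpair_eqE andbF|].
    rewrite -[_ \in _]/[&& _, _ & _] /= mulr1 subrK dvdzz andbT subr_ge0 lez_nat; lia.
  have small x : ((x, 0) : int * int) \in cqs_monoid n q -> x <= n%:Z - q%:Z -> x = 0.
    rewrite axis_x_cqs => /andP[x0 dx] xle; apply/eqP; apply: contraT => x_neq0.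
    have := ge_dvd x0 dx x_neq0; lia.
  move=> [x1 y1] [x2 y2] v1 v2 [xE yE].
  have /and3P[/= x10 y10 _] := v1; have /and3P[/= x20 y20 _] := v2.
  have [y1E|y1E] := eqVneq y1 0.
    by left; subst y1; rewrite (small x1) //; lia.
  right; have y2E : y2 = 0 by lia.
  by subst y2; rewrite (small x2) //; lia.
have [i iw vE] : exists2 i, (i < size w)%N & W i.+1 = v.
  by exists (index v w); rewrite ?index_mem // /wgen nth_index.
rewrite eE in iw; have y1 : wy i.+1 = 1 by rewrite vE.
case: i iw y1 {vE} => [|i] iw y1; first by rewrite gen_first in y1.
case: i iw y1 => [//|i] iw y1.
have lt2 : wy 2 < wy i.+3 by apply: gen_y_mono; lia.
have : 0 < wy 2 by apply: gen_y_gt0; lia.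
lia.
Qed.

(** The recursion preserves the determinant of neighbours. *)
Lemma gen_det i : (1 <= i < e)%N -> det2 (W i.+1) (W i) = n%:Z.
Proof.
elim: i => // i IHi ie; case: i IHi ie => [_ ie|i IHi ie].
  by rewrite /det2 gen_first gen_y2 /= mulr0 subr0 mulr1.
rewrite -(IHi _); last by lia.
have rec1 := gen_rec1 (i := i.+2); have rec2 := gen_rec2 (i := i.+2).
have ii : (2 <= i.+2 <= e - 1)%N by lia.
move: (rec1 ii) (rec2 ii); rewrite /det2 /= => r1 r2.
have -> : wx i.+3 = wx i.+2 * chain_entry a i.+2 - wx i.+1 by rewrite -r1 addrC addKr.
have -> : wy i.+3 = wy i.+2 * chain_entry a i.+2 - wy i.+1 by rewrite -r2 addrC addKr.
by ring.
Qed.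

(** * The generators as affine functions on a slice *)

Context (R : realType) (h : nat).
Hypothesis h_bounds : (2 <= h <= e - 1)%N.
Context (o delta : R * R) (beta gamma : R).
Hypothesis Q_coords : slice_coordinates n q w h o delta beta gamma.

Lemma pairingD v1 v2 u : pairing (v1 + v2 : R * R) u = pairing v1 u + pairing v2 u.
Proof. by rewrite /pairing /=; ring. Qed.

Lemma pairing_line t u : pairing (line o delta t) u = t * pairing delta u + pairing o u.
Proof. by rewrite /pairing /line /=; ring. Qed.

Lemma pairing_integral v u : lattice_N n q v -> u \in cqs_monoid n q ->
  exists k : int, pairing (v : R * R) u = k%:~R.
Proof.
have n0 : n%:R != 0 :> R by rewrite pnatr_eq0; lia.
move=> [i [j [k ->]]] /and3P[_ _ /dvdzP[m mE]].
exists (i * u.1 + j * u.2 + k * m); rewrite /pairing /=.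
have : (u.1 + q%:Z * u.2)%:~R = (m * n%:Z)%:~R :> R by rewrite mE.
rewrite !rmorphD !rmorphM /= => mE'.
transitivity (i%:~R * u.1%:~R + j%:~R * u.2%:~R + k%:~R * (u.1%:~R + q%:~R * u.2%:~R) / n%:R :> R).
  by field.
by rewrite mE'; field.
Qed.

Lemma pairing_h t : pairing (line o delta t) (W h) = 1.
Proof.
case: Q_coords => L _ _ _.
have [_ p0] : lattice_N n q (line o delta 0%:~R) /\ pairing (line o delta 0%:~R) (W h) = 1.
  by apply/L; exists 0.
have [_ p1] : lattice_N n q (line o delta 1%:~R) /\ pairing (line o delta 1%:~R) (W h) = 1.
  by apply/L; exists 1.
move: p0 p1; rewrite !pairing_line mul0r add0r mul1r => p0.
by rewrite p0 => /(canRL (addrK _)); rewrite subrr => ->; rewrite mulr0 add0r.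
Qed.

Lemma lattice_line (k : int) : lattice_N n q (line o delta k%:~R).
Proof.
case: Q_coords => L _ _ _.
by have [] : lattice_N n q (line o delta k%:~R) /\ pairing (line o delta k%:~R) (W h) = 1
  by apply/L; exists k.
Qed.

Lemma pairing_delta_integral u : u \in cqs_monoid n q -> exists k : int, pairing delta u = k%:~R.
Proof.
move=> Mu; have [k0 E0] := pairing_integral (lattice_line 0) Mu.
have [k1 E1] := pairing_integral (lattice_line 1) Mu.
exists (k1 - k0); rewrite rmorphB /= -E0 -E1 !pairing_line mul0r mul1r; ring.
Qed.

Lemma pairing_o_integral u : u \in cqs_monoid n q -> exists k : int, pairing o u = k%:~R.
Proof.
move=> Mu; have [k E] := pairing_integral (lattice_line 0) Mu.
by exists k; rewrite -E pairing_line mul0r add0r.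
Qed.

Let x_gt0 : 0 < wx h. Proof. by apply: gen_x_gt0; lia. Qed.
Let y_gt0 : 0 < wy h. Proof. by apply: gen_y_gt0; lia. Qed.
Let xR_gt0 : 0 < (wx h)%:~R :> R. Proof. by rewrite ltr0z. Qed.
Let yR_gt0 : 0 < (wy h)%:~R :> R. Proof. by rewrite ltr0z. Qed.
Let nR_gt0 : 0 < n%:R :> R. Proof. by rewrite ltr0n; lia. Qed.

Lemma line_beta : line o delta beta = ((wx h)%:~R^-1, 0).
Proof.
case: Q_coords => _ _ pe _; have := pairing_h beta; move: pe.
rewrite eE gen_last; case: (line o delta beta) => b1 b2.
rewrite /pairing /= mulr0 add0r => /eqP.
rewrite mulf_eq0 -[n%:~R]/(n%:R) (gt_eqF nR_gt0) orbF => /eqP ->.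
by rewrite mul0r addr0 => /(canRL (mulfK (lt0r_neq0 xR_gt0))); rewrite mul1r => ->.
Qed.

Lemma line_gamma : line o delta gamma = (0, (wy h)%:~R^-1).
Proof.
case: Q_coords => _ _ _ pe; have := pairing_h gamma; move: pe.
rewrite gen_first; case: (line o delta gamma) => b1 b2.
rewrite /pairing /= mulr0 addr0 => /eqP.
rewrite mulf_eq0 -[n%:~R]/(n%:R) (gt_eqF nR_gt0) orbF => /eqP ->.
by rewrite mul0r add0r => /(canRL (mulfK (lt0r_neq0 yR_gt0))); rewrite mul1r => ->.
Qed.

(** The vector on the right joins two lattice points of the slice, so it is
    k delta for an integer k. Its pairing with w^(h+1) is 1 by [gen_det], so k
    divides 1. The sign is fixed by the orientation of the slice. *)
Lemma slice_delta : delta = (- ((wy h)%:~R / n%:R), (wx h)%:~R / n%:R).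
Proof.
pose eps : R * R := (- ((wy h)%:~R / n%:R), (wx h)%:~R / n%:R).
have n0 := lt0r_neq0 nR_gt0.
have [k epsE] : exists k : int, eps = (k%:~R * delta.1, k%:~R * delta.2).
  have [L _ _ _] := Q_coords.
  have hh : (1 <= h <= e)%N by lia.
  have [Mx My /dvdzP[m mE]] := and3P (gen_cqs hh).
  have [k kE] : exists k : int, o + eps = line o delta k%:~R.
    apply/L; split; last first.
      have := pairing_h 0; rewrite pairing_line mul0r add0r pairingD => ->.
      by rewrite /eps /pairing /=; field.
    have := lattice_line 0; rewrite /line !mul0r !addr0 -surjective_pairing.
    move=> [i [j [l ->]]].
    exists i, (j + m), (l - wy h); rewrite /eps; congr (_, _) => /=.
      by rewrite rmorphB /=; field.
    have xE : (wx h)%:~R = m%:~R * n%:R - q%:R * (wy h)%:~R :> R.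
      have : (wx h + q%:Z * wy h)%:~R = (m * n%:Z)%:~R :> R by rewrite mE.
      by rewrite rmorphD !rmorphM /= => <-; rewrite addrK.
    by rewrite xE rmorphB rmorphD /=; field.
  exists k; move: kE; rewrite /line; case: (eps) => e1 e2 /= [E1 E2].
  by congr (_, _); [apply: (addrI o.1)|apply: (addrI o.2)].
have d2 : 0 < delta.2.
  have bg : beta <= gamma.
    have [_ Q _ _] := Q_coords.
    have /Q/andP[] // : 0 <= (line o delta beta).1 /\ 0 <= (line o delta beta).2.
    by rewrite line_beta /= invr_ge0 ltW.
  have E : (gamma - beta) * delta.2 = (wy h)%:~R^-1.
    have := congr1 snd line_gamma; have := congr1 snd line_beta; rewrite /line /= => E1 <-.
    by rewrite -[RHS]subr0 -{1}E1; ring.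
  have : 0 < (gamma - beta) * delta.2 by rewrite E invr_gt0.
  move: bg; rewrite -subr_ge0 le_eqVlt => /orP[/eqP <-|bg]; first by rewrite mul0r ltxx.
  by rewrite pmulr_rgt0.
have k_gt0 : 0 < k.
  have : 0 < eps.2 by rewrite /eps /= divr_gt0.
  by rewrite epsE /= pmulr_lgt0 // ltr0z.
have [j jE] : exists j : int, pairing delta (W h.+1) = j%:~R.
  by apply: pairing_delta_integral; apply: (gen_cqs); lia.
have kj : k * j = 1.
  apply/eqP; rewrite -(eqr_int R) rmorphM /= -jE.
  have -> : k%:~R * pairing delta (W h.+1) = pairing eps (W h.+1).
    by rewrite epsE /pairing /=; ring.
  have ii : (1 <= h < e)%N by lia.
  have wE := congr1 (fun z : int => z%:~R : R) (gen_det ii).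
  rewrite /det2 rmorphB !rmorphM /= in wE.
  apply/eqP; transitivity (((wx h)%:~R * (wy h.+1)%:~R - (wx h.+1)%:~R * (wy h)%:~R) / n%:R :> R).
    by rewrite /eps /pairing /=; field.
  by rewrite wE divff.
have j_gt0 : 0 < j by rewrite -(pmulr_rgt0 _ k_gt0) kj.
have k1 : k = 1 by move: kj k_gt0 j_gt0; clear; nia.
by rewrite -/eps epsE k1 !mul1r -surjective_pairing.
Qed.

(** The slope of the affine function w^i on the slice, in the coordinate given
    by [o] and [delta], and its value at the origin [o]. Both are integers, so
    the floor does not change them. *)
Definition slice_vec (i : nat) : int * int :=
  (Num.floor (pairing delta (W i)), Num.floor (pairing o (W i))).
Local Notation us := slice_vec.

Lemma slice_vecE i : (1 <= i <= e)%N ->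
  (us i).1%:~R = pairing delta (W i) /\ (us i).2%:~R = pairing o (W i).
Proof.
move=> ie; have Mi := gen_cqs ie; rewrite /us /=.
have [k ->] := pairing_delta_integral Mi; have [l ->] := pairing_o_integral Mi.
by rewrite !intrKfloor.
Qed.

Lemma height_slice_vec t i : (1 <= i <= e)%N ->
  height t (us i) = pairing (line o delta t) (W i).
Proof. by move=> /slice_vecE[E1 E2]; rewrite /height E1 E2 pairing_line. Qed.

Lemma height_beta i : (1 <= i <= e)%N -> height beta (us i) = (wx i)%:~R / (wx h)%:~R.
Proof.
by move=> ie; rewrite height_slice_vec // line_beta /pairing /= mul0r addr0 mulrC.
Qed.

Lemma height_gamma i : (1 <= i <= e)%N -> height gamma (us i) = (wy i)%:~R / (wy h)%:~R.
Proof.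
by move=> ie; rewrite height_slice_vec // line_gamma /pairing /= mul0r add0r mulrC.
Qed.

Let hh : (1 <= h <= e)%N. Proof. by lia. Qed.

Lemma slice_vec_h : us h = (0, 1).
Proof.
have [E1 E2] := slice_vecE hh; have p0 := pairing_h 0; have p1 := pairing_h 1.
rewrite !pairing_line mul0r add0r mul1r in p0 p1.
have d0 : pairing delta (W h) = 0 by apply: (addIr (pairing o (W h))); rewrite add0r p1 p0.
rewrite (surjective_pairing (us h)); congr (_, _); apply/eqP; rewrite -(eqr_int R).
  by rewrite E1 d0.
by rewrite E2 p0.
Qed.

Lemma slice_vec_det i : (1 <= i < e)%N -> det2 (us i) (us i.+1) = 1.
Proof.
move=> ie; have ie1 : (1 <= i <= e)%N by lia. have ie2 : (1 <= i.+1 <= e)%N by lia.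
have [E1 E2] := slice_vecE ie1; have [E3 E4] := slice_vecE ie2.
apply/eqP; rewrite -(eqr_int R) /det2 rmorphB !rmorphM /= E1 E2 E3 E4.
have n0 := lt0r_neq0 nR_gt0.
have p0 := pairing_h 0; rewrite pairing_line mul0r add0r in p0.
have wE := congr1 (fun z : int => z%:~R : R) (gen_det ie).
rewrite /det2 rmorphB !rmorphM /= in wE.
apply/eqP; transitivity (((wx i)%:~R * (wy i.+1)%:~R - (wx i.+1)%:~R * (wy i)%:~R) / n%:R
  * pairing o (W h) : R).
  by rewrite slice_delta /pairing /=; field.
by rewrite wE p0 mulr1 divff.
Qed.

(** Slope and value depend linearly on the generator. *)
Lemma slice_vec_rec i : (2 <= i <= e - 1)%N ->
  us i.-1 + us i.+1 = us i *~ chain_entry a i.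
Proof.
move=> ie.
have ie0 : (1 <= i.-1 <= e)%N by lia. have ie1 : (1 <= i <= e)%N by lia.
have ie2 : (1 <= i.+1 <= e)%N by lia.
have [E1 E2] := slice_vecE ie0; have [E3 E4] := slice_vecE ie1.
have [E5 E6] := slice_vecE ie2.
have := gen_rec ie; rewrite !pairMz => rec.
have pr v : pairing v (W i.-1) + pairing v (W i.+1) =
    pairing (v : R * R) (W i) * (chain_entry a i)%:~R.
  have /= e1 := congr1 (fun z : int * int => (fst z)%:~R : R) rec.
  have /= e2 := congr1 (fun z : int * int => (snd z)%:~R : R) rec.
  rewrite !rmorphD !rmorphM /= in e1 e2.
  rewrite /pairing mulrDl -!mulrA -e1 -e2; ring.
rewrite (surjective_pairing (us i.-1)) (surjective_pairing (us i.+1)).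
congr (_, _); apply/eqP; rewrite -(eqr_int R) rmorphD rmorphM /=.
  by rewrite E1 E3 E5 pr.
by rewrite E2 E4 E6 pr.
Qed.

Lemma slice_vec_sign i : (1 <= i <= e)%N ->
  n%:Z * (us i).1 = wx h * wy i - wy h * wx i.
Proof.
move=> ie; have [E1 _] := slice_vecE ie; apply/eqP; rewrite -(eqr_int R).
rewrite rmorphB !rmorphM /= E1 slice_delta /pairing /= -[n%:~R]/(n%:R).
have n0 := lt0r_neq0 nR_gt0.
by apply/eqP; field.
Qed.

(** On the slice w^i takes the value x_i / x_h < 1 at the left end of the
    segment and y_i / y_h > 1 at the right end. *)
Lemma slice_vec_right i : (h < i <= e)%N -> 0 < (us i).1.
Proof.
move=> ie; have ie' : (1 <= i <= e)%N by lia.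
rewrite -(pmulr_rgt0 _ n_gt0) slice_vec_sign //.
have y : wy h < wy i by apply: gen_y_mono; lia.
have x : wx i < wx h by apply: gen_x_mono; lia.
have x0 := gen_x_ge0 ie'.
by move: y x x0 x_gt0 y_gt0; clear; nia.
Qed.

Lemma slice_vec_left i : (1 <= i < h)%N -> (us i).1 < 0.
Proof.
move=> ie; have ie' : (1 <= i <= e)%N by lia.
rewrite -(pmulr_rlt0 _ n_gt0) slice_vec_sign //.
have y : wy i < wy h by apply: gen_y_mono; lia.
have x : wx h < wx i by apply: gen_x_mono; lia.
have y0 := gen_y_ge0 ie'.
by move: y x y0 x_gt0 y_gt0; clear; nia.
Qed.

Lemma height_beta_gt0 i : (1 <= i < e)%N -> 0 < height beta (us i).
Proof.
by move=> ie; rewrite height_beta ?divr_gt0 ?ltr0z ?gen_x_gt0 //; lia.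
Qed.

Lemma height_gamma_gt0 i : (1 < i <= e)%N -> 0 < height gamma (us i).
Proof.
by move=> ie; rewrite height_gamma ?divr_gt0 ?ltr0z ?gen_y_gt0 //; lia.
Qed.

Lemma height_beta_last : height beta (us e) = 0.
Proof.
by rewrite height_beta ?gen_last /= ?mul0r //; lia.
Qed.

Lemma height_gamma_first : height gamma (us 1) = 0.
Proof.
by rewrite height_gamma ?gen_first /= ?mul0r //; lia.
Qed.

Lemma height_beta_next : height beta (us h.+1) < 1.
Proof.
rewrite height_beta; last by lia.
by rewrite ltr_pdivrMr // mul1r ltr_int; apply: gen_x_mono; lia.
Qed.

Lemma height_gamma_prev : height gamma (us h.-1) < 1.
Proof.
rewrite height_gamma; last by lia.
by rewrite ltr_pdivrMr // mul1r ltr_int; apply: gen_y_mono; lia.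
Qed.

(** On the points (k, 1, p) an exponent is an affine function of k, with slope
    its first coordinate. *)
Lemma restricts_first_coord D v i : (1 <= i <= e)%N ->
  restricts_to o delta D v (W i) -> v.1.1 = (us i).1.
Proof.
move=> ie r; have [] := slice_vecE ie; move: (us i) => u E1 E2.
have := r 0; have := r 1; rewrite !pairing_line /pairing' /= -E1 -E2 => r1 r0.
apply/eqP; rewrite -(eqr_int R); apply/eqP.
rewrite !mul0r !add0r !mul1r in r0 r1.
by apply: (addIr (u.2%:~R : R)); rewrite r1 r0 addrA.
Qed.

Lemma restricts_h D : restricts_to o delta D (0, 1, 0) (W h).
Proof. by move=> k; rewrite pairing_h /pairing' /= !mulr0 mul1r add0r addr0. Qed.

Lemma slice_vec_next : (us h.+1).1 = 1.
Proof.
have ie : (1 <= h < e)%N by lia.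
by have := slice_vec_det ie; rewrite slice_vec_h /det2 /= mulr1 mul0r subr0.
Qed.

Lemma slice_vec_prev : (us h.-1).1 = -1.
Proof.
have ie : (1 <= h.-1 < e)%N by lia.
have := slice_vec_det ie; rewrite prednK; last by lia.
by rewrite slice_vec_h /det2 mul0r mulr1 sub0r => /(canRL (@opprK _)).
Qed.

(** * The origin and the other fixed points *)

Section Origin.
Context (D : decomposition R) (lambda : R[i]).
Hypotheses (lambda_neq0 : lambda != 0) (p_gt0 : (0 < mult D)%N).
Hypothesis gap1 : beta1 D / (mult D)%:R < gamma1 D / (mult D)%:R.

(** The coordinate x_h is y0. *)
Lemma origin_y0 x : is_origin w h o delta x -> x (tmonomial D (0, 1, 0)) = 0.
Proof.
move=> ox; apply: (ox h) => //; [by rewrite eE|exact: (y0_hilbert gap1)|exact: restricts_h].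
Qed.

(** For i distinct from h the slope of w^i is not zero, so x_i is a monomial of
    nonzero degree. *)
Lemma vertex_origin x : over_vertex x -> x (tmonomial D (0, 1, 0)) = 0 ->
  is_origin w h o delta x.
Proof.
move=> vx x0 i v; rewrite eE => ie vP rv vh.
have [ih|ih] := eqVneq i h; first by rewrite vh.
apply: vx; first by case: vP.
rewrite (restricts_first_coord ie rv).
have [lt_ih|le_hi] := ltnP i h; first by rewrite lt_eqF // slice_vec_left //; lia.
by rewrite gt_eqF // slice_vec_right //; lia.
Qed.

(** A fixed point over y0 = 0 is the origin; the others are over the p roots of
    - lambda, where y1 vanishes. *)
Lemma singular_points : exists xs : 'I_(mult D) -> (total_ring D -> R[i]),
  [/\ injective xs,
      forall j, [/\ scheme_point (fibre D lambda) (xs j),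
        ~ is_origin w h o delta (xs j), over_vertex (xs j) &
        modelled_on lambda (beta1 D / (mult D)%:R) (gamma1 D / (mult D)%:R) (xs j)] &
      forall x, scheme_point (fibre D lambda) x ->
        ~ is_origin w h o delta x -> (forall j, x <> xs j) ->
        smooth_at (fibre D lambda) x].
Proof.
have [xs [xs_inj hxs vxs rootxs allxs]] := root_vertices lambda_neq0 p_gt0 gap1.
exists xs; split=> // [j|x hx nx nxs].
  split=> //; last exact: modelled_over_root.
  move=> /origin_y0 y0; have := rootxs j; rewrite y0 expr0n gtn_eqF // => /eqP.
  by rewrite eq_sym oppr_eq0 (negPf lambda_neq0).
apply: (smooth_outside_vertices lambda_neq0 p_gt0 hx) => vx; split=> [y0|yp].
  by apply/nx/vertex_origin.
by have [j /nxs] := allxs _ hx vx yp.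
Qed.

Lemma vertex_singularity (b : seq int) : beta0 D < gamma0 D ->
    (forall x, modelled_on lambda (beta0 D) (gamma0 D) x -> over_vertex x ->
      chain_singularity b (fibre D lambda) x) ->
  origin_singularity w h o delta D lambda b.
Proof.
move=> bg sing.
have [x [hx x0 vx]] := fibre_vertex (lambda := lambda) (or_introl (conj (erefl 0) bg)).
left; exists x; split=> //; first exact: vertex_origin.
by apply: sing => //; apply: modelled_over_0.
Qed.
End Origin.

(** With a single entry in the chain, w^2 would be (1, 1), so n would divide
    1 + q. *)
Lemma size_ge4 : (4 <= e)%N.
Proof.
rewrite ltnNge; apply/negP => e3; have {}e3 : e = 3 by lia.
have i2 : (2 <= 2 <= e - 1)%N by lia.
have W3 := gen_last; rewrite [in W e]e3 in W3.
have := gen_rec2 i2; rewrite /= gen_first gen_y2 W3 /= mul1r add0r => cE.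
have := gen_rec1 i2; rewrite /= gen_first W3 /= addr0 -cE => nE.
have x1 : wx 2 = 1.
  have /eqP : (wx 2 - 1) * n%:Z = 0 by rewrite mulrBl mul1r -nE subrr.
  by rewrite mulf_eq0 subr_eq0 (gt_eqF n_gt0) orbF => /eqP.
have i2' : (1 <= 2 <= e)%N by lia.
have := gen_cqs i2'; rewrite -[_ \in _]/[&& _, _ & _] => /and3P[_ _].
rewrite gen_y2 mulr1 x1.
by rewrite -PoszD -[(_ %| _)%Z]/(_ %| _)%N => /dvdn_leq; lia.
Qed.

Lemma size_chain : size a = (e - 2)%N.
Proof. by rewrite size_gens addnK. Qed.

Lemma chain_entryE i : chain_entry a i.+2 = nth 0 a i.
Proof. by rewrite /chain_entry !subSS subn0. Qed.

Lemma slice_vec_rec2 i : (i < e - 2)%N -> us i.+1 + us i.+3 = us i.+2 *~ nth 0 a i.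
Proof.
move=> ie; have ie' : (2 <= i.+2 <= e - 1)%N by lia.
by have := slice_vec_rec ie'; rewrite chain_entryE.
Qed.

(** * Splitting off a lattice segment *)

Section FirstFamily.
Context (p d : nat).
Hypotheses (p_gt0 : (0 < p)%N) (d_gt0 : (0 < d)%N).
Hypothesis pd_le : (p * d)%:R <= gamma - beta.

Let k : int := (p * d)%:Z.
Let gamma' : R := gamma - (p * d)%:R.
(** The exponents on the left of w^h are sheared, which moves the right end of
    the segment from gamma to gamma - k and fixes us h = (0, 1). *)
Let z (i : nat) : int * int := if (i.+1 < h)%N then shear k (us i.+1) else us i.+1.
Let b := take (h - 2) a ++ (chain_entry a h - (d * p)%:Z) :: drop (h - 1) a.

Let sizeb : size b = (e - 2)%N.
Proof.
rewrite size_cat /= size_takel ?size_drop size_chain; last by lia.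
by lia.
Qed.

Let z_left i : (i < h)%N -> z i = shear k (us i.+1).
Proof.
rewrite /z => ih; case: ltnP => // hi.
have -> : i.+1 = h by apply/eqP; rewrite eqn_leq ih.
by rewrite slice_vec_h /shear /= mulr0 addr0.
Qed.

Let z_right i : (h <= i.+1)%N -> z i = us i.+1.
Proof. by rewrite /z ltnNge => ->. Qed.

Let b_entry i : (i < e - 2)%N ->
  nth 0 b i = if i.+2 == h then nth 0 a i - k else nth 0 a i.
Proof.
move=> ie; rewrite nth_cat size_takel; last by rewrite size_chain; lia.
case: (ltngtP i.+2 h) => ih.
- by rewrite nth_take; [rewrite ifT //|]; lia.
- rewrite ifF; last by lia.
  have -> : (i - (h - 2) = (i - (h - 1)).+1)%N by lia.
  by rewrite /= nth_drop; congr (nth _ _ _); lia.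
rewrite ifF; last by lia.
have -> : (i - (h - 2) = 0)%N by lia.
by rewrite /= -ih chain_entryE /k mulnC.
Qed.

Let zrec i : (i < size b)%N -> z i + z i.+2 = z i.+1 *~ nth 0 b i.
Proof.
rewrite sizeb => ie; rewrite b_entry //; have rec := slice_vec_rec2 ie.
case: (ltngtP i.+2 h) => ih.
- rewrite !z_left; [by rewrite -shearD rec shearMz|lia..].
- rewrite !z_right; [by rewrite rec|lia..].
rewrite (z_left (i := i)) ?(z_right (i := i.+1)) ?(z_right (i := i.+2)); try lia.
have s1 : (us i.+1).1 = -1 by rewrite -slice_vec_prev -ih.
have us_h : us i.+2 = (0, 1) by rewrite ih slice_vec_h.
move: rec s1; rewrite us_h !pairMz !mul0r !mul1r.
move: (us i.+1) (us i.+3) => [u1 u2] [v1 v2] [E1 E2] /= s1.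
congr (_, _); first exact: E1.
by rewrite -E2 s1 /shear /=; ring.
Qed.

Let zl : z (size b).+1 = us e.
Proof. by rewrite sizeb z_right; [congr us|]; lia. Qed.

Let h_gamma' i : height gamma' (shear k (us i)) = height gamma (us i).
Proof. by rewrite height_shear /gamma' /k subrK. Qed.

Let bg' : beta <= gamma'.
Proof. by rewrite /gamma' lerBrDl -lerBrDr. Qed.

Let sb : (0 < size b)%N. Proof. by rewrite sizeb; lia. Qed.

Let zdet : det2 (z 0%N) (z 1%N) = 1.
Proof.
by rewrite !z_left; [rewrite det2_shear slice_vec_det| |]; lia.
Qed.

Let z0 : height gamma' (z 0%N) = 0.
Proof. by rewrite z_left; [rewrite h_gamma' height_gamma_first|lia]. Qed.

Let zpos i : (1 <= i <= size b)%N -> 0 < height beta (z i) + height gamma' (z i).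
Proof.
rewrite sizeb => ie; case: (ltngtP i.+1 h) => ih.
- rewrite z_left ?(ltnW ih) //.
  have s_lt : (us i.+1).1 < 0 by apply: slice_vec_left; lia.
  have g_gt0 : 0 < height gamma' (shear k (us i.+1)).
    by rewrite h_gamma' height_gamma_gt0 //; lia.
  have := height_ge (v := shear k (us i.+1)) bg' (ltW s_lt).
  by move=> le_gb; rewrite addr_gt0 // (lt_le_trans g_gt0).
- rewrite z_right; last by lia.
  have s_gt : 0 < (us i.+1).1 by apply: slice_vec_right; lia.
  have b_gt0 : 0 < height beta (us i.+1) by rewrite height_beta_gt0 //; lia.
  have := height_le (v := us i.+1) bg' (ltW s_gt).
  by move=> le_bg; rewrite addr_gt0 // (lt_le_trans b_gt0).
rewrite z_right ?ih // slice_vec_h.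
by rewrite !height_unit addr_gt0.
Qed.

Let z0_left : (z 0%N).1 < 0.
Proof. by rewrite z_left; [apply: slice_vec_left|]; lia. Qed.

Let zl_right : 0 < (z (size b).+1).1.
Proof. by rewrite zl; apply: slice_vec_right; lia. Qed.

Let zl0 : height beta (z (size b).+1) = 0.
Proof. by rewrite zl height_beta_last. Qed.

Let D := decomposition_D beta gamma p d.

Let b1E : beta1 D / (mult D)%:R = 0. Proof. by rewrite /D /= mul0r. Qed.

Let g1E : gamma1 D / (mult D)%:R = d%:R.
Proof. by rewrite /D /= natrM mulrC mulKf // pnatr_eq0 -lt0n. Qed.

Let gap1 : beta1 D / (mult D)%:R < gamma1 D / (mult D)%:R.
Proof. by rewrite b1E g1E ltr0n. Qed.

(** When k is the length of the segment, the first summand is a point and the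
    second alternative of [origin_singularity] holds. *)
Lemma first_family_origin (lambda : R[i]) : lambda != 0 ->
  origin_singularity w h o delta D lambda b.
Proof.
move=> lambda_neq0.
have [lt_bg|bg] := ltrP beta gamma'.
  apply: (vertex_singularity lambda_neq0) => // x mx vx.
  exact: (fan_singularity zrec zdet z0 zl0 zpos z0_left zl_right lt_bg sb mx vx).
have {bg} bg : beta = gamma' by apply/eqP; rewrite eq_le bg' bg.
right; split.
  apply: (fan_blows_down zrec zdet z0 zl0 zpos bg).
  by rewrite sizeb; have := size_ge4; lia.
move=> x hx /(origin_y0 gap1) x0.
have mx := modelled_over_0 (D := D) lambda_neq0 p_gt0 hx x0.
rewrite [gamma0 D](_ : _ = beta0 D) in mx; last by rewrite /= bg.
apply: (modelled_ray_smooth (u := us e) mx); last exact: height_beta_last.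
by rewrite gt_eqF //; apply: slice_vec_right; lia.
Qed.

Lemma first_family_singular_points (lambda : R[i]) : lambda != 0 ->
  exists xs : 'I_p -> (total_ring D -> R[i]),
    [/\ injective xs,
        forall j, [/\ scheme_point (fibre D lambda) (xs j),
                      ~ is_origin w h o delta (xs j) &
                      A_singularity d (fibre D lambda) (xs j)] &
        forall x, scheme_point (fibre D lambda) x ->
          ~ is_origin w h o delta x -> (forall j, x <> xs j) ->
          smooth_at (fibre D lambda) x].
Proof.
move=> lambda_neq0.
have [xs [xs_inj xsP smooth]] := singular_points (D := D) lambda_neq0 p_gt0 gap1.
exists xs; split=> // j; have [hj nj vj] := xsP j; rewrite b1E g1E => mj; split=> //.
exact: type_A_at_vertex.
Qed.
End FirstFamily.

(** * Cutting the segment at a lattice point *)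

(** The part of the segment to the left of the lattice point [c]: on the right of
    w^h the fan is unchanged, and it starts with the vector (-1, c), which
    vanishes at [c]. *)
Section RightFan.
Context (c : int) (beta_lt_c : beta < c%:~R).
Let b := (c + (us h.+1).2) :: drop (h - 1) a.
Let z (i : nat) : int * int := if i == 0%N then (-1, c) else us (h.-1 + i).

Let sizeb : size b = (e - h)%N.
Proof. by rewrite /= size_drop size_chain; lia. Qed.

Let zrec i : (i < size b)%N -> z i + z i.+2 = z i.+1 *~ nth 0 b i.
Proof.
rewrite sizeb /z; case: i => [|i] ie /=.
  have -> : (h.-1 + 2 = h.+1)%N by lia.
  have -> : (h.-1 + 1 = h)%N by lia.
  rewrite [us h.+1]surjective_pairing slice_vec_next slice_vec_h pairMz mul0r mul1r.
  by congr (_, _).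
have ie' : (h.-1 + i < e - 2)%N by lia.
rewrite nth_drop !addnS (slice_vec_rec2 ie'); congr (_ *~ nth _ _ _); lia.
Qed.

Let zl : z (size b).+1 = us e.
Proof. by rewrite sizeb /z /=; congr us; lia. Qed.

Let zpos i : (1 <= i <= size b)%N -> 0 < height beta (z i) + height c%:~R (z i).
Proof.
rewrite sizeb /z => /andP[i1 ie]; rewrite gtn_eqF //.
have [i0|i_neq1] := eqVneq i 1%N.
  have -> : (h.-1 + i = h)%N by lia.
  by rewrite slice_vec_h !height_unit addr_gt0.
have s_gt : 0 < (us (h.-1 + i)).1 by apply: slice_vec_right; lia.
have b_gt0 : 0 < height beta (us (h.-1 + i)) by rewrite height_beta_gt0 //; lia.
have := height_le (v := us (h.-1 + i)) (ltW beta_lt_c) (ltW s_gt).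
by move=> le_bc; rewrite addr_gt0 // (lt_le_trans b_gt0).
Qed.

Lemma right_fan_singularity (D : decomposition R) (lambda : R[i]) x :
  modelled_on lambda beta c%:~R x -> over_vertex x -> chain_singularity b (fibre D lambda) x.
Proof.
move=> mx vx.
apply: (fan_singularity zrec _ _ _ zpos _ _ beta_lt_c _ mx vx) => //.
- have z1 : z 1 = (0, 1) by rewrite /z /= addn1 prednK ?slice_vec_h //; lia.
  by rewrite z1 /det2 /= mul0r mulN1r opprK.
- by rewrite /height /= mulrN1 addNr.
- by rewrite zl height_beta_last.
by rewrite zl; apply: slice_vec_right; lia.
Qed.
End RightFan.

(** The part of the segment to the right of [c], translated by [- c] to start at
    0: on the left of w^h the fan is unchanged, and it ends with (1, 0), which
    vanishes at 0. *)
Section LeftFan.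
Context (c : int) (c_lt_gamma : c%:~R < gamma).
Let b := rcons (take (h - 2) a) ((us h.-1).2 - c).
Let z (i : nat) : int * int := if (i < h)%N then shear c (us i.+1) else (1, 0).

Let sizeb : size b = h.-1.
Proof. by rewrite size_rcons size_takel ?size_chain; lia. Qed.

Let z_lt i : (i < h)%N -> z i = shear c (us i.+1).
Proof. by rewrite /z => ->. Qed.

Let zrec i : (i < size b)%N -> z i + z i.+2 = z i.+1 *~ nth 0 b i.
Proof.
rewrite sizeb => ih; rewrite nth_rcons size_takel ?size_chain; last by lia.
have [ih2|ih2] := ltnP i (h - 2).
  have ie : (i < e - 2)%N by lia.
  rewrite nth_take // !z_lt; [|lia..].
  by rewrite -shearD (slice_vec_rec2 ie) shearMz.
have iE : i = (h - 2)%N by lia.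
rewrite iE eqxx (z_lt (i := (h - 2)%N)) ?(z_lt (i := (h - 2).+1)); [|lia..].
have -> : z (h - 2).+2 = (1, 0) by rewrite /z ltnNge; case: leqP => //; lia.
have -> : (h - 2).+1 = h.-1 by lia.
rewrite prednK; last by lia.
rewrite [us h.-1]surjective_pairing slice_vec_prev slice_vec_h pairMz /shear /=.
by congr (_, _) => /=; ring.
Qed.

Let zl : z (size b).+1 = (1, 0).
Proof. by rewrite sizeb prednK ?/z ?ltnn //; lia. Qed.

Let zdet : det2 (z 0%N) (z 1%N) = 1.
Proof. by rewrite !z_lt; [rewrite det2_shear slice_vec_det| |]; lia. Qed.

Let zpos i : (1 <= i <= size b)%N ->
  0 < height 0 (z i) + height (gamma - c%:~R) (z i).
Proof.
rewrite sizeb => ih; rewrite z_lt; last by lia.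
rewrite !height_shear add0r subrK.
have g_gt0 : 0 < height gamma (us i.+1) by rewrite height_gamma_gt0 //; lia.
suff le_gc : height gamma (us i.+1) <= height c%:~R (us i.+1).
  by rewrite addr_gt0 // (lt_le_trans g_gt0).
apply: height_ge (ltW c_lt_gamma) _.
have [->|ih'] := eqVneq i.+1 h; first by rewrite slice_vec_h.
by apply/ltW/slice_vec_left; lia.
Qed.

Lemma left_fan_singularity (D : decomposition R) (lambda : R[i]) x :
    modelled_on lambda 0 (gamma - c%:~R) x -> over_vertex x ->
  chain_singularity b (fibre D lambda) x.
Proof.
move=> mx vx; apply: (fan_singularity zrec zdet _ _ zpos _ _ _ _ mx vx) => //.
- by rewrite z_lt ?height_shear ?subrK ?height_gamma_first //; lia.
- by rewrite zl /height /= mul0r addr0.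
- by rewrite z_lt; [apply: slice_vec_left|]; lia.
- by rewrite zl.
- by rewrite subr_gt0.
by rewrite sizeb; lia.
Qed.
End LeftFan.

Section SecondFamily.
Hypothesis h_inner : (2 < h < e - 1)%N.

(** The functions w^(h-1) and w^(h+1) are kl - t and kr + t. Their values at
    gamma and beta are between 0 and 1, so kl - 1 and 1 - kr are the lattice
    points of the segment next to its ends, and kl + kr = a_h. *)
Let kl : int := (us h.-1).2.
Let kr : int := (us h.+1).2.

Let us_prev : us h.-1 = (-1, kl).
Proof. by rewrite -slice_vec_prev -surjective_pairing. Qed.

Let us_next : us h.+1 = (1, kr).
Proof. by rewrite -slice_vec_next -surjective_pairing. Qed.

Let entry_h : kl + kr = chain_entry a h.
Proof.
have := slice_vec_rec h_bounds; rewrite us_prev us_next slice_vec_h pairMz.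
by move=> /(congr1 snd) /=; rewrite mul1r.
Qed.

Let beta_floor : - kr%:~R < beta < (1 - kr)%:~R.
Proof.
have h1 := height_beta_next; have : (1 <= h.+1 < e)%N by lia.
move/height_beta_gt0; move: h1; rewrite us_next /height mulr1 rmorphB /=.
by move=> h1 h2; apply/andP; split; move: h1 h2; lra.
Qed.

Let gamma_floor : (kl - 1)%:~R < gamma < kl%:~R.
Proof.
have h1 := height_gamma_prev; have : (1 < h.-1 <= e)%N by lia.
move/height_gamma_gt0; move: h1; rewrite us_prev /height rmorphB mulrN1 /=.
by move=> h1 h2; apply/andP; split; move: h1 h2; lra.
Qed.

Let lattice_pointE (k : int) : (beta <= k%:~R <= gamma) = (1 - kr <= k <= kl - 1).
Proof.
move: beta_floor gamma_floor => /andP[b1 b2] /andP[g1 g2].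
apply/andP/andP => [[bk kg]|[bk kg]]; split.
- have : - kr < k by rewrite -(ltr_int R) rmorphN /=; apply: lt_le_trans bk.
  by clear; lia.
- have : k < kl by rewrite -(ltr_int R); apply: le_lt_trans g2.
  by clear; lia.
- by apply: le_trans (ltW b2) _; rewrite ler_int.
by apply: le_trans _ (ltW g1); rewrite ler_int.
Qed.

Lemma nb_lattice_points_slice :
  (nb_lattice_points beta gamma)%:Z = chain_entry a h - 1.
Proof.
have a2 := entry_ge2 h_bounds.
pose m := absz (chain_entry a h - 1)%R.
have mE : m%:Z = chain_entry a h - 1 by rewrite gez0_abs // subr_ge0; apply: le_trans a2.
pose s : seq int := [seq (1 - kr) + i%:Z | i <- iota 0 m].
have su : uniq s by rewrite map_inj_uniq ?iota_uniq // => i j /addrI[].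
have sE (k : int) : (k \in s) = (beta <= k%:~R <= gamma).
  rewrite lattice_pointE; apply/mapP/idP => [[j]|/andP[k1 k2]].
    rewrite mem_iota add0n => /andP[_ jm] ->; move: jm; rewrite -ltz_nat mE -entry_h.
    by clear; lia.
  have iE : Posz (absz (k - (1 - kr))%R) = k - (1 - kr) by rewrite gez0_abs // subr_ge0.
  exists (absz (k - (1 - kr))%R); last by rewrite iE addrC subrK.
  by rewrite mem_iota add0n /= -ltz_nat iE mE -entry_h; move: k2; clear; lia.
rewrite -mE /nb_lattice_points.
have -> : [set k : int | beta <= k%:~R <= gamma]%classic = [set` [fset x in s]%fset]%classic.
  by apply/seteqP; split=> k /=; rewrite inE sE.
by rewrite set_fsetK card_fseq undup_id // size_map size_iota.
Qed.

Context (d : nat).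
Hypothesis d_bounds : (1 <= d <= nb_lattice_points beta gamma)%N.

Let D := decomposition_Dbar beta gamma d.
(** the lattice point at which the decomposition cuts the segment *)
Let c : int := kl - d%:Z.

Let d_lt : d%:Z <= chain_entry a h - 1.
Proof. by rewrite -nb_lattice_points_slice lez_nat; case/andP: d_bounds. Qed.

Let gamma0E : gamma0 D = c%:~R.
Proof.
rewrite /D /=; congr (_%:~R); apply/eqP; rewrite ceil_eq.
have -> : (nb_lattice_points beta gamma)%:R = (kl + kr - 1)%:~R :> R.
  by rewrite entry_h -nb_lattice_points_slice.
move: beta_floor; rewrite /c !(rmorphB, rmorphD) /= => /andP[b1 b2].
by apply/andP; split; move: b1 b2; lra.
Qed.

Let beta_lt_c : beta < c%:~R.
Proof.
case/andP: beta_floor => _ b2; apply: lt_le_trans b2 _; rewrite ler_int /c.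
by move: d_lt; rewrite -entry_h; clear; lia.
Qed.

Let c_lt_gamma : c%:~R < gamma.
Proof.
case/andP: gamma_floor => g1 _; apply: le_lt_trans g1; rewrite ler_int /c.
by case/andP: d_bounds => d1 _; move: d1; clear; lia.
Qed.

Let b1E : beta1 D / (mult D)%:R = 0. Proof. by rewrite /D /= mul0r. Qed.

Let g1E : gamma1 D / (mult D)%:R = gamma - c%:~R.
Proof. by rewrite -gamma0E /D /= divr1. Qed.

Let gap1 : beta1 D / (mult D)%:R < gamma1 D / (mult D)%:R.
Proof. by rewrite b1E g1E subr_gt0. Qed.

Lemma second_family_origin (lambda : R[i]) : lambda != 0 ->
  origin_singularity w h o delta D lambda ((chain_entry a h - d%:Z) :: drop (h - 1) a).
Proof.
move=> lambda_neq0; apply: (vertex_singularity lambda_neq0) => //.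
  by rewrite gamma0E.
rewrite gamma0E => x mx vx.
have := right_fan_singularity beta_lt_c mx vx.
by rewrite /c -/kr addrAC entry_h.
Qed.

Lemma second_family_singular_points (lambda : R[i]) : lambda != 0 ->
  exists y : total_ring D -> R[i],
    [/\ scheme_point (fibre D lambda) y,
        ~ is_origin w h o delta y,
        chain_singularity (rcons (take (h - 2) a) d%:Z) (fibre D lambda) y &
        forall x, scheme_point (fibre D lambda) x ->
          ~ is_origin w h o delta x -> x <> y ->
          smooth_at (fibre D lambda) x].
Proof.
move=> lambda_neq0.
have [xs [_ xsP smooth]] := singular_points (D := D) lambda_neq0 isT gap1.
have [hy ny vy my] := xsP ord0; exists (xs ord0); split=> //.
  rewrite b1E g1E in my.
  by have := left_fan_singularity c_lt_gamma my vy; rewrite /c -/kl subKr.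
by move=> x hx nx xy; apply: smooth => // j; rewrite ord1.
Qed.
End SecondFamily.
End CyclicQuotient.

(** * The singularities of the general fibre *)

Theorem proposition4p1 (R : realType) (n q : nat) (a : seq int)
    (w : seq (int * int)) (h : nat) (o delta : R * R) (beta gamma : R)
    (n_ge3 : (3 <= n)%N) (q_bounds : (0 < q < n - 1)%N)
    (coprime_nq : coprime n q)
    (a_chain : expands n q a)
    (w_gens : minimal_generators n q a w)
    (h_bounds : (2 <= h <= size w - 1)%N)
    (Q_coords : slice_coordinates n q w h o delta beta gamma) :
  (forall p d : nat, (0 < p)%N -> (0 < d)%N -> (p * d)%:R <= gamma - beta ->
     let D := decomposition_D beta gamma p d in
     general (fun lambda : R[i] =>
       origin_singularity w h o delta D lambda
         (take (h - 2) a ++ (chain_entry a h - (d * p)%:Z) :: drop (h - 1) a)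
       /\ exists xs : 'I_p -> (total_ring D -> R[i]),
          [/\ injective xs,
              forall j, [/\ scheme_point (fibre D lambda) (xs j),
                            ~ is_origin w h o delta (xs j) &
                            A_singularity d (fibre D lambda) (xs j)] &
              forall x, scheme_point (fibre D lambda) x ->
                ~ is_origin w h o delta x -> (forall j, x <> xs j) ->
                smooth_at (fibre D lambda) x]))
  /\
  ((2 < h < size w - 1)%N ->
   forall d : nat, (1 <= d <= nb_lattice_points beta gamma)%N ->
     let D := decomposition_Dbar beta gamma d in
     general (fun lambda : R[i] =>
       origin_singularity w h o delta D lambda
         ((chain_entry a h - d%:Z) :: drop (h - 1) a)
       /\ exists y : total_ring D -> R[i],
          [/\ scheme_point (fibre D lambda) y,
              ~ is_origin w h o delta y,
              chain_singularity (rcons (take (h - 2) a) d%:Z)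
                (fibre D lambda) y &
              forall x, scheme_point (fibre D lambda) x ->
                ~ is_origin w h o delta x -> x <> y ->
                smooth_at (fibre D lambda) x])).
Proof.
(* only the special fibre is excluded *)
split=> [p d p_gt0 d_gt0 pd_le|h_inner d d_bounds]; exists [:: 0] => lambda;
  rewrite inE => lambda_neq0; split.
- exact: (first_family_origin n_ge3 q_bounds coprime_nq a_chain w_gens erefl).
- exact: (first_family_singular_points n_ge3 q_bounds coprime_nq a_chain w_gens erefl).
- exact: (second_family_origin n_ge3 q_bounds coprime_nq a_chain w_gens erefl).
exact: (second_family_singular_points n_ge3 q_bounds coprime_nq a_chain w_gens erefl).
Qed.
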